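(* Let $T>0$, $\alpha\in(0,1)$, and for $i=1,2$ let $b_i>0$ and $u_0^i$ be data satisfying: $u_0^i\in H^{1+\alpha}(0,b_i)$, $(u_0^i)'\in{}_0H^\alpha(0,b_i)$, $u_0^i(b_i)=0$, $u_0^i\ge0$, $u_0^i\not\equiv0$, and $u_0^i(x)\le \frac{M_i\Gamma(2-\alpha)}{b_i^{1-\alpha}}(b_i-x)$ on $[0,b_i]$ for some $M_i>0$. Let $(u^i,s_i)$ be the solution (in the class: $s_i\in C^{0,1}([0,T])$, $0<\dot s_i\le M_i$ a.e., $u^i\in C(\overline{Q_{s_i,T}})$, $u^i_t,\partial_xD^\alpha u^i\in C(Q_{s_i,T})$, $u^i_x$ continuous on $\overline{Q_{s_i,T}}$ (for $\alpha>\frac12$) resp. on $\overline{Q_{s_i,T}}\setminus(\{t=0\}\times[0,b_i])$ (for $\alpha\le\frac12$), and $u^i(\cdot,t)\in W^{2,\frac1{1-\beta}}(\varepsilon,\omega)$ for some $\beta\in(\alpha,1)$, all $t\in(0,T]$, $0<\varepsilon<\omega<s_i(t)$) of the problem $$\begin{cases} u_t-\partial_x D^{\alpha} u=0 & \text{in } Q_{s,T}=\{(x,t):0<x<s(t),\ 0<t<T\},\\ u_x(0,t)=0,\quad u(s(t),t)=0 & t\in(0,T),\\ u(x,0)=u_0^i(x) & 0<x<s(0)=b_i,\\ \dot s(t)=-(D^{\alpha}u)(s(t),t) & t\in(0,T).\end{cases}$$ If $b_1\le b_2$ and $u_0^1\le u_0^2$, then $s_1(t)\le s_2(t)$ for every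 $t\in[0,T]$.
   Context: For $\alpha\in(0,1)$ the Caputo derivative in $x$ is $D^{\alpha}f(x)=\frac{1}{\Gamma(1-\alpha)}\frac{\partial}{\partial x}\int_0^x(x-p)^{-\alpha}[f(p)-f(0)]\,dp$. $H^\gamma$ are fractional Sobolev spaces; ${}_0H^{\gamma}(0,L)=H^\gamma(0,L)$ for $\gamma<\frac12$, $=\{u\in H^{1/2}(0,L):\int_0^L|u|^2/x\,dx<\infty\}$ for $\gamma=\frac12$, $=\{u\in H^\gamma(0,L):u(0)=0\}$ for $\gamma\in(\frac12,1)$. The inequality $u_0^1\le u_0^2$ is understood on $[0,b_1]$ (where both are defined). *)

(* Defs.v *)
From mathcomp Require Import all_boot all_order all_algebra.
From mathcomp Require Import all_classical all_reals all_analysis.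
Import Order.TTheory GRing.Theory Num.Theory numFieldNormedType.Exports.
Set Implicit Arguments. Unset Strict Implicit. Unset Printing Implicit Defensive.
Local Open Scope classical_set_scope.
Local Open Scope ring_scope.

Section Defs.
Variable R : realType.
Local Notation leb := (@lebesgue_measure R).

Definition Gamma (z : R) : R :=
  Rintegral leb `]0, +oo[ (fun x => x `^ (z - 1) * expR (- x)).

Definition Lp (p a b : R) (f : R -> R) : Prop :=
  measurable_fun `]a, b[ f /\
  (\int[leb]_(x in `]a, b[) (`|f x| `^ p)%:E < +oo)%E.

Definition L2 (a b : R) (f : R -> R) : Prop := Lp 2 a b f.

Definition test_fun (a b : R) (phi : R -> R) : Prop :=
  (forall (n : nat) (x : R), derivable (derive1n n phi) x 1) /\
  exists c d : R, [/\ a < c, c <= d, d < b &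
    forall x, x < c \/ d < x -> phi x = 0].

Definition weak_deriv (a b : R) (f g : R -> R) : Prop :=
  (forall c d, a < c -> d < b -> leb.-integrable `[c, d] (EFin \o f)) /\
  (forall c d, a < c -> d < b -> leb.-integrable `[c, d] (EFin \o g)) /\
  forall phi, test_fun a b phi ->
    Rintegral leb `]a, b[ (fun x => f x * derive1 phi x)
    = - Rintegral leb `]a, b[ (fun x => g x * phi x).

Definition Hs (s a b : R) (f : R -> R) : Prop :=
  L2 a b f /\
  (\int[leb]_(x in `]a, b[) \int[leb]_(y in `]a, b[)
     ((f x - f y) ^+ 2 / (`|x - y| `^ (1 + 2 * s)))%:E < +oo)%E.

Definition H1_with (a b : R) (f g : R -> R) : Prop :=
  L2 a b f /\ weak_deriv a b f g /\ L2 a b g.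

Definition zeroHs (s L : R) (f : R -> R) : Prop :=
  Hs s 0 L f /\
  (s = 1 / 2 ->
     (\int[leb]_(x in `]0%R, L[) ((f x) ^+ 2 / x)%:E < +oo)%E) /\
  (1 / 2 < s ->
     exists h : R -> R, {within `[0, L]%classic, continuous h} /\
       {ae leb, forall x, x \in `]0, L[ -> h x = f x} /\ h 0 = 0).

Definition W2p (p a b : R) (f : R -> R) : Prop :=
  exists g1 g2 : R -> R, [/\ Lp p a b f, weak_deriv a b f g1, Lp p a b g1,
                            weak_deriv a b g1 g2 & Lp p a b g2].

Definition initial_datum (alpha b M : R) (u0 : R -> R) : Prop :=
  {within `[0, b]%classic, continuous u0} /\
  (exists g : R -> R, H1_with 0 b u0 g /\ Hs alpha 0 b g /\ zeroHs alpha b g) /\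
  u0 b = 0 /\ (forall x, 0 <= x <= b -> 0 <= u0 x) /\
  (exists x, 0 <= x <= b /\ u0 x != 0) /\
  (forall x, 0 <= x <= b ->
     u0 x <= M * Gamma (2 - alpha) / b `^ (1 - alpha) * (b - x)).

Definition frac_int (alpha : R) (f : R -> R) (x : R) : R :=
  Rintegral leb `[0, x] (fun p => (x - p) `^ (- alpha) * (f p - f 0)).

Definition frac_int_lquot (alpha : R) (f : R -> R) (x : R) : R -> R :=
  fun h => (frac_int alpha f x - frac_int alpha f (x - h)) / h.

(* Caputo derivative D^alpha f (x): the x-derivative of frac_int, divided by
   Gamma(1-alpha); computed as a left derivative, which coincides with the
   two-sided derivative at interior points and is the meaningful one at the
   right end point x = s(t) of the domain. *)
Definition caputo (alpha : R) (f : R -> R) (x : R) : R :=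
  lim (frac_int_lquot alpha f x @ 0^'+) / Gamma (1 - alpha).

Definition Qst (s : R -> R) (T : R) : set (R * R) :=
  [set p | 0 < p.1 < s p.2 /\ 0 < p.2 < T].
Definition Qbar (s : R -> R) (T : R) : set (R * R) :=
  [set p | 0 <= p.1 <= s p.2 /\ 0 <= p.2 <= T].

Definition is_solution (alpha T b M : R) (u0 : R -> R)
    (u : R -> R -> R) (s : R -> R) : Prop :=
  let uu := fun p : R * R => u p.1 p.2 in
  let ut := fun p : R * R => derive1 (fun t => u p.1 t) p.2 in
  let ux := fun p : R * R => derive1 (fun x => u x p.2) p.1 in
  let Dau := fun p : R * R => caputo alpha (fun x => u x p.2) p.1 in
  let dxDau := fun p : R * R =>
     derive1 (fun x => caputo alpha (fun y => u y p.2) x) p.1 in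
  (exists L : R, forall t1 t2, 0 <= t1 <= T -> 0 <= t2 <= T ->
       `|s t1 - s t2| <= L * `|t1 - t2|) /\
  {ae leb, forall t, t \in `]0, T[ -> derivable s t 1 /\ 0 < derive1 s t <= M} /\
  {within Qbar s T, continuous uu} /\
  (forall p, Qst s T p ->
     [/\ derivable (fun t => u p.1 t) p.2 1,
         derivable (fun x => u x p.2) p.1 1,
         derivable (frac_int alpha (fun x => u x p.2)) p.1 1 &
         derivable (fun x => caputo alpha (fun y => u y p.2) x) p.1 1]) /\
  {within Qst s T, continuous ut} /\
  {within Qst s T, continuous dxDau} /\
  (exists v : R * R -> R,
     {within [set p | Qbar s T p /\ (1 / 2 < alpha \/ 0 < p.2)], continuous v} /\
     (forall p, Qst s T p -> v p = ux p) /\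
     (forall t, 0 < t < T -> v (0, t) = 0)) /\
  (exists beta : R, alpha < beta < 1 /\
     forall t eps om, 0 < t <= T -> 0 < eps -> eps < om -> om < s t ->
       W2p (1 / (1 - beta)) eps om (fun x => u x t)) /\
  (forall p, Qst s T p -> ut p - dxDau p = 0) /\
  (forall t, 0 < t < T -> u (s t) t = 0) /\
  s 0 = b /\
  (forall x, 0 < x < b -> u x 0 = u0 x) /\
  (forall t, 0 < t < T ->
     cvg (frac_int_lquot alpha (fun x => u x t) (s t) @ 0^'+) /\
     derivable s t 1 /\ derive1 s t = - Dau (s t, t)).

End Defs.

(* Main.v *)
Require Import Defs.
From mathcomp Require Import all_boot all_order all_algebra.
From mathcomp Require Import all_classical all_reals all_analysis.
From mathcomp Require Import measurable_realfun ring lra.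
Import Order.TTheory GRing.Theory Num.Theory numFieldNormedType.Exports.
Local Open Scope classical_set_scope.
Local Open Scope ring_scope.

(** The enthalpy excess  \int (u1 - u2)^+ dx + (s1 - s2)^+  of the first solution over
    the second, with both temperatures extended by zero beyond their fronts, does not
    increase in time and vanishes at t = 0.

    Multiplying the equation for w = u1 - u2 by eta(w), with eta nondecreasing and
    eta(0) = 0, and integrating by parts produces the energy
    \int eta'(w) w_x (q^-alpha * w_x) dx.  It is nonnegative for every convex entropy
    because q^-alpha is a positive superposition of exponentials, and for an exponential
    kernel the energy is bounded below by convexity.  Hence the mass of w^+ on the common
    domain only grows through the smaller front, where u1 - u2 has the sign of s1 - s2.
    Since the total enthalpies  s_i + \int u_i  are conserved, the excesses in the two
    directions differ by a constant, so it suffices to control at each time whichever is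
    more convenient according to the order of the fronts.

    The Caputo derivative is used as the convolution of q^-alpha with u_x, which is
    continuous up to the front. *)

(* lra on bounded contexts: splits conjunctions and discards every hypothesis
   that is not an inequality. *)
Ltac blra := intros;
  repeat match goal with
  | H : is_true (_ && _) |- _ => case/andP: (H) => [? ?]; clear H
  | H : _ /\ _ |- _ => destruct H
  end;
  repeat match goal with
  | |- is_true (_ && _) => apply/andP; split
  | |- _ /\ _ => split
  end;
  repeat match goal with x := _ |- _ => clearbody x end;
  repeat match goal with
  | H : ?P |- _ => lazymatch type of P with
      | Prop => lazymatch P with
          | is_true (_ <= _) => fail
          | is_true (_ < _) => fail
          | _ => clear H
          end
      end
  end; lra.

(** * Real analysis on intervals *)

Section Toolkit.
Variable R : realType.
Set Implicit Arguments. Unset Strict Implicit.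
Implicit Types (f g : R -> R) (a b x : R).
Local Notation leb := (@lebesgue_measure R).
Local Notation Int a b f := (Rintegral leb `[a, b] f).

(** Two obstacles shape the argument. The equation and the continuity of [u_t] are available only in
    the open domain, and for alpha <= 1/2 the derivative [u_x] is not controlled at t = 0, so no
    integral identity can be written on the closed domain or from time 0. Everything is therefore
    phrased as increments over [t, t + h] with an error k h, at times 0 < t < T, and integrated by a
    criterion on right Dini derivatives; time 0 is reached by continuity alone. The same criterion
    copes with fronts that may meet on an arbitrary closed set of times: at each time only their
    order just afterwards matters. Both directions are needed because of the boundary term at the
    smaller front: the excess of the solution that vanishes there gains nothing, while the opposite
    one receives a flux of unknown sign. All convolutions use one kernel on ]0, L], with L a common
    bound of the fronts, and fields extended to the whole line, so that x enters only as a
    translation. *)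

Lemma continuous_at_within f a b :
  (forall x, a <= x <= b -> {for x, continuous f}) ->
  {within `[a, b], continuous f}.
Proof.
move=> cf; apply: continuous_in_subspaceT => x /set_mem /=.
by rewrite in_itv /= => /cf.
Qed.

Lemma continuous_at_integrable f a b :
  (forall x, a <= x <= b -> {for x, continuous f}) ->
  leb.-integrable `[a, b] (EFin \o f).
Proof.
move=> cf; apply: continuous_compact_integrable; first exact: segment_compact.
exact: continuous_at_within.
Qed.

(** Two-sided continuity at the end points can be required because the fields below are extended
    past their domains; differentiability is required only inside, where the equation holds. *)
Lemma Rintegral_FTC2 f g a b : a <= b ->
  (forall x, a <= x <= b -> {for x, continuous g}) ->
  (forall x, a <= x <= b -> {for x, continuous f}) ->
  (forall x, a < x < b -> is_derive x 1 f (g x)) ->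
  Int a b g = f b - f a.
Proof.
rewrite le_eqVlt => /predU1P[<- _ _ _|ab cg cf df].
  by rewrite set_itv1 Rintegral_set1 subrr.
rewrite /Rintegral (@continuous_FTC2 _ g f) //.
- exact: continuous_at_within.
- split.
  + by move=> x /[!in_itv] /= /df dx; exact: (@ex_derive _ _ _ _ _ _ _ dx).
  + by apply: cvg_at_right_filter; apply: cf; rewrite lexx ltW.
  + by apply: cvg_at_left_filter; apply: cf; rewrite lexx ltW.
- move=> x /[!in_itv] /= /df dx; rewrite derive1E.
  exact: (@derive_val _ _ _ _ _ _ _ dx).
Qed.

Lemma norm_Rintegral_le f a b (M : R) : a <= b ->
  leb.-integrable `[a, b] (EFin \o f) ->
  (forall x, a <= x <= b -> `|f x| <= M) ->
  `|Int a b f| <= M * (b - a).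
Proof.
move=> ab intf fM.
apply: (le_trans (le_normr_Rintegral _ intf)) => //.
have -> : M * (b - a) = Int a b (cst M).
  rewrite Rintegral_cst //= lebesgue_measure_itv /= lte_fin.
  by case: ltgtP ab => //= -> _; rewrite subrr.
apply: le_Rintegral => //.
- exact: (integrable_norm intf).
- by apply: continuous_at_integrable => x _; exact: cst_continuous.
Qed.

Lemma dominated_Rintegral (D : set R) (f_ : nat -> R -> R) f g :
  measurable D -> (forall n, measurable_fun D (f_ n)) -> measurable_fun D f ->
  (forall x, D x -> f_ n x @[n --> \oo] --> f x) ->
  leb.-integrable D (EFin \o g) ->
  (forall n x, D x -> `|f_ n x| <= g x) ->
  leb.-integrable D (EFin \o f) /\
  Rintegral leb D (f_ n) @[n --> \oo] --> Rintegral leb D f.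
Proof.
move=> mD mf_ mf ff_ ig fg.
have [] := @dominated_convergence _ _ _ leb D mD
  (fun n => EFin \o f_ n) (EFin \o f) (EFin \o g).
- by move=> n; exact: (measurable_EFinP _ _).2 (mf_ n).
- exact: (measurable_EFinP _ _).2 mf.
- apply: aeW => x Dx; apply: cvg_EFin; last exact: ff_.
  by apply: nearW.
- exact: ig.
- by apply: aeW => x n Dx; rewrite /= lee_fin fg.
move=> i1 _ i3; split => //.
rewrite /Rintegral; apply: fine_cvg; rewrite fineK //.
exact: integrable_fin_num.
Qed.

(** * Reflection of the integration variable *)

Lemma measurable_reflect x : measurable_fun [set: R] (fun p : R => x - p).
Proof. by apply: measurable_funB => //; exact: measurable_cst. Qed.

Lemma lebesgue_measure_reflect x (A : set R) : measurable A ->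
  pushforward leb (fun p : measurableTypeR R => (x - p) : measurableTypeR R) A = leb A.
Proof.
move=> mA; apply/esym/lebesgue_measure_unique => //=.
  exact: measurable_reflect.
move=> mm _ [[a b]] _ <-.
rewrite /pushforward.
(* Reflection exchanges the open and the closed end, which the length of an interval does not
   see. *)
have -> : (fun p : R => x - p) @^-1` `]a, b] = `[x - b, x - a[%classic.
  apply/seteqP; split => p /=; rewrite !in_itv /= => /andP[h1 h2]; apply/andP; split; lra.
rewrite !lebesgue_measure_itv /= !lte_fin -!EFinD.
have -> : x - a - (x - b) = b - a by lra.
by have -> : (x - b < x - a) = (a < b) by apply/idP/idP => h; lra.
Qed.

Lemma preimage_reflect x :
  (fun p : R => x - p) @^-1` `[0, x] = `[0, x]%classic.
Proof.
apply/seteqP; split => p /=; rewrite !in_itv /= => /andP[h1 h2].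
  by apply/andP; split; lra.
by apply/andP; split; lra.
Qed.

Lemma integrable_reflect f x : measurable_fun [set: R] f ->
  leb.-integrable `[0, x] (EFin \o f) ->
  leb.-integrable `[0, x] (EFin \o (fun p => f (x - p))).
Proof.
move=> mf intf.
pose phi := fun p : measurableTypeR R => (x - p) : measurableTypeR R.
have mphi : measurable_fun setT phi by exact: measurable_reflect.
have mfx : measurable_fun [set: R] (f \o phi) by exact: measurableT_comp.
apply/integrableP; split.
  by apply: (measurable_EFinP _ _).2; apply: measurable_funTS.
move/integrableP : intf => [_]; apply: le_lt_trans.
have -> : (\int[leb]_(y in `[0%R, x]) `|(EFin \o f) y| =
    \int[pushforward leb phi]_(y in `[0%R, x]) `|(EFin \o f) y|)%E.
  by apply: eq_measure_integral => A mA _; exact/esym/lebesgue_measure_reflect.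
rewrite ge0_integral_pushforward //; last first.
  by apply: measurableT_comp => //; apply: (measurable_EFinP _ _).2; apply: measurable_funTS.
by rewrite preimage_reflect.
Qed.

Lemma Rintegral_reflect f x : measurable_fun [set: R] f ->
  leb.-integrable `[0, x] (EFin \o f) ->
  Int 0 x (fun p => f (x - p)) = Int 0 x f.
Proof.
move=> mf intf.
pose phi := fun p : measurableTypeR R => (x - p) : measurableTypeR R.
have mphi : measurable_fun setT phi by exact: measurable_reflect.
rewrite /Rintegral; congr fine.
transitivity (\int[pushforward leb phi]_(y in `[0%R, x]) (f y)%:E)%E.
  rewrite integral_pushforward //.
  - by rewrite preimage_reflect; apply: eq_integral.
  - exact: (measurable_EFinP _ _).2 mf.
  - by rewrite preimage_reflect; exact: integrable_reflect.
by apply: eq_measure_integral => A mA _; exact: lebesgue_measure_reflect.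
Qed.

Lemma is_derive_continuous f x (d : R) : is_derive x 1 f d -> {for x, continuous f}.
Proof.
by move=> df; apply: differentiable_continuous; apply/derivable1_diffP; exact: ex_derive.
Qed.

(** The rules are restated for explicit functions and ring multiplication, so that computed
    derivatives can be compared by [ring] or [field]. *)
Lemma is_derive_scale f x (k d : R) :
  is_derive x 1 f d -> is_derive x 1 (fun y => k * f y) (k * d).
Proof. exact: is_deriveZ. Qed.

Lemma is_derive_add f g x (df dg : R) : is_derive x 1 f df -> is_derive x 1 g dg ->
  is_derive x 1 (fun y => f y + g y) (df + dg).
Proof. exact: is_deriveD. Qed.

Lemma is_derive_sub f g x (df dg : R) : is_derive x 1 f df -> is_derive x 1 g dg ->
  is_derive x 1 (fun y => f y - g y) (df - dg).
Proof. exact: is_deriveB. Qed.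

Lemma is_derive_mul f g x (df dg : R) : is_derive x 1 f df -> is_derive x 1 g dg ->
  is_derive x 1 (fun y => f y * g y) (df * g x + f x * dg).
Proof.
move=> hf hg; apply: is_derive_eq (is_deriveM hf hg) _.
by rewrite /GRing.scale /= addrC mulrC.
Qed.

Lemma is_derive_pow f x (df : R) n : is_derive x 1 f df ->
  is_derive x 1 (fun y => f y ^+ n) (n%:R * f x ^+ n.-1 * df).
Proof.
move=> hf; elim: n => [|n IH].
  by rewrite !mul0r; under [X in is_derive _ _ X _]funext => y do rewrite expr0; exact: is_derive_cst.
under [X in is_derive _ _ X _]funext => y do rewrite exprS.
apply: is_derive_eq (is_derive_mul hf IH) _.
by case: n {IH} => [|n] /=; rewrite ?expr0 ?exprS -?natr1; ring.
Qed.

Lemma powR_continuous_at (p x : R) : 0 < x -> {for x, continuous (fun y : R => y `^ p)}.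
Proof. by move=> x0; exact: is_derive_continuous (is_derive1_powR p x0). Qed.

(** Monotone convergence along [L/(n+1), L], which exhausts ]0, L]: since 1 - al > 0, the
    antiderivative x^(1-al)/(1-al) bounds the integral over each piece independently of n. *)
Lemma powRN_integrable (al L : R) : 0 < al < 1 -> 0 < L ->
  leb.-integrable `[0, L] (EFin \o (fun q => q `^ (- al))).
Proof.
move=> /andP[al0 al1] L0; apply/integrableP; split.
  by apply/measurable_EFinP; apply: measurable_funTS; exact: measurable_powR.
rewrite -integral_itv_obnd_cbnd; last first.
  by apply: measurableT_comp => //; apply/measurable_EFinP; apply: measurable_funTS; exact: measurable_powR.
pose F n := `[L / n.+1%:R, L]%classic.
have UF : `]0, L]%classic = \bigcup_n F n.
  apply/seteqP; split => x /=.
    rewrite in_itv /= => /andP[x0 xL].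
    have [n nP] : exists n : nat, L / x < n%:R.
      by exists (Num.bound (L / x)); apply: archi_boundP; rewrite divr_ge0 ?ltW.
    exists n => //; rewrite /F /= in_itv /= xL andbT.
    rewrite ler_pdivrMr ?ltr0n // mulrC -ler_pdivrMr //.
    by rewrite (le_trans (ltW nP)) // ler_nat.
  move=> [n _]; rewrite /F /= !in_itv /= => /andP[h ->]; rewrite andbT.
  by apply: lt_le_trans h; rewrite divr_gt0 // ltr0n.
rewrite UF.
have cv := @ge0_nondecreasing_set_cvg_integral _ (measurableTypeR R) _ F
  (fun x => `|(x `^ (- al))%:E|)%E leb.
apply: (@le_lt_trans _ _ ((1 - al)^-1 * L `^ (1 - al))%:E); last exact: ltry.
have LF n : 0 < L / n.+1%:R <= L.
  by rewrite divr_gt0 ?ltr0n //= ler_pdivrMr ?ltr0n // ler_peMr ?ler1n // ltW.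
have Fn n : (\int[leb]_(x in F n) `|(x `^ (- al))%:E| <= ((1 - al)^-1 * L `^ (1 - al))%:E)%E.
  have /andP[Ln0 LnL] := LF n.
  have al' : 1 - al != 0 by lra.
  have := @Rintegral_FTC2 (fun x => (1 - al)^-1 * x `^ (1 - al)) (fun x => x `^ (- al)) _ _ LnL.
  rewrite /Rintegral => H.
  under eq_integral do rewrite abse_EFin ger0_norm ?powR_ge0 //.
  rewrite -[leLHS]fineK; last first.
    apply: integrable_fin_num; first exact: measurable_itv.
    refine (@continuous_at_integrable (fun x => x `^ (- al)) (L / n.+1%:R) L _).
    by move=> x /andP[hx _]; apply: powR_continuous_at; exact: lt_le_trans hx.
  rewrite lee_fin; move: H.
  set I := fine _; move=> H; suff -> : I = (1 - al)^-1 * L `^ (1 - al) - (1 - al)^-1 * (L / n.+1%:R) `^ (1 - al).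
    by rewrite gerBl mulr_ge0 ?powR_ge0 // invr_ge0; lra.
  apply: H.
  - by move=> x /andP[hx _]; apply: powR_continuous_at; exact: lt_le_trans hx.
  - move=> x /andP[hx _]; have x0 : 0 < x by exact: lt_le_trans hx.
    exact: is_derive_continuous (is_derive_scale ((1 - al)^-1) (is_derive1_powR (1 - al) x0)).
  - move=> x /andP[hx _]; have x0 : 0 < x by exact: lt_trans hx.
    have := is_derive_scale ((1 - al)^-1) (is_derive1_powR (1 - al) x0).
    rewrite mulrA mulVf // mul1r.
    by have -> : 1 - al - 1 = - al by lra.
have {}cv := cv _ _ _ _.
have hc : (\int[leb]_(x in F i) `|(x `^ (- al))%:E|)%E @[i --> \oo] -->
    (\int[leb]_(x in \bigcup_i F i) `|(x `^ (- al))%:E|)%E.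
  apply: cv => //.
  - move=> n m nm; apply/subsetPset => x; rewrite /F /= !in_itv /= => /andP[h ->].
    rewrite andbT; apply: le_trans h; rewrite ler_pM2l // lef_pV2 ?posrE ?ltr0n //.
    by rewrite ler_nat.
  - by move=> n; exact: measurable_itv.
  - move=> n; apply: measurableT_comp => //; apply: (measurable_EFinP _ _).2.
    by apply: measurable_funTS; exact: measurable_powR.
rewrite -(cvg_lim _ hc) //; apply: lime_le; first by apply/cvg_ex; eexists; exact: hc.
by apply: nearW => n; exact: Fn.
Qed.

(** Continuity is two-sided at the points of the box, so only the first of the two compared points
    has to lie in it. *)
Lemma uniform_continuous_box (g : R * R -> R) a b (c d : R) :
  (forall x t, a <= x <= b -> c <= t <= d -> {for (x, t), continuous g}) ->
  forall e : R, 0 < e -> exists2 de : R, 0 < de & forall x t x' t',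
    a <= x <= b -> c <= t <= d -> `|x - x'| < de -> `|t - t'| < de ->
    `|g (x, t) - g (x', t')| < e.
Proof.
move=> cg e e0.
pose K := (`[a, b]%classic `*` `[c, d]%classic : set (R * R)).
have cK : compact K by apply: compact_setX; exact: segment_compact.
have e20 : 0 < e / 2 by lra.
have := (compact_near_coveringP K).1 cK R (0^'+)
  (fun de p => forall p', ball p de p' -> `|g p - g p'| < e) _.
case.
  move=> [x t] [/=]; rewrite !in_itv /= => xab tcd.
  have /cvgrPdist_lt /(_ _ e20) := cg _ _ xab tcd.
  move=> /nbhs_ballP[r /= r0 hr].
  exists (ball (x, t) (r / 2), [set de | de < r / 2]) => /=.
    split; first by apply: nbhsx_ballx; lra.
    by apply: nbhs_right_lt; lra.
  move=> [p de] /= [hp hde] p' hp'.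
  have r2r : r / 2 <= r by lra.
  have h1 := hr p (le_ball r2r hp).
  have h2 : `|g (x, t) - g p'| < e / 2.
    apply: hr; have -> : r = r / 2 + r / 2 by lra.
    by apply: ball_triangle hp _; apply: le_ball hp'; exact: ltW.
  have -> : g p - g p' = (g (x, t) - g p') - (g (x, t) - g p) by lra.
  by rewrite (le_lt_trans (ler_normB _ _)) //; lra.
move=> de /= de0 H.
exists (de / 2); first by lra.
move=> x t x' t' xab tcd hx ht.
have de20 : 0 < de / 2 by lra.
have de2 : de / 2 < de by lra.
have /= := H (de / 2).
rewrite sub0r normrN gtr0_norm // => /(_ de2 de20 (x, t)).
by apply; [split; rewrite /= in_itv | split].
Qed.

(** For a slack k > 0, consider the times up to which f stays below the line of slope k through (a,
    f a). Continuity puts their supremum in the set and the Dini hypothesis would push it further,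
    so it is b; then k tends to 0. *)
Lemma Dini_nonincreasing f a b : a <= b ->
  (forall t, a <= t <= b -> {for t, continuous f}) ->
  (forall t, a <= t < b -> forall k : R, 0 < k ->
    exists2 de : R, 0 < de & forall h : R, 0 < h < de -> f (t + h) <= f t + k * h) ->
  f b <= f a.
Proof.
move=> ab cf Df.
suff H (k : R) : 0 < k -> f b <= f a + k * (b - a).
  have [ab0|ab0] := eqVneq a b; first by rewrite -ab0.
  have {}ab0 : 0 < b - a by rewrite subr_gt0 lt_neqAle ab0.
  apply/ler_addgt0Pr => e e0.
  by have := H _ (divr_gt0 e0 ab0); rewrite divfK // gt_eqF.
move=> k0.
pose E := [set t | a <= t <= b /\ forall s, a <= s <= t -> f s <= f a + k * (s - a)].
have Ea : E a.
  split; first by rewrite lexx.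
  move=> s hs; have -> : s = a by apply/eqP; rewrite eq_le; blra.
  by rewrite subrr mulr0 addr0.
have supE : has_sup E by split; [exists a | exists b => t [/andP[_]]].
pose t0 := sup E.
have at0 : a <= t0 by exact: (ub_le_sup supE.2).
have t0b : t0 <= b by apply: ge_sup => //; [exists a|move=> t [/andP[]]].
have lt0 s : a <= s < t0 -> f s <= f a + k * (s - a).
  move=> /andP[as_ st0]; have ts0 : 0 < t0 - s by lra.
  have [t [_ Et] st] := sup_adherent ts0 supE.
  by apply: Et; rewrite as_ /= ltW //; move: st; rewrite -/t0; blra.
have ft0 : f t0 <= f a + k * (t0 - a).
  rewrite leNgt; apply/negP => habs.
  have at0' : a < t0.
    rewrite lt_neqAle at0 andbT; apply/eqP => ht; move: habs; rewrite -ht; lra.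
  pose e := (f t0 - (f a + k * (t0 - a))) / 2.
  have e0 : 0 < e by rewrite /e; lra.
  have t0ab : a <= t0 <= b by rewrite at0.
  have /cvgrPdist_lt /(_ _ e0) := cf t0 t0ab.
  move=> /nbhs_ballP[r /= r0 hr].
  pose s := Num.max a (t0 - r / 2).
  have hs : a <= s < t0 by rewrite /s; case: (lerP a (t0 - r / 2)) => ?; blra.
  have := hr s.
  have hb : ball t0 r s.
    by rewrite /ball /= /s; case: (lerP a (t0 - r / 2)) => ?; rewrite ger0_norm; blra.
  move=> /(_ hb) /ltr_normlW hf; have := lt0 s hs.
  have : k * (s - a) <= k * (t0 - a) by rewrite ler_pM2l //; blra.
  by rewrite /e in hf; lra.
have [<-//|t0nb] := eqVneq t0 b.
have {}t0b : t0 < b by rewrite lt_neqAle t0nb.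
have t0ab : a <= t0 < b by rewrite at0.
have [de de0 hde] := Df t0 t0ab k k0.
pose h := Num.min (de / 2) (b - t0).
have hh : 0 < h < de /\ t0 + h <= b by rewrite /h; case: (lerP (de / 2) (b - t0)) => ?; blra.
suff : E (t0 + h) by move=> /(ub_le_sup supE.2); rewrite -/t0; blra.
split; first by blra.
move=> s /andP[s1 s2]; have [st|ts] := ltP s t0; first by apply: lt0; rewrite s1.
have [->//|nst] := eqVneq s t0.
have st0 : t0 < s by rewrite lt_neqAle eq_sym nst.
have hst : 0 < s - t0 < de by blra.
have := hde _ hst.
rewrite addrC subrK => hs; apply: (le_trans hs); lra.
Qed.

End Toolkit.

(** * The binomial series of negative exponent *)

Section Binomial.
Variable R : realType.
Set Implicit Arguments. Unset Strict Implicit.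
Variable al : R.
Hypothesis al01 : 0 < al < 1.

(** Taylor coefficient of (1 - z)^(-al), that is al (al+1) ... (al+n-1) / n!. Its sign is what makes
    q^(-al) a positive superposition of exponentials. *)
Definition neg_binom_coef (n : nat) : R :=
  \prod_(i < n) ((al + i%:R) / i.+1%:R).

Definition neg_binom_sum (n : nat) (z : R) : R :=
  \sum_(j < n) neg_binom_coef j * z ^+ j.

Lemma neg_binom_coefS n :
  neg_binom_coef n.+1 * n.+1%:R = neg_binom_coef n * (al + n%:R).
Proof.
by rewrite /neg_binom_coef big_ord_recr /= -mulrA divfK.
Qed.

Lemma neg_binom_coef_bound n : 0 <= neg_binom_coef n <= 1.
Proof.
have /andP[a0 a1] := al01.
apply/andP; split.
  apply: prodr_ge0 => i _; apply: divr_ge0; last by rewrite ler0n.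
  by apply: addr_ge0; [exact: ltW|rewrite ler0n].
rewrite /neg_binom_coef; elim: n => [|n IH]; first by rewrite big_ord0.
have f0 : 0 <= (al + n%:R) / n.+1%:R.
  by apply: divr_ge0; [apply: addr_ge0; [exact: ltW|rewrite ler0n]|rewrite ler0n].
rewrite big_ord_recr /= mulr_ile1 //.
  apply: prodr_ge0 => i _; apply: divr_ge0; last by rewrite ler0n.
  by apply: addr_ge0; [exact: ltW|rewrite ler0n].
by rewrite ler_pdivrMr ?ltr0n // mul1r -natr1 addrC lerD2l ltW.
Qed.

(** The recurrence [neg_binom_coefS] makes the derivative telescope: only the term of top degree
    survives. *)
Lemma neg_binom_sum_derive n (z : R) : z < 1 ->
  is_derive z 1 (fun y => (1 - y) `^ al * neg_binom_sum n y)
    (- ((1 - z) `^ (al - 1) * (neg_binom_coef n * n%:R * z ^+ n.-1))).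
Proof.
move=> z1; have z1' : 0 < 1 - z by lra.
have dp : is_derive z 1 (fun y => (1 - y) `^ al) (- (al * (1 - z) `^ (al - 1))).
  have h1 : is_derive z 1 (fun y : R => 1 - y) (-1).
    by have := is_derive_sub (is_derive_cst (1 : R) z 1) (is_derive_id z 1); rewrite sub0r.
  have := @is_derive1_comp _ (fun y => y `^ al) (fun y => 1 - y) z _ _ (is_derive1_powR al z1') h1.
  by rewrite mulrN1.
have hp : (1 - z) `^ al = (1 - z) `^ (al - 1) * (1 - z).
  by rewrite mulrC mulr_powRB1 ?ltW //; case/andP: al01.
elim: n => [|n IH].
  rewrite /neg_binom_sum mulr0 mul0r mulr0 oppr0.
  under [X in is_derive _ _ X _]funext => y do rewrite big_ord0 mulr0.
  exact: is_derive_cst.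
have -> : (fun y => (1 - y) `^ al * neg_binom_sum n.+1 y) =
    (fun y => (1 - y) `^ al * neg_binom_sum n y + (1 - y) `^ al * (neg_binom_coef n * y ^+ n)).
  by apply/funext => y; rewrite /neg_binom_sum big_ord_recr /= mulrDr.
have dX := is_derive_scale (neg_binom_coef n) (is_derive_pow n (is_derive_id z (1 : R))).
apply: is_derive_eq (is_derive_add IH (is_derive_mul dp dX)) _.
rewrite neg_binom_coefS /GRing.scale /= hp.
case: n {IH dX} => [|n] /=; first by rewrite /neg_binom_coef big_ord0 !expr0; ring.
by rewrite exprS; ring.
Qed.

(** For n >= 1 the product of the partial sum with (1 - z)^al equals 1 at z = 0, and its derivative
    is at most 0. *)
Lemma neg_binom_sum_le n (z : R) : 0 < z < 1 ->
  0 <= neg_binom_sum n z <= (1 - z) `^ (- al).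
Proof.
move=> /andP[z0 z1]; apply/andP; split.
  apply: sumr_ge0 => i _; apply: mulr_ge0; last by rewrite exprn_ge0 // ltW.
  by have /andP[] := neg_binom_coef_bound i.
have z1' : 0 < 1 - z by lra.
case: n => [|n]; first by rewrite /neg_binom_sum big_ord0 powR_ge0.
have [] := @MVT_segment _ (fun y => (1 - y) `^ al * neg_binom_sum n.+1 y)
  (fun z => - ((1 - z) `^ (al - 1) * (neg_binom_coef n.+1 * n.+1%:R * z ^+ n)))
  0 z (ltW z0).
- by move=> x /[!in_itv] /= /andP[_ xz]; apply: neg_binom_sum_derive; exact: lt_trans z1.
- apply: continuous_at_within => x /andP[_ xz].
  apply: is_derive_continuous; apply: neg_binom_sum_derive; exact: le_lt_trans z1.
move=> c; rewrite in_itv /= => /andP[c0 cz].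
rewrite !subr0 powR1 mul1r.
have -> : neg_binom_sum n.+1 0 = 1.
  rewrite /neg_binom_sum big_ord_recl /= expr0 mulr1 big1 => [|i _].
    by rewrite /neg_binom_coef big_ord0 addr0.
  by rewrite expr0n /= mulr0.
move=> H.
have h2 : (1 - z) `^ al * neg_binom_sum n.+1 z <= 1.
  rewrite -subr_le0 H mulNr oppr_le0; apply: mulr_ge0; last exact: ltW.
  apply: mulr_ge0; first exact: powR_ge0.
  apply: mulr_ge0; last by rewrite exprn_ge0.
  by apply: mulr_ge0; [have /andP[] := neg_binom_coef_bound n.+1|rewrite ler0n].
by rewrite powRN -[leRHS]mulr1 ler_pdivlMl // powR_gt0.
Qed.

(** With z = e^(-2a), the bound e^(an) >= 1 + an >= m (n+1), where m = min(1, a), is used twice: z^n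
    decays quadratically against the linear factor. *)
Lemma nat_expr_cvg0 (z : R) : 0 < z < 1 -> n.+1%:R * z ^+ n @[n --> \oo] --> (0 : R).
Proof.
move=> /andP[z0 z1].
pose a := - ln z / 2.
have a0 : 0 < a by rewrite /a divr_gt0 // oppr_gt0 ln_lt0 // z0.
pose m := Num.min 1 a.
have m0 : 0 < m by rewrite lt_min ltr01.
have hz n : z ^+ n <= (m ^+ 2 * n.+1%:R ^+ 2)^-1.
  have -> : z = expR (- (a + a)).
    by rewrite /a -splitr opprK lnK.
  rewrite -expRM_natl mulrN expRN lef_pV2 ?posrE ?expR_gt0 //; last first.
    by rewrite mulr_gt0 // exprn_gt0 // ltr0n.
  rewrite mulrDr expRD -exprMn expr2; apply: ler_pM.
  - by rewrite mulr_ge0 // ltW.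
  - by rewrite mulr_ge0 // ltW.
  - apply: (le_trans _ (expR_ge1Dx _)); rewrite -natr1 mulrDr addrC mulr1.
    by apply: lerD; [rewrite ge_min lexx|rewrite mulrC ler_wpM2l ?ler0n // ge_min lexx orbT].
  - apply: (le_trans _ (expR_ge1Dx _)); rewrite -natr1 mulrDr addrC mulr1.
    by apply: lerD; [rewrite ge_min lexx|rewrite mulrC ler_wpM2l ?ler0n // ge_min lexx orbT].
have h n : 0 <= n.+1%:R * z ^+ n <= (m ^+ 2)^-1 * n.+1%:R^-1.
  rewrite mulr_ge0 ?ler0n ?exprn_ge0 ?(ltW z0) //=.
  apply: (@le_trans _ _ (n.+1%:R * (m ^+ 2 * n.+1%:R ^+ 2)^-1)).
    by apply: ler_wpM2l (hz n); rewrite ler0n.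
  by rewrite invfM mulrCA ler_pM2l ?invr_gt0 ?exprn_gt0 // expr2 invfM mulVKf // pnatr_eq0.
apply: (@squeeze_cvgr _ _ _ _ (cst 0) (fun n => (m ^+ 2)^-1 * n.+1%:R^-1)).
- exact: nearW.
- exact: cvg_cst.
- by rewrite -[X in _ --> X](mulr0 ((m ^+ 2)^-1)); apply: cvgM; [exact: cvg_cst|exact: cvg_harmonic].
Qed.

(** The mean value theorem on [0, z] bounds the defect of the product from 1 by a multiple of (n+1)
    z^n: the coefficients are at most 1, and (1 - c)^(al-1) c^n increases with the intermediate
    point c. *)
Lemma neg_binom_sum_cvg (z : R) : 0 < z < 1 ->
  neg_binom_sum n z @[n --> \oo] --> (1 - z) `^ (- al).
Proof.
move=> z01; have /andP[z0 z1] := z01; have z1' : 0 < 1 - z by lra.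
rewrite -(cvg_shiftS (fun n => neg_binom_sum n z)).
pose C := (1 - z) `^ (- al) * (1 - z) `^ (al - 1).
apply: (@squeeze_cvgr _ _ _ _ (fun n => (1 - z) `^ (- al) - C * (n.+1%:R * z ^+ n)) (cst ((1 - z) `^ (- al)))).
- apply: nearW => n /=; have /andP[_ ->] := neg_binom_sum_le n.+1 z01; rewrite andbT.
  have [] := @MVT_segment _ (fun y => (1 - y) `^ al * neg_binom_sum n.+1 y)
    (fun z => - ((1 - z) `^ (al - 1) * (neg_binom_coef n.+1 * n.+1%:R * z ^+ n)))
    0 z (ltW z0).
  + by move=> x /[!in_itv] /= /andP[_ xz]; apply: neg_binom_sum_derive; exact: lt_trans z1.
  + apply: continuous_at_within => x /andP[_ xz].
    apply: is_derive_continuous; apply: neg_binom_sum_derive; exact: le_lt_trans z1.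
  move=> c; rewrite in_itv /= => /andP[c0 cz].
  rewrite !subr0 powR1 mul1r.
  have -> : neg_binom_sum n.+1 0 = 1.
    rewrite /neg_binom_sum big_ord_recl /= expr0 mulr1 big1 => [|i _].
      by rewrite /neg_binom_coef big_ord0 addr0.
    by rewrite expr0n /= mulr0.
  move=> H.
  have hc : (1 - c) `^ (al - 1) * (neg_binom_coef n.+1 * n.+1%:R * c ^+ n) * z <=
      (1 - z) `^ (al - 1) * (n.+1%:R * z ^+ n).
    have /andP[b0 b1] := neg_binom_coef_bound n.+1.
    rewrite -[leRHS]mulr1; apply: ler_pM => //; try exact: ltW.
      apply: mulr_ge0; first exact: powR_ge0.
      by rewrite mulr_ge0 ?exprn_ge0 // mulr_ge0 // ler0n.
    apply: ler_pM; first exact: powR_ge0.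
    - by rewrite mulr_ge0 ?exprn_ge0 // mulr_ge0 // ler0n.
    - have -> : al - 1 = - (1 - al) by lra.
      rewrite !powRN lef_pV2 ?posrE ?powR_gt0 //; last by lra.
      clear H b0 b1; have /andP[a0 a1] := al01.
      by apply: ge0_ler_powR; rewrite ?nnegrE; lra.
    - apply: ler_pM; rewrite ?exprn_ge0 // ?mulr_ge0 ?ler0n //.
      + by rewrite ler_piMl ?ler0n.
      + by rewrite lerXn2r // nnegrE // ltW.
  have h3 : 1 - (1 - z) `^ (al - 1) * (n.+1%:R * z ^+ n) <= (1 - z) `^ al * neg_binom_sum n.+1 z.
    by move: H; lra.
  have := ler_wpM2l (powR_ge0 (1 - z) (- al)) h3.
  have hq : (1 - z) `^ (- al) * (1 - z) `^ al = 1.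
    by rewrite powRN mulVf // gt_eqF // powR_gt0.
  by rewrite [X in _ <= X]mulrA hq mul1r mulrBr mulr1 [X in _ - X]mulrA.
- rewrite -[X in _ --> X]subr0; apply: cvgB; first exact: cvg_cst.
  by rewrite -[X in _ --> X](mulr0 C); apply: cvgM; [exact: cvg_cst|exact: nat_expr_cvg0].
- exact: cvg_cst.
Qed.

End Binomial.

(** * Truncated convolutions *)

Section Convolution.
Variable R : realType.
Set Implicit Arguments. Unset Strict Implicit.
Implicit Types (k v f g : R -> R) (a b x L : R).
Local Notation leb := (@lebesgue_measure R).
Local Notation Int a b f := (Rintegral leb `[a, b] f).

(** For 0 <= x <= L and v vanishing on negative arguments this is the usual convolution over [0, x].
    The fixed range of integration confines the dependence on x to v, so that the singular kernel is
    never differentiated or translated. *)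
Definition conv k L v x : R := Rintegral leb `]0, L] (fun q => k q * v (x - q)).

Lemma continuous_at_bounded f a b : a <= b ->
  (forall x, a <= x <= b -> {for x, continuous f}) ->
  exists2 M : R, 0 <= M & forall x, a <= x <= b -> `|f x| <= M.
Proof.
move=> ab cf.
have [|c _ hc] := @EVT_max R (fun x => `|f x|) a b ab.
  apply: continuous_at_within => x xab; apply: continuous_comp; first exact: cf.
  exact: norm_continuous.
exists `|f c|; first exact: normr_ge0.
by move=> x xab; apply: hc; rewrite in_itv.
Qed.

Lemma mul_reflect_integrable (D : set R) k L v x : measurable D -> D `<=` `[0, L]%classic ->
  0 <= L -> leb.-integrable D (EFin \o k) -> continuous v ->
  leb.-integrable D (EFin \o (fun q => k q * v (x - q))).
Proof.
move=> mD DL L0 ik cv.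
have [M M0 hM] : exists2 M : R, 0 <= M & forall y, x - L <= y <= x -> `|v y| <= M.
  by apply: continuous_at_bounded => // *; [lra|exact: cv].
have mk : measurable_fun D k by apply: (measurable_EFinP _ _).1; case/integrableP : ik.
apply: (@le_integrable _ _ _ leb _ _ _ (EFin \o (fun q => M * k q))) => //.
- apply: (measurable_EFinP _ _).2; apply: measurable_funM => //.
  apply: measurable_funTS; apply: (measurableT_comp (f := v)).
    exact: continuous_measurable_fun.
  exact: measurable_reflect.
- move=> q /DL; rewrite /= in_itv /= => /andP[q0 qL]; rewrite lee_fin !normrM mulrC.
  by rewrite (ger0_norm M0) ler_wpM2r // hM //; apply/andP; split; lra.
- under [X in integrable _ _ X]funext => q do rewrite /= EFinM.
  exact: integrableZl.
Qed.

Lemma conv_integrable k L v x : 0 < L ->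
  leb.-integrable `]0, L] (EFin \o k) -> continuous v ->
  leb.-integrable `]0, L] (EFin \o (fun q => k q * v (x - q))).
Proof.
move=> L0 ik cv; apply: (mul_reflect_integrable _ _ _ (ltW L0) ik cv) => //.
exact: subset_itv_oc_cc.
Qed.

(** The source of every continuity statement about fluxes: the kernel enters only through the
    integral of |k|. *)
Lemma conv_dist_le k L (v1 v2 : R -> R) x1 x2 (M : R) : 0 < L ->
  leb.-integrable `]0, L] (EFin \o k) -> continuous v1 -> continuous v2 ->
  (forall q, 0 < q <= L -> `|v1 (x1 - q) - v2 (x2 - q)| <= M) ->
  `|conv k L v1 x1 - conv k L v2 x2| <= M * Rintegral leb `]0, L] (fun q => `|k q|).
Proof.
move=> L0 ik c1 c2 hM.
have i1 := conv_integrable x1 L0 ik c1; have i2 := conv_integrable x2 L0 ik c2.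
rewrite /conv -RintegralB //.
have i12 : leb.-integrable `]0, L] (EFin \o (fun q => k q * v1 (x1 - q) - k q * v2 (x2 - q))).
  by under [X in integrable _ _ X]funext => q do rewrite /= EFinB; exact: integrableB.
have ink : leb.-integrable `]0, L] (EFin \o (fun q => `|k q|)) by exact: (integrable_norm ik).
apply: (le_trans (le_normr_Rintegral _ i12)) => //.
rewrite -RintegralZl //; apply: le_Rintegral => //.
- exact: (integrable_norm i12).
- by under [X in integrable _ _ X]funext => q do rewrite /= EFinM; exact: integrableZl.
- move=> q; rewrite /= in_itv /= => hq; rewrite -mulrBr normrM mulrC.
  by apply: ler_wpM2r => //; exact: hM.
Qed.

Lemma conv0 k L x : conv k L (fun=> 0) x = 0.
Proof.
rewrite /conv; under eq_Rintegral do rewrite mulr0.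
by rewrite /Rintegral integral0.
Qed.

Lemma conv_norm_le k L v x (M : R) : 0 < L ->
  leb.-integrable `]0, L] (EFin \o k) -> continuous v ->
  (forall q, 0 < q <= L -> `|v (x - q)| <= M) ->
  `|conv k L v x| <= M * Rintegral leb `]0, L] (fun q => `|k q|).
Proof.
move=> L0 ik cv hM.
have := @conv_dist_le k L v (fun=> 0) x x M L0 ik cv.
rewrite conv0 subr0; apply; first by move=> ?; exact: cst_continuous.
by move=> q hq; rewrite subr0 hM.
Qed.

Lemma convB k L (v1 v2 : R -> R) x : 0 < L ->
  leb.-integrable `]0, L] (EFin \o k) -> continuous v1 -> continuous v2 ->
  conv k L (fun y => v1 y - v2 y) x = conv k L v1 x - conv k L v2 x.
Proof.
move=> L0 ik c1 c2; rewrite /conv -RintegralB //; try exact: conv_integrable.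
by apply: eq_Rintegral => q _; rewrite mulrBr.
Qed.

Lemma section_continuous_l (v : R -> R -> R) (y t : R) :
  {for (y, t), continuous (fun p : R * R => v p.1 p.2)} ->
  {for y, continuous (fun z => v z t)}.
Proof.
move=> cv; rewrite /prop_for /continuous_at.
apply: (@continuous_comp _ _ _ (fun z : R => (z, t)) (fun p : R * R => v p.1 p.2)); last exact: cv.
move=> A /nbhs_ballP[e /= e0 hA]; apply/nbhs_ballP; exists e => // z hz; apply: hA.
by split => //=; exact: ballxx.
Qed.

Lemma section_continuous_r (v : R -> R -> R) (y t : R) :
  {for (y, t), continuous (fun p : R * R => v p.1 p.2)} ->
  {for t, continuous (v y)}.
Proof.
move=> cv; rewrite /prop_for /continuous_at.
apply: (@continuous_comp _ _ _ (fun z : R => (y, z)) (fun p : R * R => v p.1 p.2)); last exact: cv.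
move=> A /nbhs_ballP[e /= e0 hA]; apply/nbhs_ballP; exists e => // z hz; apply: hA.
by split => //=; exact: ballxx.
Qed.

(** The convolution on [a, b] looks at v on [a - L, b]; uniform continuity of v there passes to it
    at the cost of the integral K of |k|, with K + 1 as denominator because K may vanish. *)
Lemma conv_uniform (v : R -> R -> R) k L a b (c d : R) : 0 < L ->
  leb.-integrable `]0, L] (EFin \o k) ->
  (forall y t, c <= t <= d -> {for (y, t), continuous (fun p : R * R => v p.1 p.2)}) ->
  forall e : R, 0 < e -> exists2 de : R, 0 < de & forall x t x' t',
    a <= x <= b -> c <= t <= d -> a <= x' <= b -> c <= t' <= d ->
    `|x - x'| < de -> `|t - t'| < de ->
    `|conv k L (v^~ t) x - conv k L (v^~ t') x'| <= e.
Proof.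
move=> L0 ik cv e e0.
pose K := Rintegral leb `]0, L] (fun q => `|k q|).
have K0 : 0 <= K by apply: Rintegral_ge0.
have eK : 0 < e / (K + 1) by rewrite divr_gt0 //; lra.
have [de de0 hde] := @uniform_continuous_box R (fun p => v p.1 p.2) (a - L) b c d
  (fun x t _ ht => cv x t ht) _ eK.
exists de => // x t x' t' xab tcd xab' tcd' hx ht.
have cs t0 : c <= t0 <= d -> continuous (v^~ t0).
  by move=> ht0 y; apply: section_continuous_l; exact: cv.
apply: (@le_trans _ _ (e / (K + 1) * K)).
  apply: conv_dist_le => //; [exact: cs|exact: cs|].
  move=> q /andP[q0 qL]; apply/ltW; apply: (hde (x - q) t (x' - q) t') => //.
    by move/andP: xab => [? ?]; apply/andP; split; lra.
  by have -> : x - q - (x' - q) = x - x' by lra.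
by rewrite mulrAC ler_pdivrMr; [rewrite ler_pM2l //; lra|lra].
Qed.

Lemma conv_continuous k L v : 0 < L ->
  leb.-integrable `]0, L] (EFin \o k) -> continuous v -> continuous (conv k L v).
Proof.
move=> L0 ik cv x; apply/cvgrPdist_le => e e0.
have cv2 (y t : R) : 0 <= t <= 1 -> {for (y, t), continuous (fun p : R * R => (fun z _ => v z) p.1 p.2)}.
  move=> _; apply: (@continuous_comp _ _ _ (fun p : R * R => p.1) v); last exact: cv.
  exact: cvg_fst.
(* The uniform estimate is applied to a field that is constant in time. *)
have [de de0 hde] := @conv_uniform (fun z (_ : R) => v z) k L (x - 1) (x + 1) 0 1 L0 ik cv2 e e0.
near=> y; apply: (hde x 0 y 0).
- by apply/andP; split; lra.
- by rewrite lexx ler01.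
- suff : `|x - y| <= 1 by rewrite ler_distlC => /andP[? ?]; apply/andP; split; lra.
  by near: y; apply: cvgr_dist_le => //; exact: cvg_id.
- by rewrite lexx ler01.
- by near: y; apply: cvgr_dist_lt => //; exact: cvg_id.
- by rewrite subrr normr0.
Unshelve. all: by end_near. Qed.

Lemma Rintegral_truncate (h : R -> R) x L : 0 <= x <= L ->
  (forall q, x < q -> h q = 0) ->
  Rintegral leb `]0, L] h = Rintegral leb `]0, x] h.
Proof.
move=> /andP[x0 xL] h0; rewrite Rintegral_mkcond [RHS]Rintegral_mkcond.
congr Rintegral; apply/funext => q; rewrite /patch.
have -> : (q \in `]0, x]%classic) = (q \in `]0, x]) by rewrite mem_setE.
have -> : (q \in `]0, L]%classic) = (q \in `]0, L]) by rewrite mem_setE.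
rewrite !in_itv /=; case: (ltP 0 q) => //= q0.
case: (leP q x) => [qx|xq]; first by rewrite (le_trans qx).
by rewrite h0 //; case: ifP.
Qed.

End Convolution.

(** * Positivity of the convolution energy *)

Section Energy.
Variable R : realType.
Set Implicit Arguments. Unset Strict Implicit.
Implicit Types (k v f g H eta zeta : R -> R) (a b x X L lam : R).
Local Notation leb := (@lebesgue_measure R).
Local Notation Int a b f := (Rintegral leb `[a, b] f).

(** eta = H' is the multiplier of the equation and zeta = H'' the weight in the energy; continuity
    of zeta makes the energy integrand continuous. *)
Definition convex_entropy H eta zeta : Prop :=
  [/\ forall z : R, is_derive z 1 H (eta z), forall z : R, is_derive z 1 eta (zeta z),
      continuous zeta & forall z, 0 <= zeta z].

Lemma convex_entropy_homo H eta zeta : convex_entropy H eta zeta ->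
  forall a b, a <= b -> eta a <= eta b.
Proof.
move=> [_ de _ z0] a b ab.
have [|c _ hc] := @MVT_segment _ eta zeta a b ab (fun x _ => de x).
  by apply: continuous_at_within => x _; exact: is_derive_continuous (de x).
by rewrite -subr_ge0 hc mulr_ge0 // subr_ge0.
Qed.

Lemma convex_entropy_tangent H eta zeta : convex_entropy H eta zeta ->
  forall a b, eta a * (b - a) <= H b - H a.
Proof.
move=> hH a b; have [dH _ _ _] := hH; have mono := convex_entropy_homo hH.
have cH x y : {within `[x, y], continuous H}.
  by apply: continuous_at_within => z _; exact: is_derive_continuous (dH z).
have [ab|/ltW ba] := leP a b.
  have [c + ->] := @MVT_segment _ H eta a b ab (fun x _ => dH x) (cH _ _).
  rewrite in_itv /= => /andP[ac cb]; apply: ler_wpM2r; first by rewrite subr_ge0.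
  exact: mono.
have [c + hc] := @MVT_segment _ H eta b a ba (fun x _ => dH x) (cH _ _).
rewrite in_itv /= => /andP[bc ca].
rewrite -opprB mulrN lerNl opprB hc; apply: ler_wpM2r; first by rewrite subr_ge0.
exact: mono.
Qed.

(** Integrating from -1 instead of 0 makes the derivative at x = 0 two-sided. *)
Lemma antiderivative_exists f : continuous f ->
  exists2 A : R -> R, A 0 = 0 & forall x, 0 <= x -> is_derive x 1 A (f x).
Proof.
move=> cf; exists (fun x => Int (-1) x f - Int (-1) 0 f); first by rewrite subrr.
move=> x x0.
have [] := @continuous_FTC1_closed R f (-1) x (x + 1) _ _ _ (cf x).
- by lra.
- by apply: continuous_at_integrable => y _; exact: cf.
- by lra.
move=> dI IE.
have dI' : is_derive x 1 (fun x => Int (-1) x f) (f x).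
  by rewrite -IE derive1E; exact: derivableP.
by have := is_derive_sub dI' (is_derive_cst (Int (-1) 0 f) x 1); rewrite subr0.
Qed.

Lemma is_derive_expR_scale lam x :
  is_derive x 1 (fun p => expR (lam * p)) (lam * expR (lam * x)).
Proof.
have d1 := is_derive_scale lam (is_derive_id x (1 : R)).
have := @is_derive1_comp _ expR (fun p => lam * p) x _ _ (is_derive_expR _) d1.
by rewrite mulr1 mulrC.
Qed.

Lemma Rintegral_oc_cc a b f : leb.-integrable `[a, b] (EFin \o f) ->
  Rintegral leb `]a, b] f = Int a b f.
Proof.
move=> intf; apply: Rintegral_itv_obnd_cbnd; apply: integrableS intf => //.
exact: subset_itv_oc_cc.
Qed.

(* For an exponential kernel, the defect y = f - k * f' solves y' = lam (f - y). *)
Lemma conv_expR lam L X f v : 0 < L -> X <= L -> continuous f -> continuous v ->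
  (forall x, x <= 0 -> v x = 0) ->
  (forall x, 0 < x < X -> is_derive x 1 f (v x)) ->
  exists y : R -> R, [/\ y 0 = f 0,
    forall x, 0 <= x -> is_derive x 1 y (lam * (f x - y x)) &
    forall x, 0 <= x <= X -> conv (fun q => expR (- lam * q)) L v x = f x - y x].
Proof.
move=> L0 XL cf cv v0 df.
have ce (c : R) : continuous (fun p : R => expR (c * p)).
  by move=> p; exact: is_derive_continuous (is_derive_expR_scale c p).
have cef : continuous (fun p => expR (lam * p) * f p).
  by move=> p; apply: cvgM; [exact: ce|exact: cf].
have [A A0 dA] := antiderivative_exists cef.
(* The solution of y' = lam (f - y), y 0 = f 0, by the integrating factor e^(lam x). *)
exists (fun x => expR (- lam * x) * (f 0 + lam * A x)); split.
- by rewrite A0 !mulr0 expR0 mul1r addr0.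
- move=> x x0.
  have d2 := is_derive_add (is_derive_cst (f 0) x 1) (is_derive_scale lam (dA _ x0)).
  apply: is_derive_eq (is_derive_mul (is_derive_expR_scale (- lam) x) d2) _.
  have ee : expR (- lam * x) * expR (lam * x) = 1.
    by rewrite -expRD mulNr addNr expR0.
  have -> : expR (- lam * x) * (0 + lam * (expR (lam * x) * f x)) =
      lam * f x * (expR (- lam * x) * expR (lam * x)) by ring.
  by rewrite ee /cst; ring.
- move=> x /andP[x0 xX].
  pose phi p := expR (- lam * (x - p)) * v p.
  have cphi : continuous phi.
    move=> p; apply: cvgM; last exact: cv.
    apply: (@continuous_comp _ _ _ (fun p : R => x - p) (fun r => expR (- lam * r))); last exact: ce.
    by apply: cvgB; [exact: cvg_cst|exact: cvg_id].
  rewrite /conv (@Rintegral_truncate _ _ x); last first.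
  + by move=> q xq; rewrite v0 ?mulr0 // subr_le0 ltW.
  + by rewrite x0 (le_trans xX).
  transitivity (Rintegral leb `]0, x] (fun q => phi (x - q))).
    apply: eq_Rintegral => q _; rewrite /phi.
    by have -> : x - (x - q) = q by ring.
  have mphi : measurable_fun [set: R] phi by exact: continuous_measurable_fun.
  have iphi : leb.-integrable `[0, x] (EFin \o phi).
    by apply: continuous_at_integrable => p _; exact: cphi.
  rewrite Rintegral_oc_cc; last exact: integrable_reflect.
  rewrite Rintegral_reflect //.
  have ee : expR (- lam * x) * expR (lam * x) = 1.
    by rewrite -expRD mulNr addNr expR0.
  (* Integration by parts of e^(lam p) f'(p), carried out on the antiderivative. *)
  pose G p := expR (- lam * x) * (expR (lam * p) * f p - lam * A p).
  transitivity (G x - G 0); last first.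
    by rewrite /G A0 !mulr0 expR0 mul1r subr0 mulrBr mulrA ee mul1r; ring.
  apply: Rintegral_FTC2.
  + exact: x0.
  + by move=> p _; exact: cphi.
  + move=> p /andP[p0 _]; apply: cvgM; first exact: cvg_cst.
    apply: cvgB; first exact: cef.
    apply: cvgM; first exact: cvg_cst.
    exact: is_derive_continuous (dA _ p0).
  + move=> p /andP[p0 px].
    have pX : 0 < p < X by rewrite p0 (lt_le_trans px).
    have d1 := is_derive_mul (is_derive_expR_scale lam p) (df _ pX).
    have d2 := is_derive_sub d1 (is_derive_scale lam (dA _ (ltW p0))).
    apply: is_derive_eq (is_derive_scale (expR (- lam * x)) d2) _.
    have -> : phi p = expR (- lam * x) * (expR (lam * p) * v p).
      by rewrite /phi mulrA -expRD; congr (expR _ * _); ring.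
    by ring.
Qed.

Definition energy zeta f v X k L : R :=
  Int 0 X (fun x => zeta (f x) * v x * conv k L v x).

Section Positivity.
Variables (H eta zeta f v : R -> R) (X L : R).
Hypotheses (HH : convex_entropy H eta zeta) (X0 : 0 <= X) (L0 : 0 < L) (XL : X <= L).
Hypotheses (cf : continuous f) (cv : continuous v).
Hypotheses (v0 : forall x, x <= 0 -> v x = 0).
Hypothesis (df : forall x, 0 < x < X -> is_derive x 1 f (v x)).

Let czf : continuous (fun x => zeta (f x)).
Proof.
move=> x; apply: (@continuous_comp _ _ _ f zeta); first exact: cf.
by have [_ _ cz _] := HH; exact: cz.
Qed.

Let integrable_integrand k : leb.-integrable `]0, L] (EFin \o k) ->
  leb.-integrable `[0, X] (EFin \o (fun x => zeta (f x) * v x * conv k L v x)).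
Proof.
move=> ik; apply: continuous_at_integrable => x _.
apply: cvgM; last exact: conv_continuous.
by apply: cvgM; [exact: czf|exact: cv].
Qed.

(* With g = eta(f)(f - y) - H(f) + H(y), g(0) = 0 <= g(X) by convexity while
   g' is at most the integrand because eta is nondecreasing. *)
Lemma energy_expR_ge0 lam : 0 <= lam -> 0 <= energy zeta f v X (fun q => expR (- lam * q)) L.
Proof.
move=> lam0; have [dH deta cz _] := HH.
have [y [y0 dy hy]] := conv_expR lam L0 XL cf cv v0 df.
have -> : energy zeta f v X (fun q => expR (- lam * q)) L =
    Int 0 X (fun x => zeta (f x) * v x * (f x - y x)).
  by apply: eq_Rintegral => x; rewrite inE /= in_itv /= => hx; rewrite hy.
pose G x := eta (f x) * (f x - y x) - (H (f x) - H (y x)).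
pose dG x := zeta (f x) * v x * (f x - y x) - (eta (f x) - eta (y x)) * (lam * (f x - y x)).
have cy x : 0 <= x -> {for x, continuous y} by move=> /dy; exact: is_derive_continuous.
have ceta : continuous eta by move=> z; exact: is_derive_continuous (deta z).
have cH : continuous H by move=> z; exact: is_derive_continuous (dH z).
have cfy x : 0 <= x -> {for x, continuous (fun x => f x - y x)}.
  by move=> x0; apply: cvgB; [exact: cf|exact: cy].
have cef : continuous (fun x => eta (f x)).
  by move=> x; apply: (@continuous_comp _ _ _ f eta); [exact: cf|exact: ceta].
have cey x : 0 <= x -> {for x, continuous (fun x => eta (y x))}.
  by move=> x0; apply: (@continuous_comp _ _ _ y eta); [exact: cy|exact: ceta].
have cHf : continuous (fun x => H (f x)).
  by move=> x; apply: (@continuous_comp _ _ _ f H); [exact: cf|exact: cH].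
have cHy x : 0 <= x -> {for x, continuous (fun x => H (y x))}.
  by move=> x0; apply: (@continuous_comp _ _ _ y H); [exact: cy|exact: cH].
have cI x : 0 <= x -> {for x, continuous (fun x => zeta (f x) * v x * (f x - y x))}.
  by move=> x0; apply: cvgM; [apply: cvgM; [exact: czf|exact: cv]|exact: cfy].
have cdG x : 0 <= x <= X -> {for x, continuous dG}.
  move=> /andP[x0 _]; apply: cvgB; first exact: cI.
  apply: cvgM; first by apply: cvgB; [exact: cef|exact: cey].
  by apply: cvgM; [exact: cvg_cst|exact: cfy].
have : Int 0 X dG = G X - G 0.
  apply: Rintegral_FTC2; [exact: X0|exact: cdG| |].
    move=> x /andP[x0 _]; apply: cvgB.
      by apply: cvgM; [exact: cef|exact: cfy].
    by apply: cvgB; [exact: cHf|exact: cHy].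
  move=> x hx; have /andP[x0 xX] := hx.
  have dx := df hx; have dyx := dy x (ltW x0).
  have d1 : is_derive x 1 (fun x => eta (f x)) (zeta (f x) * v x) by exact: is_derive1_comp.
  have d2 : is_derive x 1 (fun x => H (f x)) (eta (f x) * v x) by exact: is_derive1_comp.
  have d3 : is_derive x 1 (fun x => H (y x)) (eta (y x) * (lam * (f x - y x))) by exact: is_derive1_comp.
  apply: is_derive_eq (is_derive_sub (is_derive_mul d1 (is_derive_sub dx dyx)) (is_derive_sub d2 d3)) _.
  by rewrite /dG; ring.
have G0 : G 0 = 0 by rewrite /G y0 !subrr mulr0 subrr.
have GX : 0 <= G X.
  have := convex_entropy_tangent HH (f X) (y X).
  by rewrite /G -[y X - f X]opprB -[H (y X) - _]opprB mulrN lerN2 subr_ge0.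
rewrite G0 subr0 => IG; rewrite -IG in GX; apply: (le_trans GX).
apply: le_Rintegral => //.
- exact: continuous_at_integrable.
- by apply: continuous_at_integrable => x /andP[x0 _]; exact: cI.
move=> x _; rewrite /dG gerBl mulrCA; apply: mulr_ge0 => //.
have [h|/ltW h] := leP (y x) (f x).
  by apply: mulr_ge0; rewrite subr_ge0 //; exact: (convex_entropy_homo HH).
by apply: mulr_le0; rewrite subr_le0 //; exact: (convex_entropy_homo HH).
Qed.

Lemma energy_lin k1 k2 (c : R) : leb.-integrable `]0, L] (EFin \o k1) ->
  leb.-integrable `]0, L] (EFin \o k2) ->
  energy zeta f v X (fun q => k1 q + c * k2 q) L =
  energy zeta f v X k1 L + c * energy zeta f v X k2 L.
Proof.
move=> i1 i2; rewrite /energy -RintegralZl //; last exact: integrable_integrand.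
have i2c : leb.-integrable `[0, X] (EFin \o (fun x => c * (zeta (f x) * v x * conv k2 L v x))).
  by under [X in integrable _ _ X]funext => q do rewrite /= EFinM; apply: integrableZl => //; exact: integrable_integrand.
rewrite -RintegralD //; last exact: integrable_integrand.
apply: eq_Rintegral => x _.
have j1 := conv_integrable x L0 i1 cv; have j2 := conv_integrable x L0 i2 cv.
have -> : conv (fun q => k1 q + c * k2 q) L v x = conv k1 L v x + c * conv k2 L v x.
  rewrite /conv -RintegralZl // -RintegralD //.
    by apply: eq_Rintegral => q _; ring.
  by under [X in integrable _ _ X]funext => q do rewrite /= EFinM; exact: integrableZl.
by ring.
Qed.

(** Dominated convergence twice: in q for the convolution at each x, with bound M g, then in x,
    where the convolutions are bounded by a constant. *)
Lemma energy_limit (k_ : nat -> R -> R) k g :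
  (forall n, leb.-integrable `]0, L] (EFin \o k_ n)) ->
  leb.-integrable `]0, L] (EFin \o k) -> leb.-integrable `]0, L] (EFin \o g) ->
  (forall n q, 0 < q <= L -> `|k_ n q| <= g q) ->
  (forall q, 0 < q <= L -> k_ n q @[n --> \oo] --> k q) ->
  (forall n, 0 <= energy zeta f v X (k_ n) L) -> 0 <= energy zeta f v X k L.
Proof.
move=> ik_ ik ig kg kk e0.
have mint h : leb.-integrable `]0, L] (EFin \o h) -> measurable_fun `]0, L]%classic h.
  by move=> ih; apply: (measurable_EFinP _ _).1; case/integrableP : ih.
have [M M0 hM] : exists2 M : R, 0 <= M & forall y, - L <= y <= X -> `|v y| <= M.
  apply: continuous_at_bounded => [|y _]; last exact: cv.
  by apply: le_trans X0; rewrite oppr_le0 ltW.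
have [C C0 hC] : exists2 C : R, 0 <= C & forall y, 0 <= y <= X -> `|zeta (f y) * v y| <= C.
  by apply: continuous_at_bounded => // y _; apply: cvgM; [exact: czf|exact: cv].
have vM x q : 0 <= x <= X -> 0 < q <= L -> `|v (x - q)| <= M.
  by move=> /andP[? ?] /andP[? ?]; apply: hM; apply/andP; split; lra.
have cvconv x : 0 <= x <= X -> conv (k_ n) L v x @[n --> \oo] --> conv k L v x.
  move=> hx; have [] // := @dominated_Rintegral R `]0, L]%classic (fun n q => k_ n q * v (x - q))
    (fun q => k q * v (x - q)) (fun q => M * g q).
  - move=> n; apply: measurable_funM; first exact: mint.
    apply: measurable_funTS; apply: (measurableT_comp (f := v)); last exact: measurable_reflect.
    exact: continuous_measurable_fun.
  - apply: measurable_funM; first exact: mint.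
    apply: measurable_funTS; apply: (measurableT_comp (f := v)); last exact: measurable_reflect.
    exact: continuous_measurable_fun.
  - move=> q; rewrite /= in_itv /= => hq; apply: cvgM; [exact: kk|exact: cvg_cst].
  - by under [X in integrable _ _ X]funext => q do rewrite /= EFinM; exact: integrableZl.
  - move=> n q; rewrite /= in_itv /= => hq; rewrite normrM mulrC.
    by apply: ler_pM => //; [exact: vM|exact: kg].
pose K := Rintegral leb `]0, L] g.
have mI h : leb.-integrable `]0, L] (EFin \o h) ->
    measurable_fun `[0, X]%classic (fun x => zeta (f x) * v x * conv h L v x).
  by move=> /integrable_integrand ih; apply: (measurable_EFinP _ _).1; case/integrableP : ih.
have [] := @dominated_Rintegral R `[0, X]%classic
  (fun n x => zeta (f x) * v x * conv (k_ n) L v x)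
  (fun x => zeta (f x) * v x * conv k L v x) (fun=> C * (M * K)).
- exact: measurable_itv.
- by move=> n; exact: mI.
- exact: mI.
- move=> x; rewrite /= in_itv /= => hx; apply: cvgM; [exact: cvg_cst|exact: cvconv].
- by apply: continuous_at_integrable => y _; exact: cst_continuous.
- move=> n x; rewrite /= in_itv /= => hx; rewrite normrM; apply: ler_pM => //; first exact: hC.
  apply: (le_trans (conv_norm_le L0 (ik_ n) cv (fun q => @vM x q hx))).
  apply: ler_wpM2l => //; apply: le_Rintegral => //.
  + exact: (integrable_norm (ik_ n)).
  + by move=> q; rewrite /= in_itv /=; exact: kg.
move=> _ cvE; have <- : lim (energy zeta f v X (k_ n) L @[n --> \oo]) = energy zeta f v X k L.
  exact/cvg_lim.
by apply: limr_ge; [apply/cvg_ex; eexists; exact: cvE|exact: nearW].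
Qed.

Lemma energy_ext k1 k2 : (forall q, 0 < q <= L -> k1 q = k2 q) ->
  energy zeta f v X k1 L = energy zeta f v X k2 L.
Proof.
move=> h; apply: eq_Rintegral => x _; congr (_ * _); apply: eq_Rintegral => q.
by rewrite inE /= in_itv /= => /h ->.
Qed.

Variable al : R.
Hypothesis al01 : 0 < al < 1.

Let integrable_expR (c : R) : leb.-integrable `]0, L] (EFin \o (fun q => expR (c * q))).
Proof.
apply: (@integrableS _ _ _ leb `[0, L]%classic) => //; first exact: subset_itv_oc_cc.
by apply: continuous_at_integrable => q _; exact: is_derive_continuous (is_derive_expR_scale c q).
Qed.

Let integrable_cM (c : R) k : leb.-integrable `]0, L] (EFin \o k) ->
  leb.-integrable `]0, L] (EFin \o (fun q => c * k q)).
Proof.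
by move=> ik; under [X in integrable _ _ X]funext => q do rewrite /= EFinM; exact: integrableZl.
Qed.

Let integrable_add k1 k2 : leb.-integrable `]0, L] (EFin \o k1) ->
  leb.-integrable `]0, L] (EFin \o k2) ->
  leb.-integrable `]0, L] (EFin \o (fun q => k1 q + k2 q)).
Proof.
by move=> i1 i2; under [X in integrable _ _ X]funext => q do rewrite /= EFinD; exact: integrableD.
Qed.

Let integrable0 : leb.-integrable `]0, L] (EFin \o (fun=> (0 : R))).
Proof.
apply: (@integrableS _ _ _ leb `[0, L]%classic) => //; first exact: subset_itv_oc_cc.
by apply: continuous_at_integrable => q _; exact: cst_continuous.
Qed.

Let energy0 : energy zeta f v X (fun=> 0) L = 0.
Proof.
(* Linearity on 0 + (-1) 0 reads E = E - E. *)
have := energy_lin (-1) integrable0 integrable0.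
rewrite (@energy_ext _ (fun=> 0)); last by move=> q _; rewrite mulr0 addr0.
by rewrite mulN1r subrr.
Qed.

(** Powers of e^(-mu q) are again decaying exponentials, of rate j mu, so the partial sum is a
    combination of them with nonnegative coefficients. *)
Lemma energy_neg_binom_sum_ge0 (mu : R) n : 0 <= mu ->
  leb.-integrable `]0, L] (EFin \o (fun q => neg_binom_sum al n (expR (- mu * q)))) /\
  0 <= energy zeta f v X (fun q => neg_binom_sum al n (expR (- mu * q))) L.
Proof.
move=> mu0; have XX (j : nat) q : expR (- mu * q) ^+ j = expR (- (j%:R * mu) * q).
  by rewrite -expRM_natl; congr expR; ring.
elim: n => [|n [IH1 IH2]].
  have -> : (fun q => neg_binom_sum al 0 (expR (- mu * q))) = fun=> 0.
    by apply/funext => q; rewrite /neg_binom_sum big_ord0.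
  by rewrite energy0.
have -> : (fun q => neg_binom_sum al n.+1 (expR (- mu * q))) =
    (fun q => neg_binom_sum al n (expR (- mu * q)) +
              neg_binom_coef al n * expR (- (n%:R * mu) * q)).
  by apply/funext => q; rewrite /neg_binom_sum big_ord_recr /= XX.
split; first by apply: integrable_add => //; apply: integrable_cM; exact: integrable_expR.
rewrite energy_lin //; apply: addr_ge0 => //; apply: mulr_ge0.
  by have /andP[] := neg_binom_coef_bound al01 n.
by apply: energy_expR_ge0; rewrite mulr_ge0.
Qed.

(** Both bounds are 1 + r <= e^r, at r = mu q and at r = - mu q. The upper one and the lower one
    squeeze the quotient to q as mu tends to 0. *)
Lemma expR_chord_bound (mu q : R) : 0 < mu -> 0 < q ->
  q * expR (- mu * q) <= mu^-1 * (1 - expR (- mu * q)) <= q.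
Proof.
move=> mu0 q0; apply/andP; split.
  rewrite ler_pdivlMl // lerBrDr.
  have := expR_ge1Dx (mu * q).
  have e1 : expR (- mu * q) * expR (mu * q) = 1 by rewrite -expRD mulNr addNr expR0.
  move=> h; have := ler_wpM2l (expR_ge0 (- mu * q)) h; rewrite e1.
  by apply: le_trans; rewrite le_eqVlt; apply/orP; left; apply/eqP; ring.
by rewrite ler_pdivrMl //; have := expR_ge1Dx (- mu * q); lra.
Qed.

Lemma powRN_le (x y : R) : 0 < x <= y -> y `^ (- al) <= x `^ (- al).
Proof.
move=> /andP[x0 xy]; have y0 := lt_le_trans x0 xy; have /andP[a0 _] := al01.
rewrite !powRN lef_pV2 ?posrE ?powR_gt0 //.
by apply: ge0_ler_powR => //; rewrite ?nnegrE; exact: ltW.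
Qed.

(* The kernel q^-al is the limit, as mu -> 0, of ((1 - e^(-mu q)) / mu)^-al, which is
   a series of exponentials with nonnegative coefficients. *)
Lemma energy_powRN_ge0 : 0 <= energy zeta f v X (fun q => q `^ (- al)) L.
Proof.
have /andP[a0 a1] := al01.
have ipow : leb.-integrable `]0, L] (EFin \o (fun q => q `^ (- al))).
  by apply: integrableS (powRN_integrable al01 L0) => //; exact: subset_itv_oc_cc.
pose w (mu q : R) := (mu^-1 * (1 - expR (- mu * q))) `^ (- al).
have e01 (mu q : R) : 0 < mu -> 0 < q -> 0 < expR (- mu * q) < 1.
  by move=> mu0 q0; rewrite expR_gt0 /= -expR0 ltr_expR mulNr oppr_lt0 mulr_gt0.
have wE (mu q : R) : 0 < mu -> 0 < q -> w mu q = mu `^ al * (1 - expR (- mu * q)) `^ (- al).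
  move=> mu0 q0; have /andP[_ e1] := e01 _ _ mu0 q0.
  rewrite /w powRM ?invr_ge0 ?(ltW mu0) ?subr_ge0 ?(ltW e1) //; congr (_ * _).
  by rewrite -powR_inv1 ?(ltW mu0) // -powRrM; congr (_ `^ _); ring.
(* A domination uniform in mu: the lower chord bound gives w <= q^(-al) e^(al mu q), and mu q <=
   L. *)
have wb (mu q : R) : 0 < mu <= 1 -> 0 < q <= L -> `|w mu q| <= expR (al * L) * q `^ (- al).
  move=> /andP[mu0 mu1] /andP[q0 qL]; rewrite ger0_norm ?powR_ge0 //.
  have /andP[h1 h2] := expR_chord_bound mu0 q0.
  apply: (@le_trans _ _ ((q * expR (- mu * q)) `^ (- al))).
    by apply: powRN_le; rewrite h1 mulr_gt0 // expR_gt0.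
  rewrite powRM ?(ltW q0) ?expR_ge0 // mulrC; apply: ler_wpM2r; first exact: powR_ge0.
  rewrite /powR gt_eqF ?expR_gt0 // expRK ler_expR.
  have -> : - al * (- mu * q) = al * (mu * q) by ring.
  rewrite ler_pM2l //; apply: le_trans qL.
  by rewrite ger_pMl.
have mw (mu : R) : 0 < mu -> measurable_fun [set: R] (w mu).
  move=> mu0; apply: (measurableT_comp (f := fun y : R => y `^ (- al))); first exact: measurable_powR.
  apply: measurable_funM => //; apply: measurable_funB => //.
  apply: continuous_measurable_fun => q.
  exact: is_derive_continuous (is_derive_expR_scale (- mu) q).
have iw (mu : R) : 0 < mu <= 1 -> leb.-integrable `]0, L] (EFin \o w mu).
  move=> mu01; apply: (@le_integrable _ _ _ leb _ _ _ (EFin \o (fun q => expR (al * L) * q `^ (- al)))) => //.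
  - by apply: (measurable_EFinP _ _).2; apply: measurable_funTS; apply: mw; case/andP: mu01.
  - move=> q; rewrite /= in_itv /= => hq; rewrite lee_fin (le_trans (wb _ _ mu01 hq)) //.
    exact: ler_norm.
  - exact: integrable_cM.
have ew (mu : R) : 0 < mu <= 1 -> 0 <= energy zeta f v X (w mu) L.
  move=> mu01; have /andP[mu0 mu1] := mu01.
  (* The summand 0 gives the kernel the shape expected by [energy_lin]. The partial sums increase to
     w, which therefore dominates them. *)
  pose k_ n q := 0 + mu `^ al * neg_binom_sum al n (expR (- mu * q)).
  have nb n := energy_neg_binom_sum_ge0 n (ltW mu0).
  apply: (@energy_limit k_ _ (w mu)).
  - by move=> n; apply: integrable_add => //; apply: integrable_cM; case: (nb n).
  - exact: iw.
  - exact: iw.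
  - move=> n q /andP[q0 qL]; rewrite /k_ add0r wE //.
    have /andP[h1 h2] := neg_binom_sum_le al01 n (e01 _ _ mu0 q0).
    rewrite normrM !ger0_norm ?powR_ge0 //; apply: ler_wpM2l => //.
    exact: powR_ge0.
  - move=> q /andP[q0 qL]; rewrite wE // /k_.
    under eq_fun do rewrite add0r.
    by apply: cvgM; [exact: cvg_cst|apply: neg_binom_sum_cvg => //; exact: e01].
  - move=> n; rewrite /k_ energy_lin //; last by case: (nb n).
    by rewrite energy0 add0r mulr_ge0 ?powR_ge0 //; case: (nb n).
have mun n : 0 < (n.+1%:R^-1 : R) <= 1.
  by rewrite invr_gt0 ltr0n /= invf_le1 ?ltr0n // ler1n.
apply: (@energy_limit (fun n => w n.+1%:R^-1) _ (fun q => expR (al * L) * q `^ (- al))).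
- by move=> n; exact: iw.
- exact: ipow.
- exact: integrable_cM.
- by move=> n q hq; exact: wb.
- move=> q /andP[q0 qL].
  have cp := @powR_continuous_at R (- al) q q0.
  apply: (@cvg_comp _ _ _ (fun n : nat => (n.+1%:R^-1)^-1 * (1 - expR (- n.+1%:R^-1 * q)))
    (fun y : R => y `^ (- al)) _ _ _ _ cp).
  apply: (@squeeze_cvgr _ _ _ _ (fun n => q * expR (- n.+1%:R^-1 * q)) (cst q)).
  + by apply: nearW => n; apply: expR_chord_bound => //; case/andP: (mun n).
  + rewrite -[X in _ --> X]mulr1; apply: cvgM; first exact: cvg_cst.
    have h0 : - n.+1%:R^-1 * q @[n --> \oo] --> (0 : R).
      rewrite -(mul0r q); apply: cvgM; last exact: cvg_cst.
      by rewrite -oppr0; apply: cvgN; exact: cvg_harmonic.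
    have := cvg_comp _ _ h0 (@continuous_expR R 0).
    by rewrite expR0.
  + exact: cvg_cst.
- by move=> n; exact: ew.
Qed.

End Positivity.

End Energy.

(** * Fields satisfying the fractional equation *)

Section Field.
Variable R : realType.
Set Implicit Arguments. Unset Strict Implicit.
Implicit Types (f g H eta zeta sg : R -> R) (w v z : R -> R -> R) (a b x y t X : R).
Local Notation leb := (@lebesgue_measure R).
Local Notation Int a b f := (Rintegral leb `[a, b] f).
Local Notation joint v := (fun p : R * R => v p.1 p.2).

Lemma joint_bounded v a b (c d : R) :
  (forall x t, a <= x <= b -> c <= t <= d -> {for (x, t), continuous (joint v)}) ->
  exists2 M : R, 0 <= M & forall x t, a <= x <= b -> c <= t <= d -> `|v x t| <= M.
Proof.
move=> cv; pose K := (`[a, b]%classic `*` `[c, d]%classic : set (R * R)).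
have cK : compact K by apply: compact_setX; exact: segment_compact.
have : {within K, continuous (joint v)}.
  apply: continuous_in_subspaceT => -[x t] /set_mem [] /=.
  by rewrite !in_itv /=; exact: cv.
move=> /continuous_compact /(_ cK) /compact_bounded [M0 [_ hM]].
exists (`|M0| + 1); first by rewrite addr_ge0.
move=> x t hx ht; apply: (hM (`|M0| + 1)); first by have := ler_norm M0; lra.
by exists (x, t) => //; split; rewrite /= in_itv.
Qed.

Lemma Rintegral_antiderivative f A a b : a <= b -> continuous f ->
  (forall x, a <= x <= b -> is_derive x 1 A (f x)) -> Int a b f = A b - A a.
Proof.
move=> ab cf dA; apply: Rintegral_FTC2 => //.
- by move=> x _; exact: cf.
- by move=> x /dA; exact: is_derive_continuous.
- by move=> x /andP[ax xb]; apply: dA; rewrite !ltW.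
Qed.

(** z is bounded on the compact box, so a constant dominates the difference quotients. *)
Lemma is_derive_Rintegral w z a b (t0 t1 t : R) : a <= b -> t0 < t < t1 ->
  (forall x s, a <= x <= b -> t0 <= s <= t1 -> {for (x, s), continuous (joint z)}) ->
  (forall x s, a <= x <= b -> t0 < s < t1 -> is_derive s 1 (w x) (z x s)) ->
  (forall s, continuous (w^~ s)) ->
  is_derive t 1 (fun s => Int a b (w^~ s)) (Int a b (z^~ t)).
Proof.
move=> ab tt cz dw cw.
have [M M0 hM] := joint_bounded cz.
have It : `]t0, t1[%classic t by rewrite /= in_itv.
have intw s : `]t0, t1[%classic s -> leb.-integrable `[a, b] (EFin \o w^~ s).
  by move=> _; apply: continuous_at_integrable => x _; exact: cw.
have derw s x : `]t0, t1[%classic s -> `[a, b]%classic x -> derivable (w x) s 1.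
  rewrite /= !in_itv /= => hs hx; have d := dw x s hx hs; exact: ex_derive.
have iM : leb.-integrable `[a, b] (EFin \o (fun=> M)).
  by apply: continuous_at_integrable => x _; exact: cst_continuous.
have pz s x : `]t0, t1[%classic s -> `[a, b]%classic x -> partial1of2 (fun s x => w x s) s x = z x s.
  rewrite /= !in_itv /= => hs hx; have d := dw x s hx hs.
  by rewrite /partial1of2 derive1E; exact: derive_val.
have bz s x : `]t0, t1[%classic s -> `[a, b]%classic x -> `|partial1of2 (fun s x => w x s) s x| <= M.
  move=> hs hx; rewrite pz //; move: hs hx; rewrite /= !in_itv /= => /andP[h1 h2] hx.
  by apply: hM => //; rewrite !ltW.
have D := @derivable_under_integral R _ _ leb (fun s x => w x s) `[a, b]%classic
  (measurable_itv _) t t0 t1 It intw derw (fun=> M) (fun=> M0) iM bz.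
have E := @differentiation_under_integral R _ _ leb (fun s x => w x s) `[a, b]%classic
  (measurable_itv _) t t0 t1 It intw derw (fun=> M) (fun=> M0) iM bz.
have -> : Int a b (z^~ t) = (fun s => Int a b (w^~ s))^`()%classic t.
  by rewrite E; apply: eq_Rintegral => x /set_mem hx; rewrite pz.
by rewrite derive1E; exact: derivableP.
Qed.

Lemma param_Rintegral_continuous w a b t : a <= b ->
  (forall x s, {for (x, s), continuous (joint w)}) ->
  {for t, continuous (fun s => Int a b (w^~ s))}.
Proof.
move=> ab cw; apply/cvgrPdist_le => e e0.
have cs s : continuous (w^~ s) by move=> x; exact: section_continuous_l.
have e1 : 0 < e / (b - a + 1) by rewrite divr_gt0 //; lra.
have [de de0 hde] := @uniform_continuous_box R (joint w) a b (t - 1) (t + 1) (fun x s _ _ => cw x s) _ e1.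
near=> s.
rewrite -RintegralB //; try by apply: continuous_at_integrable => x _; exact: cs.
apply: (@le_trans _ _ (e / (b - a + 1) * (b - a))); last first.
  by rewrite mulrAC ler_pdivrMr; [rewrite ler_pM2l //; lra|lra].
apply: norm_Rintegral_le => //.
  by apply: continuous_at_integrable => x _; apply: cvgB; exact: cs.
move=> x xab; apply/ltW; apply: (hde x t x s).
- exact: xab.
- by blra.
- by rewrite subrr normr0.
- by near: s; apply: cvgr_dist_lt => //; exact: cvg_id.
Unshelve. all: by end_near. Qed.

Lemma moving_Rintegral_continuous w sg t :
  (forall x s, {for (x, s), continuous (joint w)}) ->
  (forall s, 0 <= sg s) -> {for t, continuous sg} ->
  {for t, continuous (fun s => Int 0 (sg s) (w^~ s))}.
Proof.
move=> cw sg0 csg; apply/cvgrPdist_le => e e0.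
have cs s : continuous (w^~ s) by move=> x; exact: section_continuous_l.
have [A A0 dA] := antiderivative_exists (cs t).
have IA y : 0 <= y -> Int 0 y (w^~ t) = A y.
  move=> y0; rewrite -[RHS]subr0 -[X in _ - X]A0; apply: Rintegral_antiderivative => //.
  by move=> x /andP[x0 _]; exact: dA.
have cA : {for sg t, continuous A} by exact: is_derive_continuous (dA _ (sg0 t)).
have cAs : {for t, continuous (fun s => A (sg s))}.
  exact: (@continuous_comp _ _ _ sg A).
have e2 : 0 < e / 2 by lra.
have B0 : 0 < sg t + 1 by have := sg0 t; lra.
have e1 : 0 < e / 2 / (sg t + 1) by rewrite divr_gt0.
have [de de0 hde] := @uniform_continuous_box R (joint w) 0 (sg t + 1) (t - 1) (t + 1) (fun x s _ _ => cw x s) _ e1.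
near=> s.
have sB : sg s <= sg t + 1.
  suff : `|sg t - sg s| <= 1 by rewrite ler_distlC => /andP[? ?]; lra.
  by near: s; apply: cvgr_dist_le.
have -> : Int 0 (sg t) (w^~ t) - Int 0 (sg s) (w^~ s) =
    (A (sg t) - A (sg s)) + Int 0 (sg s) (fun x => w x t - w x s).
  rewrite RintegralB //; try by apply: continuous_at_integrable => x _; exact: cs.
  by rewrite !IA //; ring.
apply: (le_trans (ler_normD _ _)); rewrite [leRHS](splitr e); apply: lerD.
  by near: s; apply: cvgr_dist_le.
apply: (@le_trans _ _ (e / 2 / (sg t + 1) * (sg s - 0))); last first.
  by rewrite subr0 mulrAC ler_pdivrMr // ler_pM2l.
apply: norm_Rintegral_le => //.
  by apply: continuous_at_integrable => x _; apply: cvgB; exact: cs.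
move=> x /andP[x0 xs]; apply/ltW; apply: (hde x t x s).
- by rewrite x0 (le_trans xs).
- by blra.
- by rewrite subrr normr0.
- by near: s; apply: cvgr_dist_lt => //; exact: cvg_id.
Unshelve. all: by end_near. Qed.

Variables (T al c L Lam : R).
Hypotheses (al01 : 0 < al < 1) (c0 : 0 <= c) (L0 : 0 < L) (Lam0 : 0 <= Lam).

(* With v the space derivative of a field, extended by 0 to x <= 0, and c = 1 / Gamma (1 - al),
   c * flux v is the Caputo derivative of the field as soon as x <= L. *)
Definition flux v x t : R := conv (fun q => q `^ (- al)) L (v^~ t) x.

(** v is continuous on the whole strip but is the derivative of w only below the front: past it,
    both are mere extensions. The witness z is the common value of the time derivative and of the
    flux divergence; its continuity is claimed only inside. *)
Definition field sg w v : Prop :=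
  [/\ forall x t, {for (x, t), continuous (joint w)},
      forall x t, 0 < t < T -> {for (x, t), continuous (joint v)},
      forall x t, 0 < t < T -> x <= 0 -> v x t = 0,
      forall x t, 0 < t < T -> 0 < x < sg t -> is_derive x 1 (w^~ t) (v x t) &
      exists z, forall x t, 0 < t < T -> 0 < x < sg t ->
        [/\ is_derive t 1 (w x) (z x t), is_derive x 1 (fun y => c * flux v y t) (z x t) &
            {for (x, t), continuous (joint z)}]].

(** Monotonicity keeps a point that is below the front below it later; the Lipschitz bound limits
    the mass gained by the moving end point. *)
Definition free_boundary sg : Prop :=
  [/\ forall t, 0 < sg t <= L, continuous sg &
      forall s t, 0 < s -> s <= t -> t < T -> 0 <= sg t - sg s <= Lam * (t - s)].

Let ipow : leb.-integrable `]0, L] (EFin \o (fun q => q `^ (- al))).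
Proof.
by apply: integrableS (powRN_integrable al01 L0) => //; exact: subset_itv_oc_cc.
Qed.

Lemma field_section sg w v t : field sg w v -> 0 < t < T ->
  continuous (w^~ t) /\ continuous (v^~ t).
Proof.
move=> [cw cv _ _ _] ht; split => x; apply: section_continuous_l; first exact: cw.
exact: cv.
Qed.

(** The no-flux condition at the fixed end: at x = 0 the convolution sees only the zero extension of
    v. *)
Lemma flux0 sg w v t : field sg w v -> 0 < t < T -> flux v 0 t = 0.
Proof.
move=> [_ _ v0 _ _] ht; rewrite -[RHS](conv0 (fun q => q `^ (- al)) L 0).
apply: eq_Rintegral => q; rewrite inE /= in_itv /= => /andP[q0 _].
by rewrite v0 // sub0r oppr_le0 ltW.
Qed.

Lemma field0 sg : field sg (fun _ _ => 0) (fun _ _ => 0).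
Proof.
split => //.
- by move=> x t; exact: cst_continuous.
- by move=> x t _; exact: cst_continuous.
- by move=> x t _ _; exact: is_derive_cst.
exists (fun _ _ => 0) => x t _ _; split.
- exact: is_derive_cst.
- rewrite /flux; under [X in is_derive _ _ X _]funext => y do rewrite conv0 mulr0.
  exact: is_derive_cst.
- exact: cst_continuous.
Qed.

(** The equation is linear, but the difference satisfies it only where both terms do, hence the
    minimum of the fronts. *)
Lemma field_sub sg1 sg2 w1 w2 v1 v2 : field sg1 w1 v1 -> field sg2 w2 v2 ->
  field (fun t => Num.min (sg1 t) (sg2 t)) (fun x t => w1 x t - w2 x t)
    (fun x t => v1 x t - v2 x t).
Proof.
move=> f1 f2; have [cw1 cv1 v10 dw1 [z1 hz1]] := f1; have [cw2 cv2 v20 dw2 [z2 hz2]] := f2.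
split.
- by move=> x t; apply: cvgB; [exact: cw1|exact: cw2].
- by move=> x t ht; apply: cvgB; [exact: cv1|exact: cv2].
- by move=> x t ht x0; rewrite v10 // v20 // subrr.
- move=> x t ht; rewrite lt_min => /and3P[x0 h1 h2].
  by apply: is_derive_sub; [apply: dw1|apply: dw2] => //; rewrite x0.
exists (fun x t => z1 x t - z2 x t) => x t ht; rewrite lt_min => /and3P[x0 h1 h2].
have [|a1 b1 e1] := hz1 x t ht _; first by rewrite x0.
have [|a2 b2 e2] := hz2 x t ht _; first by rewrite x0.
split.
- exact: is_derive_sub.
- have [_ s1] := field_section f1 ht; have [_ s2] := field_section f2 ht.
  rewrite /flux; under [X in is_derive _ _ X _]funext => y do rewrite convB // mulrBr.
  exact: is_derive_sub.
- by apply: cvgB; [exact: e1|exact: e2].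
Qed.

Lemma free_boundary_min sg1 sg2 : free_boundary sg1 -> free_boundary sg2 ->
  free_boundary (fun t => Num.min (sg1 t) (sg2 t)).
Proof.
move=> [b1 c1 l1] [b2 c2 l2]; split.
- move=> t; have /andP[h1 h2] := b1 t; have /andP[h3 h4] := b2 t.
  by rewrite lt_min h1 h3 ge_min h2.
- by move=> t; apply: continuous_min; [exact: c1|exact: c2].
move=> s t s0 st tT.
have /andP[h1 h2] := l1 s t s0 st tT; have /andP[h3 h4] := l2 s t s0 st tT.
case: (lerP (sg1 s) (sg2 s)) => ?; case: (lerP (sg1 t) (sg2 t)) => ?; blra.
Qed.

Lemma flux_continuous sg w v x t : field sg w v -> 0 < t < T ->
  {for (x, t), continuous (joint (flux v))}.
Proof.
move=> [_ cv _ _ _] /andP[t0 tT].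
have cv' (y s : R) : t / 2 <= s <= (t + T) / 2 -> {for (y, s), continuous (joint v)}.
  by move=> /andP[h1 h2]; apply: cv; blra.
apply/cvgrPdist_le => e e0.
have [de de0 hde] := conv_uniform (x - 1) (x + 1) L0 ipow cv' e0.
pose r := Num.min (Num.min de 1) (Num.min (t / 2) ((T - t) / 2)).
have r0 : 0 < r by rewrite !lt_min de0 ltr01 /=; blra.
have : r <= r by [].
rewrite {2}/r !le_min => /andP[/andP[r1 r2] /andP[r3 r4]].
exists (ball x r, ball t r) => /=; first by split; exact: nbhsx_ballx.
move=> [x' t'] [/= hx ht].
have := hx; rewrite /ball /= ltr_distlC => /andP[x1 x2].
have := ht; rewrite /ball /= ltr_distlC => /andP[t1 t2].
apply: hde; try (by blra).
  exact: lt_le_trans hx r1.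
exact: lt_le_trans ht r1.
Qed.

Lemma half_lt (r : R) : 0 < r -> r / 2 < r.
Proof. by move=> r0; lra. Qed.

Lemma inner_point (X x d : R) : 0 < d -> d <= X / 2 -> 0 <= x <= X ->
  exists x', [/\ d <= x', x' <= X - d & `|x - x'| <= d].
Proof.
move=> d0 dX /andP[x0 xX].
have [h1|h1] := leP x d; last have [h2|h2] := leP x (X - d).
- exists d; split => //; first by lra.
  by rewrite ler_norml; apply/andP; split; lra.
- by exists x; split => //; [exact: ltW|rewrite subrr normr0 ltW].
- exists (X - d); split => //; first by lra.
  by rewrite ler_norml; apply/andP; split; lra.
Qed.

(* The equation holds only in the open domain; in this integrated form it extends,
   uniformly in x, to x = 0 and x = sg t0. *)
Lemma mass_increment sg w v (t0 : R) : field sg w v -> free_boundary sg -> 0 < t0 < T ->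
  forall k : R, 0 < k -> exists2 de : R, 0 < de & forall h A, 0 < h < de ->
    t0 + h < T /\
    (A 0 = 0 -> (forall x, 0 <= x -> is_derive x 1 A (w x (t0 + h) - w x t0)) ->
     forall x, 0 <= x <= sg t0 -> `|A x - h * (c * flux v x (t0 + h))| <= k * h).
Proof.
have c0' := c0.
move=> fw [sgb _ sgm] /andP[t00 t0T] k k0; have [cw cv v0 dw [z hz]] := fw.
pose X := sg t0; have /andP[X0 XL] : 0 < X <= L by exact: sgb.
pose tb := (t0 + T) / 2.
have tbT : t0 < tb < T by rewrite /tb; blra.
have cv' (y s : R) : t0 <= s <= tb -> {for (y, s), continuous (joint v)}.
  by move=> /andP[h1 h2]; apply: cv; case/andP: tbT => ? ?; blra.
have c10 : 0 < 3 * (c + 1) by lra.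
(* Three flux differences will each cost c k': two at the ends of the inner interval, one from
   moving x inside. The 1 allows c = 0. *)
pose k' := k / (3 * (c + 1)).
have k'0 : 0 < k' by rewrite divr_gt0.
have ck' : 3 * (c * k') <= k.
  rewrite /k' mulrA mulrA ler_pdivrMr // [leLHS]mulrC ler_pM2l //; lra.
have [de1 de10 hde] := conv_uniform 0 X L0 ipow cv' k'0.
exists (Num.min de1 (tb - t0)); first by case/andP: tbT => ? ?; rewrite lt_min de10 subr_gt0.
move=> h A /andP[h0]; rewrite lt_min => /andP[hde1 htb].
have /andP[tb1 tb2] := tbT.
have t1T : t0 + h < T by lra.
split => // A0 dA x; rewrite -/X => /andP[x0 xX].
have t1in : 0 < t0 + h < T by blra.
have t0in : 0 < t0 < T by rewrite t00.
have t1b : t0 <= t0 + h <= tb by rewrite lerDl ltW //= -lerBrDl ltW.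
have XX0 : 0 <= (0 : R) <= X by rewrite lexx ltW.
have cwt s : continuous (w^~ s) by move=> y; exact: section_continuous_l.
(* As the front does not recede, the rectangle over ]0, sg t0[ stays in the domain during
   [t0, t0 + h]. *)
have inQ y s : 0 < y < X -> t0 <= s <= t0 + h -> 0 < s < T /\ 0 < y < sg s.
  move=> /andP[y0 yX] /andP[s0 s1]; split; first by blra.
  rewrite y0 (lt_le_trans yX) //; have : s < T by blra.
  by move=> sT; have /andP[] := sgm _ _ t00 s0 sT; rewrite subr_ge0.
(* Away from both ends the equation can be integrated in x. The mean value theorem in time yields
   the flux difference at some s; the flux at x1 is small since it is compared with the flux at 0,
   which vanishes. *)
have core x1 y : 0 < x1 < de1 -> x1 <= y < X ->
    `|(A y - A x1) - h * (c * flux v y (t0 + h))| <= h * (c * (2 * k')).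
  move=> /andP[x10 x1de] /andP[x1y yX].
  have inQ' y' s : x1 <= y' <= y -> t0 <= s <= t0 + h -> 0 < s < T /\ 0 < y' < sg s.
    by move=> /andP[h1 h2]; apply: inQ; rewrite (lt_le_trans x10) // (le_lt_trans h2).
  have dV s : s \in `]t0, t0 + h[ -> is_derive s 1 (fun s => Int x1 y (w^~ s))
      (c * flux v y s - c * flux v x1 s).
    rewrite in_itv /= => /andP[s0 s1].
    have sin : t0 <= s <= t0 + h by rewrite !ltW.
    have <- : Int x1 y (z^~ s) = c * flux v y s - c * flux v x1 s.
      apply: (@Rintegral_FTC2 _ (fun y => c * flux v y s)); first exact: x1y.
      - move=> y' hy; have [Q1 Q2] := inQ' y' s hy sin; have [_ _ cz] := hz _ _ Q1 Q2.
        exact: section_continuous_l.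
      - move=> y' hy; have [Q1 Q2] := inQ' y' s hy sin; have [_ dz _] := hz _ _ Q1 Q2.
        exact: is_derive_continuous dz.
      - move=> y' /andP[hy1 hy2]; have hy : x1 <= y' <= y by rewrite !ltW.
        by have [Q1 Q2] := inQ' y' s hy sin; have [] := hz _ _ Q1 Q2.
    apply: (@is_derive_Rintegral w z x1 y t0 (t0 + h) s x1y).
    - by rewrite s0.
    - by move=> y' s' hy hs; have [Q1 Q2] := inQ' y' s' hy hs; have [] := hz _ _ Q1 Q2.
    - move=> y' s' hy /andP[s0' s1'].
      have hs : t0 <= s' <= t0 + h by rewrite !ltW.
      by have [Q1 Q2] := inQ' y' s' hy hs; have [] := hz _ _ Q1 Q2.
    - exact: cwt.
  have [||s + VE] := @MVT _ (fun s => Int x1 y (w^~ s)) _ t0 (t0 + h) _ dV.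
  - by rewrite ltrDl.
  - by apply: continuous_at_within => s _; apply: param_Rintegral_continuous.
  rewrite in_itv /= => /andP[s0 s1].
  have -> : A y - A x1 = Int x1 y (w^~ (t0 + h)) - Int x1 y (w^~ t0).
    rewrite -RintegralB //; try by apply: continuous_at_integrable => ? _; exact: cwt.
    apply/esym; apply: Rintegral_antiderivative => //.
    - by move=> y'; apply: cvgB; exact: cwt.
    - by move=> y' /andP[h1 _]; apply: dA; rewrite (le_trans (ltW x10)).
  have -> : Int x1 y (w^~ (t0 + h)) - Int x1 y (w^~ t0) - h * (c * flux v y (t0 + h)) =
      h * (c * ((flux v y s - flux v y (t0 + h)) - (flux v x1 s - flux v 0 s))).
    have s_in : 0 < s < T by rewrite (lt_trans t00 s0) (lt_trans s1).
    by rewrite (flux0 fw s_in) VE; ring.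
  rewrite normrM (ger0_norm (ltW h0)) ler_pM2l // normrM (ger0_norm c0).
  apply: ler_wpM2l => //; apply: (le_trans (ler_normB _ _)).
  have -> : 2 * k' = k' + k' by ring.
  have h_y : 0 <= y <= X by rewrite (le_trans (ltW x10) x1y) ltW.
  have h_x1 : 0 <= x1 <= X by rewrite (ltW x10) ltW // (le_lt_trans x1y yX).
  have h_s : t0 <= s <= tb by rewrite (ltW s0) /= (le_trans (ltW s1)) //; case/andP: t1b.
  apply: lerD; apply: hde => //.
  - by rewrite subrr normr0.
  - have h_t : s - (t0 + h) < 0 by rewrite subr_lt0.
    rewrite ltr0_norm // opprB; apply: lt_trans hde1.
    by rewrite ltrBlDr [h + s]addrC ltrD2r.
  - by rewrite subr0 gtr0_norm.
  - by rewrite subrr normr0.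
have [M M0 hM] : exists2 M : R, 0 <= M & forall y, 0 <= y <= X -> `|w y (t0 + h) - w y t0| <= M.
  by apply: continuous_at_bounded; [exact: ltW|move=> y _; apply: cvgB; exact: cwt].
have lipA a b : 0 <= a -> a <= b -> b <= X -> `|A b - A a| <= M * (b - a).
  move=> a0 ab bX; have <- : Int a b (fun y => w y (t0 + h) - w y t0) = A b - A a.
    apply: Rintegral_antiderivative => //; first by move=> y; apply: cvgB; exact: cwt.
    by move=> y /andP[ya _]; apply: dA; exact: le_trans ya.
  apply: norm_Rintegral_le => //.
    by apply: continuous_at_integrable => y _; apply: cvgB; exact: cwt.
  by move=> y /andP[ya yb]; apply: hM; rewrite (le_trans a0) // (le_trans yb).
apply/ler_addgt0Pr => e e0.
(* For fixed h the end pieces of length x1 contribute at most 2 M x1 <= e. M may depend on h,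
   because [de1] was fixed before and e is arbitrary. *)
pose x1 := Num.min (Num.min (de1 / 2) (X / 2)) (e / (2 * (M + 1))).
have M10 : 0 < 2 * (M + 1) by rewrite mulr_gt0 // ltr_wpDl.
have x10 : 0 < x1 by rewrite !lt_min !divr_gt0.
have : x1 <= x1 by [].
rewrite {2}/x1 !le_min => /andP[/andP[r1 r2] r3].
have eM : M * x1 + M * x1 <= e.
  move: r3; rewrite ler_pdivlMr // => r3; apply: le_trans r3.
  have -> : x1 * (2 * (M + 1)) = M * x1 + M * x1 + 2 * x1 by ring.
  by rewrite lerDl mulr_ge0 // ltW.
have x0X : 0 <= x <= X by rewrite x0.
have [x' [x'1 x'2 x'3]] := inner_point x10 r2 x0X.
have x1X : x1 <= X by apply: (le_trans r2); rewrite ltW // half_lt.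
have x1de : x1 < de1 by apply: (le_lt_trans r1); exact: half_lt.
have x'0 : 0 <= x' by exact: le_trans (ltW x10) x'1.
have x'X : x' < X by apply: (le_lt_trans x'2); rewrite gtrBl.
have hA : `|A x - A x'| <= M * x1.
  apply: (@le_trans _ _ (M * `|x - x'|)); last by apply: ler_wpM2l.
  have [xx|/ltW xx] := leP x' x.
    by rewrite [X in M * X]ger0_norm ?subr_ge0 //; exact: lipA.
  rewrite distrC [`|x - x'|]distrC [X in M * X]ger0_norm ?subr_ge0 //.
  by apply: lipA => //; exact: ltW.
have hA1 : `|A x1| <= M * x1.
  by have := @lipA 0 x1 (lexx _) (ltW x10) x1X; rewrite A0 !subr0.
have hF : `|flux v x' (t0 + h) - flux v x (t0 + h)| <= k'.
  apply: hde => //.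
  - by rewrite x'0 ltW.
  - by rewrite distrC; exact: le_lt_trans x'3 x1de.
  - by rewrite subrr normr0.
have -> : A x - h * (c * flux v x (t0 + h)) = (A x - A x') + A x1 +
   ((A x' - A x1 - h * (c * flux v x' (t0 + h))) +
    h * (c * (flux v x' (t0 + h) - flux v x (t0 + h)))) by ring.
apply: (@le_trans _ _ (M * x1 + M * x1 + (h * (c * (2 * k')) + h * (c * k')))).
  apply: (le_trans (ler_normD _ _)); apply: lerD.
    by apply: (le_trans (ler_normD _ _)); apply: lerD.
  apply: (le_trans (ler_normD _ _)); apply: lerD.
    by apply: core; [rewrite x10|rewrite x'1].
  by rewrite normrM (ger0_norm (ltW h0)) ler_pM2l // normrM (ger0_norm c0) ler_wpM2l.
rewrite addrC; apply: lerD => //.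
have -> : h * (c * (2 * k')) + h * (c * k') = 3 * (c * k') * h by ring.
by rewrite ler_pM2r.
Qed.

(** An implicit time step. Write w1 for the value at t0 + h, w0 for that at t0, and A for the
    primitive of w1 - w0. Convexity gives H(w1) - H(w0) <= eta(w1) (w1 - w0); integration by parts
    against A leaves a boundary term and minus the integral of zeta(w1) v A. By [mass_increment], A
    is h c times the flux at t0 + h up to o(h), so this integral is h c times an energy taken at a
    single time, which is nonnegative. *)
Lemma entropy_increment H eta zeta sg w v (t0 : R) : convex_entropy H eta zeta ->
  field sg w v -> free_boundary sg -> 0 < t0 < T ->
  forall k : R, 0 < k -> exists2 de : R, 0 < de & forall h : R, 0 < h < de ->
    t0 + h < T /\
    Int 0 (sg t0) (fun x => H (w x (t0 + h))) <= Int 0 (sg t0) (fun x => H (w x t0)) +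
      h * (eta (w (sg t0) t0) * (c * flux v (sg t0) t0) + k).
Proof.
move=> HH fw bsg t0in k k0; have [cw cv v0 dw _] := fw; have [sgb _ sgm] := bsg.
have /andP[t00 t0T] := t0in.
have [dH deta cz z0] := HH.
pose X := sg t0; have /andP[X0 XL] : 0 < X <= L by exact: sgb.
pose tb := (t0 + T) / 2.
have tbT : t0 < tb < T by rewrite /tb; blra.
have ceta : continuous eta by move=> y; exact: is_derive_continuous (deta y).
have cH : continuous H by move=> y; exact: is_derive_continuous (dH y).
have cwt s : continuous (w^~ s) by move=> y; exact: section_continuous_l.
have [E E0 hE] : exists2 M : R, 0 <= M & forall x t, 0 <= x <= X -> t0 <= t <= tb -> `|eta (w x t)| <= M.
  apply: (@joint_bounded (fun x t => eta (w x t))) => x t _ _.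
  by apply: (@continuous_comp _ _ _ (joint w) eta); [exact: cw|exact: ceta].
have [Z Z0 hZ] : exists2 M : R, 0 <= M & forall x t, 0 <= x <= X -> t0 <= t <= tb ->
    `|zeta (w x t) * v x t| <= M.
  apply: (@joint_bounded (fun x t => zeta (w x t) * v x t)) => x t _ /andP[h1 h2].
  apply: cvgM; first by apply: (@continuous_comp _ _ _ (joint w) zeta); [exact: cw|exact: cz].
  by apply: cv; case/andP: tbT => ? ?; blra.
(* The error in A is weighted by E in the boundary term and by Z over length X in the integral; D
   makes the total at most k h / 2. The other half pays for evaluating the boundary flux at t0
   instead of t0 + h. *)
pose D := E + Z * X + 1.
have D0 : 0 < D by rewrite /D; have := mulr_ge0 Z0 (ltW X0); lra.
have k10 : 0 < k / 2 / D by rewrite !divr_gt0.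
have [de1 de10 hde1] := mass_increment fw bsg t0in k10.
pose G t := eta (w X t) * (c * flux v X t).
have cG : {for t0, continuous G}.
  apply: cvgM.
    apply: (@continuous_comp _ _ _ (w X) eta); last exact: ceta.
    by apply: section_continuous_r; exact: cw.
  apply: cvgM; first exact: cvg_cst.
  by apply: section_continuous_r; exact: flux_continuous fw t0in.
have k20 : 0 < k / 2 by lra.
have /cvgrPdist_le /(_ _ k20) /nbhs_ballP[de2 /= de20 hde2] := cG.
exists (Num.min (Num.min de1 de2) (tb - t0)).
  by rewrite !lt_min de10 de20 subr_gt0 /=; case/andP: tbT.
move=> h /andP[h0]; rewrite !lt_min => /andP[/andP[hh1 hh2] hh3].
have hb1 : 0 < h < de1 by rewrite h0.
have cdw : continuous (fun x => w x (t0 + h) - w x t0) by move=> x; apply: cvgB; exact: cwt.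
have [A A0 dA] := antiderivative_exists cdw.
have [t1T /(_ A0 dA) hA] := hde1 h A hb1.
split => //; rewrite -/X in hA *.
have t1in : 0 < t0 + h < T by rewrite t1T addr_gt0.
have t1b : t0 <= t0 + h <= tb by rewrite lerDl ltW //= -lerBrDl ltW.
have cHw s : continuous (fun x => H (w x s)).
  by move=> x; apply: (@continuous_comp _ _ _ (w^~ s) H); [exact: cwt|exact: cH].
have cew s : continuous (fun x => eta (w x s)).
  by move=> x; apply: (@continuous_comp _ _ _ (w^~ s) eta); [exact: cwt|exact: ceta].
have czw s : continuous (fun x => zeta (w x s)).
  by move=> x; apply: (@continuous_comp _ _ _ (w^~ s) zeta); [exact: cwt|exact: cz].
have [_ cv1] := field_section fw t1in.
have XA x : 0 <= x -> {for x, continuous A} by move=> /dA; exact: is_derive_continuous.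
pose I1 x := eta (w x (t0 + h)) * (w x (t0 + h) - w x t0).
pose I2 x := zeta (w x (t0 + h)) * v x (t0 + h) * A x.
have cI1 : continuous I1 by move=> x; apply: cvgM; [exact: cew|exact: cdw].
have cI2 x : 0 <= x -> {for x, continuous I2}.
  by move=> x0; apply: cvgM; [apply: cvgM; [exact: czw|exact: cv1]|exact: XA].
have iI1 : leb.-integrable `[0, X] (EFin \o I1).
  by apply: continuous_at_integrable => x _; exact: cI1.
have iI2 : leb.-integrable `[0, X] (EFin \o I2).
  by apply: continuous_at_integrable => x /andP[x0 _]; exact: cI2.
have step1 : Int 0 X (fun x => H (w x (t0 + h))) - Int 0 X (fun x => H (w x t0)) <= Int 0 X I1.
  rewrite -RintegralB //; try by apply: continuous_at_integrable => x _; exact: cHw.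
  apply: le_Rintegral => //.
    by apply: continuous_at_integrable => x _; apply: cvgB; exact: cHw.
  move=> x _; have := convex_entropy_tangent HH (w x (t0 + h)) (w x t0).
  by rewrite /I1 -opprB mulrN lerNl opprB.
have step2 : Int 0 X I1 + Int 0 X I2 = eta (w X (t0 + h)) * A X.
  rewrite -RintegralD // -[RHS]subr0 -[X in _ - X](mulr0 (eta (w 0 (t0 + h)))) -[X in _ - _ * X]A0.
  apply: (@Rintegral_FTC2 _ (fun x => eta (w x (t0 + h)) * A x)); first exact: ltW.
  - by move=> x /andP[x0 _]; apply: cvgD; [exact: cI1|exact: cI2].
  - by move=> x /andP[x0 _]; apply: cvgM; [exact: cew|exact: XA].
  - move=> x /andP[x0 xX].
    have xs : 0 < x < sg (t0 + h).
      have t01 : t0 <= t0 + h by rewrite lerDl ltW.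
      rewrite x0 (lt_le_trans xX) //.
      by have /andP[] := sgm _ _ t00 t01 t1T; rewrite subr_ge0.
    have d1 : is_derive x 1 (fun x => eta (w x (t0 + h))) (zeta (w x (t0 + h)) * v x (t0 + h)).
      by have dwx := dw _ _ t1in xs; exact: is_derive1_comp.
    apply: is_derive_eq (is_derive_mul d1 (dA _ (ltW x0))) _.
    by rewrite /I1 /I2 addrC.
pose F x := c * flux v x (t0 + h).
(* The energy is that of the later time on the earlier interval [0, sg t0], which monotonicity of
   the front places inside the later domain. *)
have en : 0 <= energy zeta (w^~ (t0 + h)) (v^~ (t0 + h)) X (fun q => q `^ (- al)) L.
  apply: (energy_powRN_ge0 HH) => //; first exact: ltW.
  - by move=> x x0; exact: v0.
  - move=> x /andP[x0 xX]; apply: dw => //; rewrite x0 (lt_le_trans xX) //.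
    have t01 : t0 <= t0 + h by rewrite lerDl ltW.
    by have /andP[] := sgm _ _ t00 t01 t1T; rewrite subr_ge0.
have cF : continuous F.
  move=> x; apply: cvgM; first exact: cvg_cst.
  by apply: section_continuous_l; exact: flux_continuous fw t1in.
pose J x := zeta (w x (t0 + h)) * v x (t0 + h) * flux v x (t0 + h).
have step3 : - (Z * (k / 2 / D * h) * X) <= Int 0 X I2.
  have iJ : leb.-integrable `[0, X] (EFin \o J).
    apply: continuous_at_integrable => x _; apply: cvgM; last first.
      by apply: section_continuous_l; exact: flux_continuous fw t1in.
    by apply: cvgM; [exact: czw|exact: cv1].
  have ihJ : leb.-integrable `[0, X] (EFin \o (fun x => h * c * J x)).
    by under [X in integrable _ _ X]funext => q do rewrite /= EFinM; exact: integrableZl.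
  have ZhX : `|Int 0 X I2 - h * c * Int 0 X J| <= Z * (k / 2 / D * h) * (X - 0).
    rewrite -RintegralZl // -RintegralB //; apply: norm_Rintegral_le => //; first exact: ltW.
      by under [X in integrable _ _ X]funext => q do rewrite /= EFinB; exact: integrableB.
    move=> x hx; rewrite /I2 /J.
    have -> : zeta (w x (t0 + h)) * v x (t0 + h) * A x -
       h * c * (zeta (w x (t0 + h)) * v x (t0 + h) * flux v x (t0 + h)) =
       zeta (w x (t0 + h)) * v x (t0 + h) * (A x - h * (c * flux v x (t0 + h))) by ring.
    by rewrite normrM; apply: ler_pM => //; [exact: hZ|exact: hA].
  have hJ : 0 <= h * c * Int 0 X J by rewrite mulr_ge0 // mulr_ge0 // ltW.
  by move: ZhX hJ; rewrite subr0 ler_norml => /andP[+ _]; clear; lra.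
have XX : 0 <= X <= X by rewrite lexx ltW.
have step4 : eta (w X (t0 + h)) * A X <= h * G (t0 + h) + E * (k / 2 / D * h).
  have -> : eta (w X (t0 + h)) * A X = h * G (t0 + h) +
      eta (w X (t0 + h)) * (A X - h * (c * flux v X (t0 + h))) by rewrite /G; ring.
  rewrite lerD2l; apply: (le_trans (ler_norm _)); rewrite normrM.
  by apply: ler_pM => //; [exact: hE|exact: hA].
have step5 : G (t0 + h) <= G t0 + k / 2.
  have : `|G t0 - G (t0 + h)| <= k / 2.
    by apply: hde2; rewrite /ball /= opprD addrA subrr sub0r normrN gtr0_norm.
  by rewrite ler_distlC => /andP[_]; clear; lra.
have step6 : E * (k / 2 / D * h) + Z * (k / 2 / D * h) * X <= k / 2 * h.
  have -> : E * (k / 2 / D * h) + Z * (k / 2 / D * h) * X = (E + Z * X) * (k / 2 / D) * h by ring.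
  rewrite ler_pM2r // mulrA ler_pdivrMr // mulrC ler_pM2l //.
  by rewrite /D lerDl ler01.
have step7 := ler_wpM2l (ltW h0) step5.
rewrite -/(G t0).
have -> : h * (G t0 + k) = h * (G t0 + k / 2) + k / 2 * h by field.
move: step1 step2 step3 step4 step6 step7; clear; lra.
Qed.

End Field.

(** * Smoothed positive parts *)

Section PositivePart.
Variable R : realType.
Set Implicit Arguments. Unset Strict Implicit.
Implicit Types (f g H eta zeta : R -> R) (x y z e : R).

Lemma is_derive_maxr0 g (dg : R -> R) : g 0 = 0 -> dg 0 = 0 ->
  (forall y, 0 <= y -> is_derive y 1 g (dg y)) ->
  forall z, is_derive z 1 (fun z => g (Num.max z 0)) (dg (Num.max z 0)).
Proof.
move=> g0 dg0 hg z; have [z0|z0|z0] := ltgtP z 0.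
- rewrite dg0; have d := is_derive_cst (0 : R) z (1 : R).
  refine (near_eq_is_derive _ d).
  near=> y; rewrite /cst max_r ?g0 // ltW //.
  by near: y; exact: lt_nbhsl.
- have d := hg z (ltW z0).
  refine (near_eq_is_derive _ d).
  near=> y; rewrite max_l // ltW //.
  by near: y; exact: lt_nbhsr.
- rewrite z0 dg0; have h0 := hg 0 (lexx _).
  (* At the junction the difference quotient is that of g for h > 0 and zero for h < 0; both tend to
     dg 0 = 0. *)
  have H : (fun h : R => (h^-1 * (g (Num.max (h * 1 + 0) 0) - g (Num.max 0 0)) : R)) @ 0^' --> (0 : R).
    have := @ex_derive _ _ _ _ _ _ _ h0; rewrite /derivable => /cvg_ex[l hl].
    have lE : l = 0.
      by rewrite -dg0 -(@derive_val _ _ _ _ _ _ _ h0) /derive; apply/esym/cvg_lim.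
    rewrite lE in hl; move/cvgrPdist_le : hl => hl; apply/cvgrPdist_le => e e0.
    near=> h; have : `|0 - h^-1 *: ((g \o shift 0) (h *: 1) - g 0)| <= e.
      by near: h; exact: hl.
    rewrite /= !addr0 !scaler1 maxxx.
    have [h1|h1] := leP h 0; last by [].
    by move=> _; rewrite subrr mulr0 subr0 normr0 ltW.
  split; first by apply/cvg_ex; exists 0; exact: H.
  by rewrite /derive; apply/cvg_lim => //; exact: H.
Unshelve. all: by end_near. Qed.

(* Composed with y |-> y^+, pospart e is a convex C^2 function within 2 e of y^+: the cubic
   factor makes its second derivative vanish at 0. *)
Definition pospart e y : R := y ^+ 3 * (y + e) ^- 2.
Definition dpospart e y : R := (y ^+ 3 + 3 * e * y ^+ 2) * (y + e) ^- 3.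
Definition ddpospart e y : R := 6 * e ^+ 2 * y * (y + e) ^- 4.

Lemma is_derive_inv_pow e n y : 0 < y + e ->
  is_derive y 1 (fun y => (y + e) ^- n) (- (n%:R * (y + e) ^- n.+1)).
Proof.
move=> ye; have ye0 : y + e != 0 by rewrite gt_eqF.
have d1 : is_derive y 1 (fun y => y + e) 1.
  by have := is_derive_add (is_derive_id y (1 : R)) (is_derive_cst e y 1); rewrite addr0.
have d2 := is_derive_pow n d1.
have nz : (y + e) ^+ n != 0 by rewrite expf_neq0.
have d3 := @is_deriveV R (fun y => (y + e) ^+ n) y _ 1 nz d2.
 apply: is_derive_eq d3 _.
rewrite /GRing.scale /=; case: n d2 nz => [|n] _ nz; first by rewrite !mul0r mulr0 oppr0.
have an : (y + e) ^+ n != 0 by rewrite expf_neq0.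
by rewrite /= !exprS; field; rewrite ye0 an.
Qed.

Lemma is_derive_pospart e y : 0 < e -> 0 <= y -> is_derive y 1 (pospart e) (dpospart e y).
Proof.
move=> e0 y0; have ye : 0 < y + e by exact: ltr_wpDl.
apply: is_derive_eq (is_derive_mul (is_derive_pow 3 (is_derive_id y (1 : R))) (is_derive_inv_pow 2 ye)) _.
by rewrite /dpospart /=; field; rewrite gt_eqF.
Qed.

Lemma is_derive_dpospart e y : 0 < e -> 0 <= y -> is_derive y 1 (dpospart e) (ddpospart e y).
Proof.
move=> e0 y0; have ye : 0 < y + e by exact: ltr_wpDl.
have d1 := is_derive_add (is_derive_pow 3 (is_derive_id y (1 : R)))
  (is_derive_scale (3 * e) (is_derive_pow 2 (is_derive_id y (1 : R)))).
apply: is_derive_eq (is_derive_mul d1 (is_derive_inv_pow 3 ye)) _.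
by rewrite /ddpospart /=; field; rewrite gt_eqF.
Qed.

Lemma pospart_entropy e : 0 < e ->
  convex_entropy (fun z => pospart e (Num.max z 0)) (fun z => dpospart e (Num.max z 0))
    (fun z => ddpospart e (Num.max z 0)).
Proof.
move=> e0; split.
- apply: is_derive_maxr0; rewrite /pospart /dpospart.
  + by rewrite expr0n mul0r.
  + by rewrite !expr0n /= mulr0 addr0 mul0r.
  + by move=> y y0; exact: is_derive_pospart.
- apply: is_derive_maxr0; rewrite /dpospart /ddpospart.
  + by rewrite !expr0n /= mulr0 addr0 mul0r.
  + by rewrite mulr0 mul0r.
  + by move=> y y0; exact: is_derive_dpospart.
- move=> z; rewrite /ddpospart.
  have cm : {for z, continuous (fun z : R => Num.max z 0)}.
    by apply: continuous_max; [exact: cvg_id|exact: cvg_cst].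
  have m0 : 0 < Num.max z 0 + e by rewrite ltr_wpDl // le_max lexx orbT.
  apply: cvgM; first by apply: cvgM; [exact: cvg_cst|exact: cm].
  apply: (@continuous_comp _ _ _ (fun z : R => Num.max z 0) (fun y => (y + e) ^- 4)); first exact: cm.
  exact: is_derive_continuous (is_derive_inv_pow 4 m0).
- move=> z; rewrite /ddpospart.
  have m0 : 0 <= Num.max z 0 by rewrite le_max lexx orbT.
  rewrite mulr_ge0 ?invr_ge0 ?exprn_ge0 ?addr_ge0 ?(ltW e0) //.
  by rewrite !mulr_ge0 ?exprn_ge0 ?(ltW e0).
Qed.

Lemma pospart_bound e y : 0 < e -> 0 <= y -> y - 2 * e <= pospart e y <= y.
Proof.
move=> e0 y0; have ye : 0 < y + e by exact: ltr_wpDl.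
have ye2 : 0 < (y + e) ^+ 2 by rewrite exprn_gt0.
rewrite /pospart ler_pdivlMr // ler_pdivrMr //; apply/andP; split.
  rewrite -subr_ge0.
  have -> : y ^+ 3 - (y - 2 * e) * (y + e) ^+ 2 = 3 * e ^+ 2 * y + 2 * e ^+ 3 by ring.
  by rewrite addr_ge0 // !mulr_ge0 ?exprn_ge0 ?(ltW e0).
rewrite -subr_ge0.
have -> : y * (y + e) ^+ 2 - y ^+ 3 = 2 * e * y ^+ 2 + y * e ^+ 2 by ring.
by rewrite addr_ge0 // !mulr_ge0 ?exprn_ge0 ?(ltW e0).
Qed.

Lemma pospart_ge0 e y : 0 < e -> 0 <= y -> 0 <= pospart e y.
Proof. by move=> e0 y0; rewrite mulr_ge0 ?invr_ge0 ?exprn_ge0 ?addr_ge0 ?(ltW e0). Qed.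

Lemma dpospart_bound e y : 0 < e -> 0 <= y -> 0 <= dpospart e y <= 1.
Proof.
move=> e0 y0; have ye : 0 < y + e by exact: ltr_wpDl.
have ye3 : 0 < (y + e) ^+ 3 by rewrite exprn_gt0.
apply/andP; split.
  rewrite mulr_ge0 ?invr_ge0 ?(ltW ye3) //.
  by rewrite addr_ge0 ?exprn_ge0 // !mulr_ge0 ?exprn_ge0 ?(ltW e0).
rewrite /dpospart ler_pdivrMr // mul1r -subr_ge0.
have -> : (y + e) ^+ 3 - (y ^+ 3 + 3 * e * y ^+ 2) = 3 * e ^+ 2 * y + e ^+ 3 by ring.
by rewrite addr_ge0 // !mulr_ge0 ?exprn_ge0 ?(ltW e0).
Qed.

Lemma is_derive_increment f x (d : R) : is_derive x 1 f d ->
  forall k : R, 0 < k -> exists2 de : R, 0 < de & forall h : R, 0 < h < de ->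
    `|f (x + h) - f x - h * d| <= k * h.
Proof.
move=> df k k0; have := @ex_derive _ _ _ _ _ _ _ df.
rewrite /derivable => /cvg_ex[l hl].
have lE : l = d.
  by rewrite -(@derive_val _ _ _ _ _ _ _ df) /derive; apply/esym/cvg_lim.
rewrite lE in hl; move/cvgrPdist_le : hl => /(_ k k0) [de /= de0 hde].
exists de => // h /andP[h0 hd].
have := hde h; rewrite /= sub0r normrN (gtr0_norm h0) => /(_ hd).
rewrite gt_eqF // => /(_ isT).
rewrite /GRing.scale /= mulr1 [h + x]addrC => H.
have -> : f (x + h) - f x - h * d = - (h * (d - h^-1 * (f (x + h) - f x))).
  by field; rewrite gt_eqF.
by rewrite normrN normrM (gtr0_norm h0) mulrC ler_pM2r.
Qed.

End PositivePart.

(** * Growth of the positive mass *)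

Section Growth.
Variable R : realType.
Set Implicit Arguments. Unset Strict Implicit.
Implicit Types (f g H eta zeta sg : R -> R) (w v z : R -> R -> R) (a b x y t X : R).
Local Notation leb := (@lebesgue_measure R).
Local Notation Int a b f := (Rintegral leb `[a, b] f).
Local Notation joint v := (fun p : R * R => v p.1 p.2).
Variables (T al c L Lam : R).
Hypotheses (al01 : 0 < al < 1) (c0 : 0 <= c) (L0 : 0 < L) (Lam0 : 0 <= Lam).
Local Notation flux := (flux al L).
Local Notation field := (field T al c L).
Local Notation free_boundary := (free_boundary T L Lam).

(** To the increment on the fixed interval is added the strip swept by the front, of width at most
    Lam h, where H(w) is close to its value at the front. Nonnegativity of that value lets the width
    be replaced by Lam h. *)
Lemma moving_entropy_increment H eta zeta sg w v t : convex_entropy H eta zeta ->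
  field sg w v -> free_boundary sg -> 0 < t < T -> 0 <= H (w (sg t) t) ->
  forall k : R, 0 < k -> exists2 de : R, 0 < de & forall h : R, 0 < h < de ->
    t + h < T /\
    Int 0 (sg (t + h)) (fun x => H (w x (t + h))) <= Int 0 (sg t) (fun x => H (w x t)) +
      h * (eta (w (sg t) t) * (c * flux v (sg t) t) + Lam * H (w (sg t) t) + k).
Proof.
move=> HH fw bsg tin H0 k k0; have [cw _ _ _ _] := fw; have [sgb csg sgm] := bsg.
have /andP[t0 tT] := tin.
have [dH _ _ _] := HH.
have cH : continuous H by move=> y; exact: is_derive_continuous (dH y).
have k20 : 0 < k / 2 by rewrite divr_gt0.
have [de1 de10 hde1] := entropy_increment al01 c0 L0 HH fw bsg tin k20.
have Lam1 : 0 < Lam + 1 by rewrite ltr_wpDl.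
have k30 : 0 < k / 2 / (Lam + 1) by rewrite divr_gt0.
have cHw : {for (sg t, t), continuous (fun p : R * R => H (w p.1 p.2))}.
  by apply: (@continuous_comp _ _ _ (joint w) H); [exact: cw|exact: cH].
move/cvgrPdist_le : cHw => /(_ _ k30) /nbhs_ballP[r /= r0 hr].
have /cvgrPdist_lt /(_ _ r0) /nbhs_ballP[de2 /= de20 hde2] := csg t.
exists (Num.min de1 (Num.min de2 r)); first by rewrite !lt_min de10 de20.
move=> h /andP[h0]; rewrite !lt_min => /and3P[hd1 hd2 hd3].
have [t1T ent] := hde1 h (ltac:(by rewrite h0 hd1)).
split => //.
have tt : t <= t + h by rewrite lerDl ltW.
have /andP[m1 m2] := sgm _ _ t0 tt t1T; rewrite subr_ge0 in m1.
have /andP[sgt0 _] := sgb t.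
have cs : continuous (fun x => H (w x (t + h))).
  move=> x; apply: (@continuous_comp _ _ _ (w^~ (t + h)) H); last exact: cH.
  by apply: section_continuous_l; exact: cw.
have [B B0 dB] := antiderivative_exists cs.
have IB y : 0 <= y -> Int 0 y (fun x => H (w x (t + h))) = B y.
  move=> y0; rewrite -[RHS]subr0 -[X in _ - X]B0; apply: Rintegral_antiderivative => //.
  by move=> x /andP[x0 _]; exact: dB.
have rest : B (sg (t + h)) - B (sg t) <= (H (w (sg t) t) + k / 2 / (Lam + 1)) * (sg (t + h) - sg t).
  have <- : Int (sg t) (sg (t + h)) (fun x => H (w x (t + h))) = B (sg (t + h)) - B (sg t).
    apply: Rintegral_antiderivative => //.
    by move=> x /andP[x0 _]; apply: dB; exact: le_trans (ltW sgt0) x0.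
  have icst : leb.-integrable `[sg t, sg (t + h)]
     (EFin \o (fun=> H (w (sg t) t) + k / 2 / (Lam + 1))).
    by apply: continuous_at_integrable => x _; exact: cst_continuous.
  have <- : Int (sg t) (sg (t + h)) (fun=> H (w (sg t) t) + k / 2 / (Lam + 1)) =
      (H (w (sg t) t) + k / 2 / (Lam + 1)) * (sg (t + h) - sg t).
    rewrite mulrBr; apply: (@Rintegral_antiderivative _ _ (fun x => (H (w (sg t) t) + k / 2 / (Lam + 1)) * x)) => //.
    - by move=> x; exact: cst_continuous.
    - move=> x _; have := is_derive_scale (H (w (sg t) t) + k / 2 / (Lam + 1)) (is_derive_id x (1 : R)).
      by rewrite mulr1.
  apply: le_Rintegral => //.
    by apply: continuous_at_integrable => x _; exact: cs.
  move=> x; rewrite /= in_itv /= => /andP[x1 x2].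
  have bx : ball (sg t, t) r (x, t + h).
    split; rewrite /ball /=.
      rewrite distrC ger0_norm ?subr_ge0 //; apply: (@le_lt_trans _ _ (sg (t + h) - sg t)).
        by rewrite lerD2r.
      have := hde2 (t + h); rewrite /ball /= opprD addrA subrr sub0r normrN (gtr0_norm h0) => /(_ hd2).
      by rewrite distrC ger0_norm ?subr_ge0.
    by rewrite opprD addrA subrr sub0r normrN gtr0_norm.
  have := hr _ bx; rewrite /= ler_distlC => /andP[_]; rewrite addrC.
  by rewrite addrC.
have k3L : k / 2 / (Lam + 1) * (Lam * h) <= k / 2 * h.
  by rewrite mulrA ler_pM2r // mulrAC ler_pdivrMr // ler_pM2l // lerDl ler01.
have HL : (H (w (sg t) t) + k / 2 / (Lam + 1)) * (sg (t + h) - sg t) <=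
    (H (w (sg t) t) + k / 2 / (Lam + 1)) * (Lam * h).
  apply: ler_wpM2l; first by rewrite addr_ge0 // ltW.
  by apply: le_trans m2 _; rewrite addrAC subrr add0r.
rewrite (IB _ (ltW sgt0)) in ent; rewrite (IB _ (le_trans (ltW sgt0) m1)).
move: ent rest k3L HL.
move: (Int _ _ _) (B _) (B _) (H _) (eta _) (flux _ _ _) (k / 2 / (Lam + 1)) (sg (t + h) - sg t).
move=> I0 b1 b0 hh ee fl kk dd ent rest k3L HL.
have -> : I0 + h * (ee * (c * fl) + Lam * hh + k) =
  (I0 + h * (ee * (c * fl) + k / 2)) + (hh * (Lam * h) + k / 2 * h) by field.
rewrite mulrDl in HL.
move: ent rest k3L HL; rewrite mulrDl; clear; lra.
Qed.

(** Where w <= 0 at the front, the smoothed positive part and its derivative vanish there, so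
    nothing enters. Otherwise 0 <= eta <= 1 and H(w) <= |w| bound the rate by rho, uniformly in the
    smoothing. *)
Lemma positive_mass_bound sg w v a b (rho : R) : field sg w v -> free_boundary sg ->
  0 < a -> a <= b -> b < T -> 0 <= rho ->
  (forall t, a <= t < b -> w (sg t) t <= 0 \/
     `|c * flux v (sg t) t| + Lam * `|w (sg t) t| <= rho) ->
  Int 0 (sg b) (fun x => Num.max (w x b) 0) <=
  Int 0 (sg a) (fun x => Num.max (w x a) 0) + rho * (b - a).
Proof.
move=> fw bsg a0 ab bT rho0 hw; have [cw _ _ _ _] := fw; have [sgb csg sgm] := bsg.
have sgpos t : 0 <= sg t by have /andP[/ltW] := sgb t.
have cm t : continuous (fun x => Num.max (w x t) 0).
  move=> x; apply: continuous_max; last exact: cvg_cst.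
  by apply: section_continuous_l; exact: cw.
apply/ler_addgt0Pr => e0 e00.
(* The smoothing error is at most 2 e pointwise, hence e0 after integration over a length at most
   L. *)
pose e : R := e0 / (2 * L).
have e_gt0 : 0 < e by rewrite divr_gt0 // mulr_gt0.
have HH := pospart_entropy e_gt0.
have [dH _ _ _] := HH.
pose He (z : R) := pospart e (Num.max z 0).
have cHe : continuous He by move=> z; exact: is_derive_continuous (dH z).
have cHw x s : {for (x, s), continuous (joint (fun x t => He (w x t)))}.
  by apply: (@continuous_comp _ _ _ (joint w) He); [exact: cw|exact: cHe].
have cHs s : continuous (fun x => He (w x s)).
  by move=> x; exact: (@section_continuous_l _ (fun x t => He (w x t)) x s (cHw x s)).
have mx (z : R) : 0 <= Num.max z 0 by rewrite le_max lexx orbT.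
pose P t := Int 0 (sg t) (fun x => He (w x t)) - rho * t.
have PP : P b <= P a.
  apply: Dini_nonincreasing => //.
    move=> t _; apply: cvgB; first by apply: moving_Rintegral_continuous => //; exact: csg.
    by apply: cvgM; [exact: cvg_cst|exact: cvg_id].
  move=> t tab k k0; have /andP[at_ tb] := tab.
  have tin : 0 < t < T by rewrite (lt_le_trans a0 at_) (lt_trans tb).
  have [de de0 hde] := moving_entropy_increment HH fw bsg tin (pospart_ge0 e_gt0 (mx _)) k0.
  exists de => // h hh; have [_] := hde h hh; have /andP[h0 _] := hh.
  have key : dpospart e (Num.max (w (sg t) t) 0) * (c * flux v (sg t) t) +
      Lam * pospart e (Num.max (w (sg t) t) 0) <= rho.
    have [wn|wr] := hw t tab.
      rewrite max_r // /dpospart /pospart !expr0n /= mulr0 addr0 !mul0r mulr0 addr0 //.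
    apply: le_trans wr; apply: lerD.
      have /andP[d0 d1] := dpospart_bound e_gt0 (mx (w (sg t) t)).
      apply: (le_trans (ler_norm _)); rewrite normrM (ger0_norm d0).
      by rewrite -[leRHS]mul1r ler_wpM2r.
    apply: ler_wpM2l => //.
    have /andP[_ p1] := pospart_bound e_gt0 (mx (w (sg t) t)).
    apply: (le_trans p1); rewrite ge_max normr_ge0 andbT; exact: ler_norm.
  rewrite /P /He => hI.
  have := ler_wpM2l (ltW h0) key.
  move: hI; move: (Int _ _ _) (Int _ _ _) (dpospart _ _) (pospart _ _) (flux _ _ _).
  move=> I1 I0 dp p fl; clear; lra.
have low : Int 0 (sg b) (fun x => Num.max (w x b) 0) <= Int 0 (sg b) (fun x => He (w x b)) + e0.
  rewrite -lerBlDl -RintegralB //; try by apply: continuous_at_integrable => x _; [exact: cm|exact: cHs].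
    apply: (le_trans (ler_norm _)); apply: (le_trans (@norm_Rintegral_le _ _ _ _ (2 * e) _ _ _)) => //.
    - by apply: continuous_at_integrable => x _; apply: cvgB; [exact: cm|exact: cHs].
    - move=> x _; have /andP[p1 p2] := pospart_bound e_gt0 (mx (w x b)).
      by rewrite ger0_norm ?subr_ge0 // /He lerBlDr -lerBlDl.
    - have /andP[_ sL] := sgb b.
      rewrite subr0; apply: (@le_trans _ _ (2 * e * L)).
        by apply: ler_wpM2l => //; rewrite mulr_ge0 // ltW.
      by rewrite /e le_eqVlt; apply/orP; left; apply/eqP; field; rewrite gt_eqF.
  - by apply: continuous_at_integrable => x _; exact: cm.
  - by apply: continuous_at_integrable => x _; exact: cHs.
have up : Int 0 (sg a) (fun x => He (w x a)) <= Int 0 (sg a) (fun x => Num.max (w x a) 0).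
  apply: le_Rintegral => //.
  - by apply: continuous_at_integrable => x _; exact: cHs.
  - by apply: continuous_at_integrable => x _; exact: cm.
  - by move=> x _; have /andP[] := pospart_bound e_gt0 (mx (w x a)).
move: PP low up; rewrite /P.
move: (Int _ _ _) (Int _ _ _) (Int _ _ _) (Int _ _ _) => I1 I2 I3 I4; clear; lra.
Qed.

Lemma entropy_id : convex_entropy (fun z : R => z) (fun=> 1) (fun=> 0).
Proof.
split => //.
- by move=> z; exact: is_derive_id.
- by move=> z; exact: is_derive_cst.
- by move=> z; exact: cst_continuous.
Qed.

Lemma entropy_opp : convex_entropy (fun z : R => - z) (fun=> -1) (fun=> 0).
Proof.
split => //.
- by move=> z; exact: is_deriveN.
- by move=> z; exact: is_derive_cst.
- by move=> z; exact: cst_continuous.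
Qed.

(** z and - z are both convex entropies, so the entropy inequality holds in both directions. The
    boundary flux cancels against the speed of the front, and the swept strip costs nothing to first
    order because w vanishes at the front. *)
Lemma mass_conservation sg w v a b : field sg w v -> free_boundary sg ->
  (forall t, 0 < t < T -> w (sg t) t = 0) ->
  (forall t, 0 < t < T -> is_derive t 1 sg (- (c * flux v (sg t) t))) ->
  0 < a -> a <= b -> b < T ->
  sg b + Int 0 (sg b) (w^~ b) = sg a + Int 0 (sg a) (w^~ a).
Proof.
move=> fw bsg w0 dsg a0 ab bT; have [cw _ _ _ _] := fw; have [sgb csg sgm] := bsg.
have sgpos t : 0 <= sg t by have /andP[/ltW] := sgb t.
have cM t : {for t, continuous (fun t => sg t + Int 0 (sg t) (w^~ t))}.
  by apply: cvgD; [exact: csg|apply: moving_Rintegral_continuous => //; exact: csg].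
have tin t : a <= t < b -> 0 < t < T.
  by move=> /andP[h1 h2]; rewrite (lt_le_trans a0 h1) (lt_trans h2).
apply/eqP; rewrite eq_le; apply/andP; split.
  apply: (@Dini_nonincreasing _ (fun t => sg t + Int 0 (sg t) (w^~ t))) => //.
  move=> t /tin ht k k0; have k20 : 0 < k / 2 by rewrite divr_gt0.
  have wp : 0 <= w (sg t) t by rewrite w0.
  have [de1 de10 h1] := moving_entropy_increment entropy_id fw bsg ht wp k20.
  have [de2 de20 h2] := is_derive_increment (dsg t ht) k20.
  exists (Num.min de1 de2); first by rewrite lt_min de10.
  move=> h /andP[h0]; rewrite lt_min => /andP[hd1 hd2].
  have [|_] := h1 h; first by rewrite h0.
  have := h2 h; rewrite h0 hd2 => /(_ isT); rewrite ler_norml => /andP[_].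
  rewrite w0 // mulr0 addr0 mul1r.
  by rewrite mulrDr mulrN; clear; lra.
rewrite -lerN2.
apply: (@Dini_nonincreasing _ (fun t => - (sg t + Int 0 (sg t) (w^~ t)))) => //.
  by move=> t _; apply: cvgN; exact: cM.
move=> t /tin ht k k0; have k20 : 0 < k / 2 by rewrite divr_gt0.
have wp : 0 <= - w (sg t) t by rewrite w0 // oppr0.
have [de1 de10 h1] := moving_entropy_increment entropy_opp fw bsg ht wp k20.
have [de2 de20 h2] := is_derive_increment (dsg t ht) k20.
exists (Num.min de1 de2); first by rewrite lt_min de10.
move=> h /andP[h0]; rewrite lt_min => /andP[hd1 hd2].
have [|_] := h1 h; first by rewrite h0.
have := h2 h; rewrite h0 hd2 => /(_ isT); rewrite ler_norml => /andP[+ _].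
have NI s : Int 0 (sg s) (fun x => - w x s) = - Int 0 (sg s) (w^~ s).
  rewrite -[RHS]mulN1r -RintegralZl //; last first.
    apply: continuous_at_integrable => x _; apply: section_continuous_l; exact: cw.
  by apply: eq_Rintegral => x _; rewrite mulN1r.
rewrite !NI w0 // oppr0 mulr0 addr0 mulN1r.
by rewrite mulrDr !mulrN; clear; lra.
Qed.

Lemma continuous_le_right f b : {for 0, continuous f} -> 0 < b ->
  (forall a, 0 < a -> a <= b -> f b <= f a) -> f b <= f 0.
Proof.
move=> cf b0 hf; apply/ler_addgt0Pr => e e0.
have /cvgrPdist_le /(_ _ e0) /nbhs_ballP[r /= r0 hr] := cf.
pose a := Num.min (r / 2) b.
have a0 : 0 < a by rewrite lt_min divr_gt0.
have ab : a <= b by rewrite ge_min lexx orbT.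
have ar : a < r by rewrite gt_min half_lt.
have := hr a; rewrite /ball /= sub0r normrN (gtr0_norm a0) => /(_ ar).
rewrite ler_distlC => /andP[_]; apply: le_trans; exact: hf.
Qed.

(** The primitive is nondecreasing with equal end values, hence constant, and f is its
    derivative. *)
Lemma Rintegral_eq0_continuous f X : continuous f -> (forall x, 0 <= f x) ->
  Int 0 X f <= 0 -> forall x, 0 < x < X -> f x = 0.
Proof.
move=> cf f0 I0 x /andP[x0 xX].
have [B B0 dB] := antiderivative_exists cf.
have IB a b : 0 <= a -> a <= b -> Int a b f = B b - B a.
  move=> a0 ab; apply: Rintegral_antiderivative => //.
  by move=> y /andP[ya _]; apply: dB; exact: le_trans ya.
have pos a b : 0 <= Int a b f by apply: Rintegral_ge0.
have Bz y : 0 <= y <= X -> B y = 0.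
  move=> /andP[y0 yX]; have X0 := le_trans y0 yX.
  have := pos 0 y; have := pos y X; rewrite !IB // B0.
  by move: I0; rewrite IB // B0; move=> *; apply/eqP; rewrite eq_le; apply/andP; split; lra.
have d0 : is_derive x 1 B 0.
  have d := is_derive_cst (0 : R) x (1 : R).
  refine (near_eq_is_derive _ d).
  near=> y; rewrite /cst Bz //; apply/andP; split; apply/ltW.
    by near: y; exact: lt_nbhsr.
  by near: y; exact: lt_nbhsl.
by rewrite -(@derive_val _ _ _ _ _ _ _ d0) (@derive_val _ _ _ _ _ _ _ (dB x (ltW x0))).
Unshelve. all: by end_near. Qed.

(** A weak maximum principle: the mass of the negative part starts at 0 and, as w vanishes at the
    front, [positive_mass_bound] with rho = 0 keeps it there. *)
Lemma field_nonneg sg w v : field sg w v -> free_boundary sg ->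
  (forall t, 0 < t < T -> w (sg t) t = 0) ->
  (forall x, 0 < x < sg 0 -> 0 <= w x 0) ->
  forall x t, 0 < t < T -> 0 < x < sg t -> 0 <= w x t.
Proof.
move=> fw bsg w0 wi x t tin xin; have [cw _ _ _ _] := fw; have [sgb csg sgm] := bsg.
have sgpos s : 0 <= sg s by have /andP[/ltW] := sgb s.
have fN := field_sub al01 L0 (field0 T al c L sg) fw.
have mm : (fun t => Num.min (sg t) (sg t)) = sg by apply/funext => s; rewrite minxx.
rewrite mm in fN.
have cwN y s : {for (y, s), continuous (joint (fun x t => Num.max (0 - w x t) 0))}.
  apply: continuous_max; last exact: cvg_cst.
  by apply: cvgB; [exact: cvg_cst|exact: cw].
have cwNs s : continuous (fun x => Num.max (0 - w x s) 0).
  by move=> y; exact: (@section_continuous_l _ (fun x t => Num.max (0 - w x t) 0) y s (cwN y s)).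
pose P s := Int 0 (sg s) (fun x => Num.max (0 - w x s) 0).
have cP : {for 0, continuous P} by apply: moving_Rintegral_continuous => //; exact: csg.
have /andP[t0 tT] := tin.
have P0 : P 0 = 0.
  rewrite /P -(@Rintegral_oc_cc _ 0 (sg 0)); last first.
    by apply: continuous_at_integrable => y _; exact: cwNs.
  have : Rintegral leb `]0, sg 0[ (fun x => Num.max (0 - w x 0) 0) = 0.
    rewrite (@eq_Rintegral _ _ _ _ _ (fun=> 0)); first by rewrite /Rintegral integral0.
    by move=> y; rewrite inE /= in_itv /= => /wi h; rewrite sub0r max_r // oppr_le0.
  move=> I0; rewrite -[RHS]I0; apply/esym; apply: Rintegral_itv_bndo_bndc.
  apply: (@integrableS _ _ _ leb `[0, sg 0]%classic) => //; first exact: subset_itv_oo_cc.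
  by apply: continuous_at_integrable => y _; exact: cwNs.
have : P t <= P 0.
  apply: continuous_le_right => // a a0 at_; rewrite -[P a]addr0 -(mul0r (t - a)).
  apply: (positive_mass_bound fN) => //.
  move=> s /andP[as_ st]; left; rewrite w0 ?subrr //.
  by rewrite (lt_le_trans a0 as_) (lt_trans st).
rewrite P0 => Pt.
have := @Rintegral_eq0_continuous (fun x => Num.max (0 - w x t) 0) (sg t) _ _ Pt x xin.
move=> H.
have {}H : Num.max (0 - w x t) 0 = 0.
  apply: H; last by move=> y; rewrite le_max lexx orbT.
  by move=> y; exact: cwNs.
have : 0 - w x t <= Num.max (0 - w x t) 0 by rewrite le_max lexx.
by rewrite H sub0r oppr_le0.
Qed.

End Growth.

(** * Comparison of extended solutions *)

Section Comparison.
Variable R : realType.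
Set Implicit Arguments. Unset Strict Implicit.
Implicit Types (f g H eta zeta sg : R -> R) (w v z : R -> R -> R) (a b x y t X : R).
Local Notation leb := (@lebesgue_measure R).
Local Notation Int a b f := (Rintegral leb `[a, b] f).
Local Notation joint v := (fun p : R * R => v p.1 p.2).
Variables (T al c L Lam : R).
Hypotheses (al01 : 0 < al < 1) (c0 : 0 <= c) (L0 : 0 < L) (Lam0 : 0 <= Lam).
Local Notation flux := (flux al L).
Local Notation field := (field T al c L).
Local Notation free_boundary := (free_boundary T L Lam).

(* u is extended by zero beyond the front; u and s are defined at all times, but the
   equations are required for 0 < t < T only. *)
Definition stefan_solution s (u v : R -> R -> R) : Prop :=
  [/\ field s u v, free_boundary s,
      forall x t, s t <= x -> u x t = 0,
      forall x, 0 < x < s 0 -> 0 <= u x 0 &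
      forall t, 0 < t < T -> is_derive t 1 s (- (c * flux v (s t) t))].

Definition excess s1 s2 (u1 u2 : R -> R -> R) t : R :=
  Int 0 L (fun x => Num.max (u1 x t - u2 x t) 0) + Num.max (s1 t - s2 t) 0.

(** The part of the excess carried by the common domain, the only place where the equation for the
    difference holds. *)
Definition inner_excess s1 s2 (u1 u2 : R -> R -> R) t : R :=
  Int 0 (Num.min (s1 t) (s2 t)) (fun x => Num.max (u1 x t - u2 x t) 0).

Lemma Rintegral_truncate_cc f X : 0 <= X <= L -> continuous f ->
  (forall x, X < x -> f x = 0) -> Int 0 L f = Int 0 X f.
Proof.
move=> XL cf f0.
have i y : leb.-integrable `[0, y] (EFin \o f).
  by apply: continuous_at_integrable => x _; exact: cf.
by rewrite -!Rintegral_oc_cc //; exact: Rintegral_truncate.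
Qed.

Lemma continuous_maxr0 (S : topologicalType) (f : S -> R) (x : S) :
  {for x, continuous f} -> {for x, continuous (fun r : S => Num.max (f r) 0)}.
Proof. by move=> cf; exact: (@continuous_max _ _ f (cst 0) x cf (cvg_cst _)). Qed.

Lemma near_right (P : R -> Prop) t : (\forall s \near t, P s) ->
  exists2 de : R, 0 < de & forall s, t <= s < t + de -> P s.
Proof.
move=> /nbhs_ballP[de /= de0 hde]; exists de => // s /andP[ts sd]; apply: hde.
by rewrite /ball /= distrC ger0_norm ?subr_ge0 // ltrBlDl.
Qed.

Lemma stefan_nonneg s u v : stefan_solution s u v -> forall x t, 0 < t < T -> 0 < x -> 0 <= u x t.
Proof.
move=> [fu bs u0 ui _] x t tin x0.
have [sx|xs] := leP (s t) x; first by rewrite u0.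
apply: (field_nonneg al01 c0 L0 Lam0 fu bs) => //; last by rewrite x0.
by move=> r _; rewrite u0.
Qed.

Section Pair.
Variables (s1 s2 : R -> R) (u1 u2 v1 v2 : R -> R -> R).
Hypotheses (S1 : stefan_solution s1 u1 v1) (S2 : stefan_solution s2 u2 v2).

Let w x t := u1 x t - u2 x t.

Let u1c x t : {for (x, t), continuous (joint u1)}.
Proof. by case: S1 => -[]. Qed.

Let u2c x t : {for (x, t), continuous (joint u2)}.
Proof. by case: S2 => -[]. Qed.

Let cw x t : {for (x, t), continuous (joint w)}.
Proof. by apply: cvgB; [exact: u1c|exact: u2c]. Qed.

Let cmax t : continuous (fun x => Num.max (w x t) 0).
Proof.
move=> x; apply: (@continuous_maxr0 R (w^~ t)).
by apply: (@section_continuous_l _ (fun x t => u1 x t - u2 x t)); exact: cw.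
Qed.

(** Beyond the smaller front u1 = 0 <= u2, so the positive part lives on the common domain. *)
Lemma excess_before t : 0 < t < T -> s1 t <= s2 t -> excess s1 s2 u1 u2 t = inner_excess s1 s2 u1 u2 t.
Proof.
move=> tin s12; rewrite /excess /inner_excess min_l // [Num.max (s1 t - s2 t) 0]max_r ?subr_le0 // addr0.
have [_ [b1 _ _] z1 _ _] := S1.
apply: Rintegral_truncate_cc; [by have /andP[/ltW -> ->] := b1 t|exact: cmax|].
move=> x sx; rewrite z1 ?(ltW sx) // sub0r max_r // oppr_le0.
apply: (stefan_nonneg S2) => //; apply: lt_trans sx; by have /andP[] := b1 t.
Qed.

Lemma enthalpy_truncate s u v t : stefan_solution s u v -> s t + Int 0 L (u^~ t) = s t + Int 0 (s t) (u^~ t).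
Proof.
move=> [[cu _ _ _ _] [b1 _ _] z1 _ _]; congr (_ + _).
apply: Rintegral_truncate_cc; first by have /andP[/ltW -> ->] := b1 t.
  by move=> x; exact: section_continuous_l.
by move=> x sx; rewrite z1 // ltW.
Qed.

Lemma enthalpy_const s u v a b : stefan_solution s u v -> 0 < a -> a <= b -> b < T ->
  s b + Int 0 L (u^~ b) = s a + Int 0 L (u^~ a).
Proof.
move=> S a0 ab bT; rewrite !(enthalpy_truncate _ S).
have [fu bs z1 _ ds] := S.
apply: (mass_conservation al01 c0 L0 Lam0 fu bs) => //.
by move=> t _; rewrite z1.
Qed.

(* The last term is constant in time, by conservation of the enthalpy. *)
Lemma excess_swap t : excess s1 s2 u1 u2 t = excess s2 s1 u2 u1 t +
  ((s1 t + Int 0 L (u1^~ t)) - (s2 t + Int 0 L (u2^~ t))).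
Proof.
have [[c1 _ _ _ _] _ _ _ _] := S1; have [[c2 _ _ _ _] _ _ _ _] := S2.
have cu1 : continuous (u1^~ t) by move=> x; exact: section_continuous_l.
have cu2 : continuous (u2^~ t) by move=> x; exact: section_continuous_l.
have i f : continuous f -> leb.-integrable `[0, L] (EFin \o f).
  by move=> cf; apply: continuous_at_integrable => x _; exact: cf.
have cm (f g : R -> R) : continuous f -> continuous g -> continuous (fun x => Num.max (f x - g x) 0).
  move=> cf cg x; apply: (@continuous_maxr0 R (fun x => f x - g x)).
  by apply: cvgB; [exact: cf|exact: cg].
have mE (a b : R) : Num.max (a - b) 0 = Num.max (b - a) 0 + (a - b).
  by case: (lerP (a - b) 0) => h1; case: (lerP (b - a) 0) => h2; lra.
rewrite /excess; have -> : Int 0 L (fun x => Num.max (u1 x t - u2 x t) 0) =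
  Int 0 L (fun x => Num.max (u2 x t - u1 x t) 0) + (Int 0 L (u1^~ t) - Int 0 L (u2^~ t)).
  rewrite -RintegralB; [|exact: measurable_itv|exact: i|exact: i].
  rewrite -RintegralD; [|exact: measurable_itv|by apply: i; exact: cm|].
    by apply: eq_Rintegral => x _; exact: mE.
  by apply: i => x; apply: cvgB; [exact: cu1|exact: cu2].
by rewrite (mE (s1 t)); ring.
Qed.

End Pair.

Lemma stefan_comparison s1 s2 u1 u2 v1 v2 :
  stefan_solution s1 u1 v1 -> stefan_solution s2 u2 v2 ->
  s1 0 <= s2 0 -> (forall x, 0 < x -> u1 x 0 <= u2 x 0) ->
  forall t, 0 < t < T -> s1 t <= s2 t.
Proof.
move=> S1 S2 s0 u0 t tin.
have [f1 b1 z1 p1 d1] := S1; have [f2 b2 z2 p2 d2] := S2.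
have fw := field_sub al01 L0 f1 f2; have bw := free_boundary_min al01 b1 b2.
have [c1 _ _ _ _] := f1; have [c2 _ _ _ _] := f2.
have [sb1 cs1 _] := b1; have [sb2 cs2 _] := b2.
(* While the first front is behind, the difference at it is 0 - u2 <= 0: the favourable case, with
   rate rho = 0. Generality in the pair allows its use with the roles exchanged. *)
have before s1' s2' u1' u2' v1' v2' a b : stefan_solution s1' u1' v1' ->
    stefan_solution s2' u2' v2' -> 0 < a -> a <= b -> b < T ->
    (forall r, a <= r <= b -> s1' r <= s2' r) ->
    excess s1' s2' u1' u2' b <= excess s1' s2' u1' u2' a.
  move=> S1' S2' a0 ab bT h.
  have [f1' b1' z1' _ _] := S1'; have [f2' b2' _ _ _] := S2'.
  have ain : 0 < a < T by rewrite a0 (le_lt_trans ab).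
  have bin : 0 < b < T by rewrite bT (lt_le_trans a0).
  rewrite (excess_before S1' S2' bin) ?h ?ab ?lexx // (excess_before S1' S2' ain) ?h ?ab ?lexx //.
  rewrite -[leRHS]addr0 -(mul0r (b - a)).
  apply: (positive_mass_bound al01 c0 L0 Lam0 (field_sub al01 L0 f1' f2') (free_boundary_min al01 b1' b2')) => //.
  move=> r /andP[ar rb]; left; rewrite min_l; last by apply: h; rewrite ar ltW.
  rewrite z1' // sub0r oppr_le0; apply: (stefan_nonneg S2').
    by rewrite (lt_le_trans a0 ar) (lt_trans rb).
  by have [/(_ r)/andP[]] := b1'.
have swap r : 0 < r < T -> excess s1 s2 u1 u2 r - excess s2 s1 u2 u1 r =
   excess s1 s2 u1 u2 t - excess s2 s1 u2 u1 t.
  move=> /andP[r0 rT]; have /andP[t0 tT] := tin.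
  rewrite !(excess_swap S1 S2) [X in X - _]addrC addrK [X in _ = X - _]addrC addrK.
  have [tr|/ltW rt] := leP t r.
    by rewrite (enthalpy_const S1 t0 tr rT) (enthalpy_const S2 t0 tr rT).
  by rewrite (enthalpy_const S1 r0 rt tT) (enthalpy_const S2 r0 rt tT).
have cPhi r : {for r, continuous (excess s1 s2 u1 u2)}.
  apply: cvgD.
    apply: (@param_Rintegral_continuous _ (fun x t => Num.max (u1 x t - u2 x t) 0)); first exact: ltW.
    move=> x y; apply: (@continuous_maxr0 _ (fun p : R * R => u1 p.1 p.2 - u2 p.1 p.2)).
    by apply: cvgB; [exact: c1|exact: c2].
  apply: (@continuous_maxr0 _ (fun t => s1 t - s2 t)).
  by apply: cvgB; [exact: cs1|exact: cs2].
have Phi0 : excess s1 s2 u1 u2 0 = 0.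
  rewrite /excess [Num.max (s1 0 - s2 0) 0]max_r ?subr_le0 // addr0.
  rewrite -Rintegral_oc_cc; last first.
    apply: continuous_at_integrable => x _.
    apply: (@continuous_maxr0 R (fun x => u1 x 0 - u2 x 0)).
    by apply: cvgB; apply: section_continuous_l; [exact: c1|exact: c2].
  rewrite (@eq_Rintegral _ _ _ _ _ (fun=> 0)); first by rewrite /Rintegral integral0.
  by move=> y; rewrite inE /= in_itv /= => /andP[/u0 h _]; rewrite max_r // subr_le0.
have fluxB r x : 0 < r < T ->
    flux (fun x t => v1 x t - v2 x t) x r = flux v1 x r - flux v2 x r.
  move=> rin; have [_ cv1] := field_section f1 rin; have [_ cv2] := field_section f2 rin.
  rewrite /flux convB //; apply: integrableS (powRN_integrable al01 L0) => //.
  exact: subset_itv_oc_cc.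
have step_le r : 0 < r < T -> (exists2 de : R, 0 < de & forall h, r <= h < r + de -> s1 h <= s2 h) ->
    forall k : R, 0 < k -> exists2 de : R, 0 < de & forall h : R, 0 < h < de ->
      excess s1 s2 u1 u2 (r + h) <= excess s1 s2 u1 u2 r + k * h.
  move=> /andP[r0 rT] [de de0 hde] k k0.
  exists (Num.min de (T - r)); first by rewrite lt_min de0 subr_gt0.
  move=> h /andP[h0]; rewrite lt_min => /andP[h1 h2].
  apply: (@le_trans _ _ (excess s1 s2 u1 u2 r)); last by rewrite lerDl ltW // mulr_gt0.
  apply: (before _ _ _ _ _ _ _ _ S1 S2) => //; first by rewrite lerDl ltW.
    by rewrite -ltrBrDl.
  move=> q /andP[q1 q2]; apply: hde; rewrite q1 (le_lt_trans q2) // ltrD2l //.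
have step_ge r : 0 < r < T -> (exists2 de : R, 0 < de & forall h, r <= h < r + de -> s2 h <= s1 h) ->
    forall k : R, 0 < k -> exists2 de : R, 0 < de & forall h : R, 0 < h < de ->
      excess s1 s2 u1 u2 (r + h) <= excess s1 s2 u1 u2 r + k * h.
  move=> rin [de de0 hde] k k0; have /andP[r0 rT] := rin.
  exists (Num.min de (T - r)); first by rewrite lt_min de0 subr_gt0.
  move=> h /andP[h0]; rewrite lt_min => /andP[h1 h2].
  have rh : r + h < T by rewrite -ltrBrDl.
  have B : excess s2 s1 u2 u1 (r + h) <= excess s2 s1 u2 u1 r.
    apply: (before _ _ _ _ _ _ _ _ S2 S1) => //; first by rewrite lerDl ltW.
    move=> q /andP[q1 q2]; apply: hde; rewrite q1 (le_lt_trans q2) // ltrD2l //.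
  (* The reversed excess is the one that does not grow here; its constant difference with the other
     carries the bound over. *)
  have E1 := swap r rin; have E2 := swap (r + h) (ltac:(by rewrite addr_gt0)).
  have kh : 0 < k * h by rewrite mulr_gt0.
  move: B E1 E2 kh; clear; lra.
(* When the fronts touch with equal speeds their order afterwards is unknown, but the
   flux and the trace of the difference vanish there, which bounds both excesses. *)
have tangent s1' s2' u1' u2' v1' v2' r k : stefan_solution s1' u1' v1' ->
    stefan_solution s2' u2' v2' -> 0 < r < T -> s1' r = s2' r ->
    c * flux v1' (s1' r) r = c * flux v2' (s2' r) r -> 0 < k ->
    exists2 de : R, 0 < de & forall h : R, 0 < h < de -> r + h < T ->
      inner_excess s1' s2' u1' u2' (r + h) <= inner_excess s1' s2' u1' u2' r + k * h.
  move=> S1' S2' rin ss ff k0; have /andP[r0 rT] := rin; have c0' := c0.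
  have [f1' b1' z1' _ _] := S1'; have [f2' b2' z2' _ _] := S2'.
  have fw' := field_sub al01 L0 f1' f2'; have bw' := free_boundary_min al01 b1' b2'.
  pose sg r := Num.min (s1' r) (s2' r).
  pose v x t := v1' x t - v2' x t.
  pose w x t := u1' x t - u2' x t.
  have [cw _ _ _ _] := fw'; have [_ csg _] := bw'.
  have cp : {for r, continuous (fun r => (sg r, r))}.
    exact: (@cvg_pair R R R (nbhs r) (nbhs (sg r)) (nbhs r) _ _ _ sg id (csg r) cvg_id).
  have cG : {for r, continuous (fun r => `|c * flux v (sg r) r| + Lam * `|w (sg r) r|)}.
    apply: cvgD.
      apply: (@continuous_comp _ _ _ (fun r => c * flux v (sg r) r) (fun z : R => `|z|)).
        apply: cvgM; first exact: cvg_cst.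
        apply: (@continuous_comp _ _ _ (fun r => (sg r, r)) (joint (flux v))) => //.
        exact: flux_continuous fw' rin.
      exact: norm_continuous.
    apply: cvgM; first exact: cvg_cst.
    apply: (@continuous_comp _ _ _ (fun r => w (sg r) r) (fun z : R => `|z|)).
      by apply: (@continuous_comp _ _ _ (fun r => (sg r, r)) (joint w)) => //; exact: cw.
    exact: norm_continuous.
  have sgr : sg r = s1' r by rewrite /sg -ss minxx.
  have G0 : `|c * flux v (sg r) r| + Lam * `|w (sg r) r| = 0.
    have -> : w (sg r) r = 0 by rewrite /w sgr z1' // ss z2' // subrr.
    have -> : c * flux v (sg r) r = 0.
      have [_ cv1] := field_section f1' rin; have [_ cv2] := field_section f2' rin.
      rewrite sgr /flux convB //; last first.
        apply: integrableS (powRN_integrable al01 L0) => //; exact: subset_itv_oc_cc.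
      by rewrite mulrBr -/(flux v1' _ _) -/(flux v2' _ _) ff ss subrr.
    by rewrite !normr0 mulr0 addr0.
  have [de de0 hde] : exists2 de : R, 0 < de & forall s, r <= s < r + de ->
      `|c * flux v (sg s) s| + Lam * `|w (sg s) s| < k.
    by apply: near_right; move: cG => /cvgr_lt; apply; rewrite G0.
  exists de => // h /andP[h0 hd] hT.
  have -> : k * h = k * (r + h - r) by rewrite addrAC subrr add0r.
  apply: (positive_mass_bound al01 c0 L0 Lam0 fw' bw') => //; first by rewrite lerDl ltW.
    exact: ltW.
  move=> q /andP[q1 q2]; right; apply/ltW; apply: hde; rewrite q1 (lt_trans q2) // ltrD2l //.
(* Strictly ordered fronts stay ordered for a while. Touching fronts with different speeds separate
   in a known order; only equal speeds require the tangential estimate. *)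
have step r : 0 < r < T -> forall k : R, 0 < k -> exists2 de : R, 0 < de &
    forall h : R, 0 < h < de -> excess s1 s2 u1 u2 (r + h) <= excess s1 s2 u1 u2 r + k * h.
  move=> rin; have /andP[r0 rT] := rin.
  have csd : {for r, continuous (fun r => s2 r - s1 r)}.
    by apply: cvgB; [exact: cs2|exact: cs1].
  have [s12|s21|s12] := ltgtP (s1 r) (s2 r).
  - apply: step_le => //; apply: near_right.
    move: csd => /cvgr_gt /(_ 0); rewrite subr_gt0 => /(_ s12).
    by apply: filterS => q; rewrite subr_gt0 => /ltW.
  - apply: step_ge => //; apply: near_right.
    move: csd => /cvgr_lt /(_ 0); rewrite subr_lt0 => /(_ s21).
    by apply: filterS => q; rewrite subr_lt0 => /ltW.
  have D1 := is_derive_sub (d1 r rin) (d2 r rin).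
  have [k1|k2|ff] := ltgtP (c * flux v1 (s1 r) r) (c * flux v2 (s2 r) r).
  - apply: step_ge => //.
    (* With the relative speed itself as tolerance, the first-order expansion of s1 - s2 stays
       nonnegative. *)
    have k'0 : 0 < c * flux v2 (s2 r) r - c * flux v1 (s1 r) r by rewrite subr_gt0.
    have [de de0 hde] := is_derive_increment D1 k'0; exists de => // q /andP[q1 q2].
    have [<-|nq] := eqVneq r q; first by rewrite s12.
    have := hde (q - r); rewrite subr_gt0 lt_neqAle nq q1 ltrBlDl q2 => /(_ isT).
    rewrite (ltac:(ring) : r + (q - r) = q) s12 subrr subr0 ler_norml => /andP[+ _].
    by move: k'0; clear; lra.
  - apply: step_le => //.
    have k'0 : 0 < c * flux v1 (s1 r) r - c * flux v2 (s2 r) r by rewrite subr_gt0.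
    have [de de0 hde] := is_derive_increment D1 k'0; exists de => // q /andP[q1 q2].
    have [<-|nq] := eqVneq r q; first by rewrite s12.
    have := hde (q - r); rewrite subr_gt0 lt_neqAle nq q1 ltrBlDl q2 => /(_ isT).
    rewrite (ltac:(ring) : r + (q - r) = q) s12 subrr subr0 ler_norml => /andP[_ +].
    by move: k'0; clear; lra.
  move=> k k0.
  have [de1 de10 h1] := tangent _ _ _ _ _ _ r k S1 S2 rin s12 ff k0.
  have [de2 de20 h2] := tangent _ _ _ _ _ _ r k S2 S1 rin (esym s12) (esym ff) k0.
  exists (Num.min (T - r) (Num.min de1 de2)); first by rewrite !lt_min subr_gt0 rT de10.
  move=> h /andP[h0]; rewrite !lt_min ltrBrDl => /and3P[rh hd1 hd2].
  have rhin : 0 < r + h < T by rewrite addr_gt0.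
  have E1 := h1 h (ltac:(by rewrite h0)) rh; have E2 := h2 h (ltac:(by rewrite h0)) rh.
  have P1 : excess s1 s2 u1 u2 r = inner_excess s1 s2 u1 u2 r.
    by apply: (excess_before S1 S2) => //; rewrite s12.
  have P2 : excess s2 s1 u2 u1 r = inner_excess s2 s1 u2 u1 r.
    by apply: (excess_before S2 S1) => //; rewrite s12.
  (* Both inner excesses are controlled from r, so the direction can be chosen after the fact, by
     the order of the fronts at r + h. *)
  have [l|/ltW l] := leP (s1 (r + h)) (s2 (r + h)).
    have Q1 : excess s1 s2 u1 u2 (r + h) = inner_excess s1 s2 u1 u2 (r + h) by exact: (excess_before S1 S2).
    by rewrite Q1 P1.
  have Q2 : excess s2 s1 u2 u1 (r + h) = inner_excess s2 s1 u2 u1 (r + h) by exact: (excess_before S2 S1).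
  have W1 := swap r rin; have W2 := swap (r + h) rhin.
  rewrite -Q2 -P2 in E2; move: E2 W1 W2; clear; lra.
have /andP[t0 tT] := tin.
have fin : excess s1 s2 u1 u2 t <= excess s1 s2 u1 u2 0.
  apply: continuous_le_right => // a a0 at_.
  apply: (@Dini_nonincreasing _ (excess s1 s2 u1 u2)) => //.
  move=> q /andP[q1 q2].
  by apply: step; rewrite (lt_le_trans a0 q1) (lt_trans q2).
have : Num.max (s1 t - s2 t) 0 <= 0.
  rewrite Phi0 in fin; apply: le_trans fin; rewrite /excess lerDr; apply: Rintegral_ge0 => x _.
  by rewrite le_max lexx orbT.
by rewrite ge_max lexx andbT subr_le0.
Qed.

End Comparison.

(** * The Caputo derivative as a convolution *)

Section CaputoFlux.
Variable R : realType.
Set Implicit Arguments. Unset Strict Implicit.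
Implicit Types (f g : R -> R) (a b x y t h : R).
Local Notation leb := (@lebesgue_measure R).
Variables (al L : R).
Hypotheses (al01 : 0 < al < 1) (L0 : 0 < L).
Let k q : R := q `^ (- al).
Local Notation frac_int := (frac_int al).

Let ik : leb.-integrable `[0, L] (EFin \o k).
Proof. exact: powRN_integrable. Qed.

Let ik_oc : leb.-integrable `]0, L] (EFin \o k).
Proof. by apply: integrableS ik => //; exact: subset_itv_oc_cc. Qed.

Lemma eq_frac_int f g x : 0 <= x -> (forall p, 0 <= p <= x -> f p = g p) ->
  frac_int f x = frac_int g x.
Proof.
move=> x0 fg; apply: eq_Rintegral => p; rewrite inE /= in_itv /= => hp.
by rewrite !fg ?lexx.
Qed.

Lemma frac_int_conv f x : 0 <= x <= L -> continuous f -> (forall y, y <= 0 -> f y = f 0) ->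
  frac_int f x = conv k L (fun y => f y - f 0) x.
Proof.
move=> /andP[x0 xL] cf f0; pose h q := k q * (f (x - q) - f 0).
have cf0 : continuous (fun y => f y - f 0).
  by move=> y; apply: cvgB; [exact: cf|exact: cvg_cst].
have mh : measurable_fun setT h.
  apply: measurable_funM; first exact: measurable_powR.
  apply: (measurableT_comp (f := fun y => f y - f 0)).
    exact: continuous_measurable_fun.
  exact: measurable_reflect.
have xLs : `[0, x]%classic `<=` `[0, L]%classic.
  by move=> q; rewrite /= !in_itv /= => /andP[-> /le_trans ->].
have ih : leb.-integrable `[0, x] (EFin \o h).
  apply: (mul_reflect_integrable (v := fun y => f y - f 0) _ _ xLs) => //; first exact: ltW.
  exact: integrableS ik.
rewrite /conv (@Rintegral_truncate _ h x) ?x0 //; last first.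
  by move=> q xq; rewrite /h f0 ?subrr ?mulr0 // subr_le0 ltW.
rewrite Rintegral_oc_cc // -Rintegral_reflect //.
by apply: eq_Rintegral => p _; rewrite /h /k subKr.
Qed.

(** The left quotient is the convolution of the kernel with the backward quotient of f. The latter
    is bounded by sup |g| and converges to g at every y < x, so dominated convergence applies with
    no differentiability at x itself; hence x may be the front. *)
Lemma frac_int_quotient_cvg f g x : 0 < x <= L -> continuous f -> continuous g ->
  (forall y, y <= 0 -> f y = f 0) -> (forall y, y <= 0 -> g y = 0) ->
  (forall y, 0 < y < x -> is_derive y 1 f (g y)) ->
  frac_int_lquot al f x h @[h --> 0^'+] --> conv k L g x.
Proof.
move=> /andP[x0 xL] cf cg f0 g0 df.
have mvt a b : 0 <= a -> a < b -> b < x ->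
    exists2 c, a < c < b & f b - f a = g c * (b - a).
  move=> a0 ab bx.
  have [||c + E] := @MVT _ f g a b ab.
  - move=> y; rewrite in_itv /= => /andP[ay yb]; apply: df.
    by rewrite (le_lt_trans a0 ay) (lt_trans yb).
  - by apply: continuous_at_within => y _; exact: cf.
  - by rewrite in_itv => hc; exists c.
have [M M0 hM] : exists2 M : R, 0 <= M & forall y, 0 <= y <= x -> `|g y| <= M.
  by apply: continuous_at_bounded => [|y _]; [exact: ltW|exact: cg].
(* f is constant to the left of 0 and may have a corner there, so an interval straddling 0 is cut at
   0 before the mean value theorem is used. *)
have bound y h : y < x -> 0 < h -> `|f y - f (y - h)| <= M * h.
  move=> yx h0.
  have [y0|y0] := leP y 0.
    by rewrite f0 // (f0 (y - h)) ?subrr ?normr0 ?mulr_ge0 ?(ltW h0) // subr_le0 (le_trans y0) // ltW.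
  have [yh|yh] := leP (y - h) 0.
    rewrite (f0 (y - h)) //; have [c /andP[c1 c2] ->] := mvt 0 y (lexx _) y0 yx.
    rewrite subr0 normrM (gtr0_norm y0); apply: ler_pM; [exact: normr_ge0|exact: ltW| |by rewrite -subr_le0].
    by apply: hM; rewrite !ltW ?(lt_trans c2).
  have [|c /andP[c1 c2] ->] := mvt (y - h) y (ltW yh) _ yx; first by rewrite gtrBl.
  rewrite opprB addrC subrK normrM (gtr0_norm h0) (ler_wpM2r (ltW h0)) //.
  by apply: hM; rewrite !ltW ?(lt_trans c2) ?(lt_trans yh).
have ptw y : y < x -> (f y - f (y - h)) / h @[h --> 0^'+] --> g y.
  move=> yx; have [y0|y0] := leP y 0.
    rewrite g0 //; apply: (@cvg_trans _ (@cst R R 0 @ 0^'+)); last exact: cvg_cst.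
    apply: near_eq_cvg; near=> h.
    have h0 : 0 < h by [].
    by rewrite /cst f0 // (f0 (y - h)) ?subrr ?mul0r // subr_le0 (le_trans y0) // ltW.
  apply/cvgrPdist_le => e e0.
  have /cvgrPdist_le /(_ _ e0) /nbhs_ballP[d /= d0 hd] := cg y.
  near=> h.
  have h0 : 0 < h by [].
  have hy : h < y by near: h; exact: nbhs_right_lt.
  have hd' : h < d by near: h; exact: nbhs_right_lt.
  have [||c /andP[c1 c2] E] := mvt (y - h) y _ _ yx; [by rewrite subr_ge0 ltW|by rewrite gtrBl|].
  rewrite E subKr mulfK ?gt_eqF //.
  apply: hd; rewrite /ball /= ltr_distlC; apply/andP; split; last by rewrite (lt_trans c2) // ltrDl.
  by apply: le_lt_trans c1; rewrite lerD2l lerN2 ltW.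
(* Dominated convergence is stated for sequences, so the right limit is tested along them. *)
apply/cvg_at_rightP => u [u0 ul].
have cF : continuous (fun y => f y - f 0).
  by move=> y; apply: cvgB; [exact: cf|exact: cvg_cst].
have cS h : continuous (fun y => f (y - h)).
  move=> y; apply: (@continuous_comp _ _ _ (fun y => y - h) f); last exact: cf.
  by apply: cvgB; [exact: cvg_id|exact: cvg_cst].
pose d h y := (f y - f (y - h)) / h.
have cd h : continuous (d h).
  by move=> y; apply: cvgM; [apply: cvgB; [exact: cf|exact: cS]|exact: cvg_cst].
have quot h : 0 < h <= x -> frac_int_lquot al f x h = conv k L (d h) x.
  move=> /andP[h0 hx]; rewrite /frac_int_lquot.
  rewrite !frac_int_conv ?subr_ge0 ?hx ?(ltW x0) //=; last by rewrite (le_trans _ xL) // gerBl ltW.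
  have -> : conv k L (fun y => f y - f 0) (x - h) = conv k L (fun y => f (y - h) - f 0) x.
    by apply: eq_Rintegral => q _; rewrite addrAC.
  have cS0 : continuous (fun y => f (y - h) - f 0).
    by move=> y; apply: cvgB; [exact: cS|exact: cvg_cst].
  rewrite -convB // mulrC -RintegralZl //; last first.
    apply: (conv_integrable (v := fun y => f y - f 0 - (f (y - h) - f 0))) => // y.
    by apply: cvgB; [exact: cF|exact: cS0].
  by apply: eq_Rintegral => q _; rewrite /d; ring.
apply: (@cvg_trans _ (conv k L (d (u n)) x @[n --> \oo])).
  apply: near_eq_cvg; near=> n; rewrite quot // u0 /=; near: n.
  by move/cvgr_le : ul; apply.
have meas v : continuous v -> measurable_fun `]0, L]%classic (fun q => k q * v (x - q)).
  move=> cv; apply: (measurable_EFinP _ _).1.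
  by case/integrableP : (conv_integrable x L0 ik_oc cv).
have := @dominated_Rintegral _ `]0, L]%classic (fun n q => k q * d (u n) (x - q))
  (fun q => k q * g (x - q)) (fun q => M * k q) (measurable_itv _) (fun n => meas _ (cd _)) (meas _ cg).
case=> //.
- move=> q; rewrite /= in_itv /= => /andP[q0 _]; apply: cvgM; first exact: cvg_cst.
  have /cvg_at_rightP := ptw (x - q) (ltac:(by rewrite gtrBl)).
  by apply.
- under [X in integrable _ _ X]funext => q do rewrite /= EFinM.
  exact: integrableZl.
- move=> n q; rewrite /= in_itv /= => /andP[q0 _].
  rewrite normrM (ger0_norm (powR_ge0 _ _)) mulrC ler_wpM2r ?powR_ge0 //.
  rewrite /d normrM normfV (gtr0_norm (u0 n)) ler_pdivrMr //.
  by apply: bound; rewrite ?gtrBl.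
Unshelve. all: by end_near. Qed.

(** Left quotients only look at [0, x], so [caputo] of u may be computed on any extension f of u
    from that interval. *)
Lemma caputo_conv f g x : 0 < x <= L -> continuous f -> continuous g ->
  (forall y, y <= 0 -> f y = f 0) -> (forall y, y <= 0 -> g y = 0) ->
  (forall y, 0 < y < x -> is_derive y 1 f (g y)) ->
  forall u : R -> R, (forall p, 0 <= p <= x -> u p = f p) ->
  caputo al u x = (Gamma (1 - al))^-1 * conv k L g x.
Proof.
move=> xin cf cg f0 g0 df u uf; have /andP[x0 _] := xin.
rewrite /caputo mulrC; congr (_ * _); apply: cvg_lim => //.
apply: cvg_trans (frac_int_quotient_cvg xin cf cg f0 g0 df).
apply: near_eq_cvg; near=> h.
have h0 : 0 < h by [].
have hx : h <= x by near: h; exact: nbhs_right_le.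
rewrite /frac_int_lquot (eq_frac_int (ltW x0) uf).
rewrite (@eq_frac_int u f (x - h)) ?subr_ge0 // => p /andP[p0 p1].
by apply: uf; rewrite p0 (le_trans p1) // gerBl ltW.
Unshelve. all: by end_near. Qed.

End CaputoFlux.

(** * Extension of solutions *)

Section Extension.
Variable R : realType.
Set Implicit Arguments. Unset Strict Implicit.
Implicit Types (a b x y t h : R).
Local Notation leb := (@lebesgue_measure R).
Local Notation joint v := (fun p : R * R => v p.1 p.2).

(** A clamp sends a whole neighbourhood into the closed domain, which turns continuity relative to
    the domain into plain continuity of the extension. *)
Lemma within_comp_continuous (A : set (R * R)) (F : R * R -> R) (phi : R * R -> R * R) (p : R * R) :
  {within A, continuous F} -> {for p, continuous phi} -> (\forall q \near p, A (phi q)) ->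
  {for p, continuous (F \o phi)}.
Proof.
move=> cF cphi Aphi.
have Ap : A (phi p) by exact: (@nbhs_singleton (R * R)%type p (fun q => A (phi q))).
have /subspace_continuousP cF' := cF.
move=> U /(cF' _ Ap) hU; rewrite /= in hU *.
have h : nbhs p (fun q => A (phi q) -> U (F (phi q))) := cphi _ hU.
change (nbhs p (fun q => U (F (phi q)))).
by apply: filterS (filterI Aphi h) => q [Aq]; apply.
Qed.

(** A negative value would persist on an interval, which has positive measure. *)
Lemma continuous_ae_ge0 (F : R -> R) a b :
  (forall t, a < t < b -> {for t, continuous F}) ->
  {ae leb, forall t, t \in `]a, b[ -> 0 <= F t} ->
  forall t, a < t < b -> 0 <= F t.
Proof.
move=> cF aeF t tab; rewrite leNgt; apply/negP => Ft.
have /cvgr_lt /(_ 0 Ft) hn := cF t tab.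
have [r r0 hr] : exists2 r : R, 0 < r & forall y, ball t r y -> F y < 0 /\ a < y < b.
  have : \forall y \near t, F y < 0 /\ a < y < b.
    have /andP[ta tb] := tab; near=> y; split; first by near: y.
    by apply/andP; split; near: y; [exact: lt_nbhsr|exact: lt_nbhsl].
  by move=> /nbhs_ballP[r /= r0 hr]; exists r.
have [A [mA A0 hA]] := aeF.
have sub : `]t - r, t + r[%classic `<=` A.
  move=> y; rewrite /= in_itv /= => hy; apply: hA => /= H.
  have [|Fy yab] := hr y; first by rewrite /ball /= ltr_distlC.
  by have := H yab; rewrite leNgt Fy.
have : (leb `](t - r)%R, (t + r)%R[%classic <= 0)%E.
  apply: le_trans (@le_measure _ _ _ leb `]t - r, t + r[%classic A (mem_set (measurable_itv _)) (mem_set mA) sub) _.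
  by rewrite le_eqVlt; apply/orP; left; apply/eqP; exact: A0.
rewrite lebesgue_measure_itv /= lte_fin ifT; last by lra.
by rewrite -EFinB lee_fin; lra.
Unshelve. all: by end_near. Qed.

Lemma continuous_right_ge0 (f : R -> R) b : {for 0, continuous f} -> 0 < b ->
  (forall a, 0 < a < b -> 0 <= f a) -> 0 <= f 0.
Proof.
move=> cf b_gt0 fpos; rewrite leNgt; apply/negP => fneg.
have [de de0 hde] : exists2 de : R, 0 < de & forall a, 0 <= a < 0 + de -> f a < 0.
  by apply: near_right; move: cf => /cvgr_lt; apply.
pose a := Num.min (de / 2) (b / 2).
have a0 : 0 < a by rewrite lt_min !divr_gt0.
have ade : a < de by rewrite gt_min half_lt.
have ab : a < b by rewrite gt_min (half_lt b_gt0) orbT.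
by have := hde a; rewrite add0r ade ltW // ltNge fpos ?a0 // => /(_ isT).
Qed.

(** * Clamping to the closed domain *)

Definition clamp a b x := Num.max a (Num.min x b).

Lemma clamp_bound a b x : a <= b -> a <= clamp a b x <= b.
Proof. by move=> ab; rewrite le_max lexx /= ge_max ab ge_min lexx orbT. Qed.

Lemma clamp_id a b x : a <= x <= b -> clamp a b x = x.
Proof. by move=> /andP[ax xb]; rewrite /clamp min_l // max_r. Qed.

Lemma clamp_le a b x : a <= b -> x <= a -> clamp a b x = a.
Proof. by move=> ab xa; rewrite /clamp min_l ?max_l // (le_trans xa). Qed.

Lemma clamp_ge a b x : a <= b -> b <= x -> clamp a b x = b.
Proof. by move=> ab bx; rewrite /clamp min_r // max_r. Qed.

Lemma clamp_continuous (S : topologicalType) a (f g : S -> R) (p : S) :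
  {for p, continuous f} -> {for p, continuous g} ->
  {for p, continuous (fun q : S => clamp a (g q) (f q))}.
Proof.
move=> cf cg; apply: (@continuous_max _ _ (cst a) (fun q => Num.min (f q) (g q))); first exact: cvg_cst.
exact: (@continuous_min _ _ f g).
Qed.

Lemma clamp_dist a b x y : a <= b -> `|clamp a b x - clamp a b y| <= `|x - y|.
Proof.
move=> ab; wlog : x y / x <= y.
  move=> h; have [/h //|/ltW/h] := leP x y; by rewrite distrC [`|y - x|]distrC.
move=> xy; rewrite distrC [`|x - y|]distrC [`|y - x|]ger0_norm ?subr_ge0 //.
have : clamp a b x <= clamp a b y by rewrite ge_max le_max lexx /= le_max le_min !ge_min xy lexx !orbT.
move=> cxy; rewrite ger0_norm ?subr_ge0 // /clamp.
case: (lerP y b) => h1; case: (lerP x b) => h2; try lra.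
- by case: (lerP a y) => h3; case: (lerP a x) => h4; lra.
- by rewrite (max_r ab); case: (lerP a x) => h4; lra.
Qed.

Definition front_ext T (s : R -> R) t := s (clamp 0 T t).

(** Extension by boundary values. For u it gives zero past the front; for [u_x] it gives zero to the
    left of x = 0, and past the front a continuous function that need not be the derivative of the
    extended u. *)
Definition field_ext T (s : R -> R) (w : R * R -> R) x t :=
  w (clamp 0 (front_ext T s t) x, clamp 0 T t).

Lemma front_ext_id T s t : 0 <= t <= T -> front_ext T s t = s t.
Proof. by move=> ht; rewrite /front_ext clamp_id. Qed.

Variables (alpha T b0 M : R) (u0 : R -> R) (u : R -> R -> R) (s : R -> R).
Hypotheses (T0 : 0 < T) (al01 : 0 < alpha < 1) (b0_gt0 : 0 < b0).
Hypothesis sol : is_solution alpha T b0 M u0 u s.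
Let c : R := (Gamma (1 - alpha))^-1.

Local Notation st := (front_ext T s).

Let cl t : 0 <= clamp 0 T t <= T.
Proof. by apply: clamp_bound; exact: ltW. Qed.

Lemma extended_front_lipschitz : exists2 Lam : R, 0 <= Lam &
  forall t1 t2, `|st t1 - st t2| <= Lam * `|t1 - t2|.
Proof.
have [[La hLa] _] := sol; exists `|La| => // t1 t2.
apply: (le_trans (hLa _ _ (cl t1) (cl t2))); apply: (@le_trans _ _ (`|La| * `|clamp 0 T t1 - clamp 0 T t2|)).
  by apply: ler_wpM2r => //; exact: ler_norm.
by apply: ler_wpM2l => //; apply: clamp_dist; exact: ltW.
Qed.

Lemma front_ext_continuous : continuous st.
Proof.
have [Lam Lam0 hL] := extended_front_lipschitz.
move=> t; apply/cvgrPdist_le => e e0.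
have L1 : 0 < Lam + 1 by rewrite ltr_wpDl.
have d0 : 0 < e / (Lam + 1) by exact: divr_gt0.
apply: filterS (nbhsx_ballx t _ d0) => r /ltW tr; apply: (le_trans (hL _ _)).
apply: (@le_trans _ _ ((Lam + 1) * `|t - r|)); first by rewrite ler_wpM2r // lerDl.
by rewrite mulrC -ler_pdivlMr //.
Qed.

Let st0 : st 0 = b0.
Proof. by have [_ [_ [_ [_ [_ [_ [_ [_ [_ [_ [sb _]]]]]]]]]]] := sol; rewrite front_ext_id // lexx ltW. Qed.

Let k q : R := q `^ (- alpha).

Variable v : R * R -> R.
Hypotheses
  (cv : {within [set p | Qbar s T p /\ (1 / 2 < alpha \/ 0 < p.2)], continuous v})
  (vE : forall p, Qst s T p -> v p = derive1 (fun x => u x p.2) p.1)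
  (v0 : forall t, 0 < t < T -> v (0, t) = 0).

Let phi (p : R * R) := (clamp 0 (st p.2) p.1, clamp 0 T p.2).
Local Notation ut := (field_ext T s (joint u)).
Local Notation vt := (field_ext T s v).

Let cphi p : {for p, continuous phi}.
Proof.
have c1 : {for p, continuous (fun p : R * R => p.1)} by exact: cvg_fst.
have c2 : {for p, continuous (fun p : R * R => p.2)} by exact: cvg_snd.
have c3 : {for p, continuous (fun p : R * R => st p.2)}.
  by apply: (@continuous_comp _ _ _ (fun p : R * R => p.2) st); [exact: c2|exact: front_ext_continuous].
have c4 : {for p, continuous (fun p : R * R => clamp 0 (st p.2) p.1)}.
  exact: clamp_continuous.
have c5 : {for p, continuous (fun p : R * R => clamp 0 T p.2)}.
  by apply: clamp_continuous => //; exact: cvg_cst.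
exact: (@cvg_pair (R * R)%type R R (nbhs p) (nbhs (clamp 0 (st p.2) p.1)) (nbhs (clamp 0 T p.2)) _ _ _ _ _ c4 c5).
Qed.

Let near_above x t : x < st t -> \forall r \near t, x < st r.
Proof.
move=> xt; have h : {for t, continuous st} by exact: front_ext_continuous.
by move: h => /cvgr_gt; apply.
Qed.

Let near_front x t : 0 < st t -> \forall q \near (x, t), 0 < st q.2.
Proof.
move=> ht; have c3 : {for (x, t), continuous (fun p : R * R => st p.2)}.
  by apply: (@continuous_comp _ _ _ (fun p : R * R => p.2) st); [exact: cvg_snd|exact: front_ext_continuous].
by move: c3 => /cvgr_gt; apply.
Qed.

Let near_time x t : 0 < t < T -> \forall q \near (x, t), 0 < q.2 < T.
Proof.
move=> /andP[t0 tT]; have c2 : {for (x, t), continuous (fun p : R * R => p.2)} by exact: cvg_snd.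
have h1 : \forall q \near (x, t), 0 < q.2 by move: c2 => /cvgr_gt; apply.
have h2 : \forall q \near (x, t), q.2 < T by move: c2 => /cvgr_lt; apply.
by apply: filterS (filterI h1 h2) => q [-> ->].
Qed.

Let near_inside x t : 0 < t < T -> 0 < x < st t -> \forall q \near (x, t), Qst s T q.
Proof.
move=> tin /andP[x0 xs].
have c1 : {for (x, t), continuous (fun p : R * R => p.1)} by exact: cvg_fst.
have c3 : {for (x, t), continuous (fun p : R * R => st p.2 - p.1)}.
  apply: cvgB; last exact: c1.
  by apply: (@continuous_comp _ _ _ (fun p : R * R => p.2) st); [exact: cvg_snd|exact: front_ext_continuous].
have h1 : \forall q \near (x, t), 0 < q.1 by move: c1 => /cvgr_gt; apply.
have h2 : \forall q \near (x, t), 0 < st q.2 - q.1 by move: c3 => /cvgr_gt; apply; rewrite subr_gt0.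
apply: filterS (filterI (filterI h1 h2) (near_time x tin)) => q [[a1 a2] /[dup] a3 /andP[a4 a5]].
by split=> //; rewrite a1 -(@front_ext_id T) ?ltW // -subr_gt0.
Qed.

Let cut x t : 0 < st t -> {for (x, t), continuous (joint ut)}.
Proof.
move=> ht; have [_ [_ [cuu _]]] := sol.
suff : {for (x, t), continuous (joint u \o phi)} by [].
apply: (within_comp_continuous cuu); first exact: cphi.
apply: filterS (near_front x ht) => q hq; split; last exact: cl.
by apply: clamp_bound; exact: ltW.
Qed.

Let cvt x t : 0 < t < T -> 0 < st t -> {for (x, t), continuous (joint vt)}.
Proof.
move=> tin ht; suff : {for (x, t), continuous (v \o phi)} by [].
apply: (within_comp_continuous cv); first exact: cphi.
apply: filterS (filterI (near_front x ht) (near_time x tin)) => q [hq /andP[q0 qT]]; split.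
  by split; [apply: clamp_bound; exact: ltW|exact: cl].
by right; rewrite /phi /= clamp_id ?ltW.
Qed.

Let ut_id x t : 0 <= t <= T -> 0 <= x <= st t -> ut x t = u x t.
Proof. by move=> ht hx; rewrite /field_ext !clamp_id. Qed.

Let insideW x t : 0 < t < T -> 0 < x < st t -> Qst s T (x, t).
Proof. by move=> tin xin; have /nbhs_singleton := near_inside tin xin. Qed.

Let dut x t : 0 < t < T -> 0 < x < st t -> is_derive x 1 (ut^~ t) (vt x t).
Proof.
move=> tin xin; have Q := insideW tin xin.
have [_ [_ [_ [der _]]]] := sol; have [_ d _ _] := der _ Q.
have tin' : 0 <= t <= T by have /andP[? ?] := tin; rewrite !ltW.
have /andP[x0 xs] := xin.
have -> : vt x t = 'D_1 (u^~ t) x.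
  by rewrite /field_ext !clamp_id ?(ltW x0) ?(ltW xs) // (vE Q) derive1E.
have D : is_derive x 1 (u^~ t) ('D_1 (u^~ t) x) by exact: derivableP.
refine (near_eq_is_derive _ D).
near=> y; rewrite ut_id //; apply/andP; split; apply/ltW.
  by near: y; exact: lt_nbhsr.
by near: y; exact: lt_nbhsl.
Unshelve. all: by end_near. Qed.

Let vt0 x t : 0 < t < T -> 0 < st t -> x <= 0 -> vt x t = 0.
Proof.
move=> tin st_gt0 x0; rewrite /field_ext clamp_le ?(ltW st_gt0) // clamp_id ?v0 //.
by have /andP[? ?] := tin; rewrite !ltW.
Qed.

(** The case x = st t is included: this turns the condition on the front into one on a flux that is
    jointly continuous. *)
Let caputoE L x t : 0 < t < T -> 0 < x -> x <= st t -> st t <= L ->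
  caputo alpha (u^~ t) x = c * flux alpha L vt x t.
Proof.
move=> tin x0 xs sL; have st_gt0 := lt_le_trans x0 xs.
have L0 := lt_le_trans st_gt0 sL.
apply: (@caputo_conv _ alpha L al01 L0 (ut^~ t) (vt^~ t)).
- by rewrite x0 (le_trans xs).
- by move=> y; apply: section_continuous_l; exact: cut.
- by move=> y; apply: section_continuous_l; exact: cvt.
- by move=> y y0; rewrite /field_ext !(clamp_le (ltW st_gt0)).
- by move=> y y0; exact: vt0.
- by move=> y /andP[y0 yx]; apply: dut => //; rewrite y0 (lt_le_trans yx).
- move=> p /andP[p0 px]; rewrite ut_id //; last by rewrite p0 (le_trans px).
  by have /andP[? ?] := tin; rewrite !ltW.
Qed.

Let dst t : 0 < t < T -> is_derive t 1 st (derive1 s t).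
Proof.
move=> tin; have [_ [_ [_ [_ [_ [_ [_ [_ [_ [_ [_ [_ stef]]]]]]]]]]]] := sol.
have [_ [d _]] := stef t tin.
have D : is_derive t 1 s (derive1 s t) by rewrite derive1E; exact: derivableP.
have /andP[t0 tT] := tin.
refine (near_eq_is_derive _ D).
near=> r; rewrite front_ext_id //; apply/andP; split; apply/ltW.
  by near: r; exact: lt_nbhsr.
by near: r; exact: lt_nbhsl.
Unshelve. all: by end_near. Qed.

Let stefan_condition t : 0 < t < T -> derive1 s t = - caputo alpha (u^~ t) (st t).
Proof.
move=> tin; have [_ [_ [_ [_ [_ [_ [_ [_ [_ [_ [_ [_ stef]]]]]]]]]]]] := sol.
have [_ [_ ->]] := stef t tin; rewrite front_ext_id //.
by have /andP[? ?] := tin; rewrite !ltW.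
Qed.

(** The range of integration is empty or a point. This value settles the speed of a front whose
    positivity is not yet established. *)
Lemma caputo_le0 (f : R -> R) x : x <= 0 -> caputo alpha f x = 0.
Proof.
have F0 y : y <= 0 -> frac_int alpha f y = 0.
  rewrite le_eqVlt => /orP[/eqP ->|y0]; first by rewrite /frac_int set_itv1 Rintegral_set1.
  by rewrite /frac_int set_itv_ge ?Rintegral_set0 // bnd_simp /= -ltNge.
move=> x0; rewrite /caputo.
have -> : lim (frac_int_lquot alpha f x h @[h --> 0^'+]) = 0; last by rewrite mul0r.
apply: cvg_lim => //; apply: (@cvg_trans _ (@cst R R 0 @ 0^'+)); last exact: cvg_cst.
apply: near_eq_cvg; near=> h.
have h0 : 0 < h by [].
by rewrite /frac_int_lquot !F0 ?subrr ?mul0r // subr_le0 (le_trans x0) // ltW.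
Unshelve. all: by end_near. Qed.


(** The sign of the speed is given almost everywhere only. Where the front is positive, the speed
    equals a continuous flux, which inherits the sign everywhere; where it is not, the speed is 0 by
    [caputo_le0]. Thus the front is nondecreasing, and positivity follows from b0 > 0 without
    circularity. *)
Let derive_front_ge0 t : 0 < t < T -> 0 <= derive1 s t.
Proof.
move=> tin; have [st_le0|st_gt0] := leP (st t) 0.
  by rewrite stefan_condition // caputo_le0 ?oppr0.
have [Lam Lam0 hLam] := extended_front_lipschitz.
(* A bound from the Lipschitz estimate, as monotonicity of the front is still to come. *)
pose L := b0 + Lam * T.
have sL r : st r <= L.
  have -> : st r = st (clamp 0 T r) by rewrite /front_ext [clamp 0 T (clamp 0 T r)]clamp_id.
  have := hLam (clamp 0 T r) 0; rewrite st0 subr0; have /andP[h0 h1] := cl r.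
  rewrite (ger0_norm h0) => /(le_trans (ler_norm _)); rewrite lerBlDl => /le_trans; apply.
  by rewrite lerD2l ler_wpM2l.
have L0 := lt_le_trans st_gt0 (sL t).
have ipow : leb.-integrable `]0, L] (EFin \o k).
  by apply: integrableS (powRN_integrable al01 L0) => //; exact: subset_itv_oc_cc.
have [r r0 hr] : exists2 r : R, 0 < r & forall y, ball t r y -> 0 < y < T /\ 0 < st y.
  have : \forall y \near t, 0 < y < T /\ 0 < st y.
    have /andP[ta tb] := tin; near=> y; split.
      by apply/andP; split; near: y; [exact: lt_nbhsr|exact: lt_nbhsl].
    by near: y; exact: near_above.
  by move=> /nbhs_ballP[r /= r0 hr]; exists r.
pose F y : R := - (c * conv k L (vt^~ y) (st y)).
have rball y : t - r < y < t + r -> 0 < y < T /\ 0 < st y.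
  by move=> hy; apply: hr; rewrite /ball /= ltr_distlC.
have FE y : t - r < y < t + r -> derive1 s y = F y.
  move=> /rball[yin sy]; rewrite stefan_condition // /F.
  by rewrite (@caputoE L (st y) y).
have cF y : t - r < y < t + r -> {for y, continuous F}.
  move=> yr; have [yin sy] := rball y yr.
  apply: cvgN; apply: cvgM; first exact: cvg_cst.
  apply/cvgrPdist_le => e e0; have /andP[y1 y2] := yr.
  pose lo := (t - r + y) / 2; pose hi := (t + r + y) / 2.
  have lo1 : t - r < lo by rewrite /lo; lra.
  have lo2 : lo < y by rewrite /lo; lra.
  have hi1 : y < hi by rewrite /hi; lra.
  have hi2 : hi < t + r by rewrite /hi; lra.
  have cv' (z q : R) : lo <= q <= hi -> {for (z, q), continuous (joint vt)}.
    move=> /andP[q1 q2]; have [|qin sq] := rball q; last exact: cvt.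
    by rewrite (lt_le_trans lo1 q1) (le_lt_trans q2).
  have [de de0 hde] := conv_uniform (st y - 1) (st y + 1) L0 ipow cv' e0.
  have near_st (d : R) : 0 < d -> \forall q \near y, `|st y - st q| < d.
    move=> d0; have h : {for y, continuous st} by exact: front_ext_continuous.
    by move: h => /cvgrPdist_lt; apply.
  near=> q; apply: hde.
  - by rewrite gerBl lerDl ler01.
  - by rewrite !ltW.
  - have : `|st y - st q| < 1 by near: q; exact: near_st.
    by rewrite ltr_distlC => /andP[q1 q2]; rewrite !ltW.
  - by apply/andP; split; apply/ltW; near: q; [exact: lt_nbhsr|exact: lt_nbhsl].
  - by near: q; exact: near_st.
  - by near: q; apply: filterS (nbhsx_ballx y _ de0).
have [_ [aes _]] := sol.
have tr : t - r < t < t + r by rewrite gtrBl r0 ltrDl.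
rewrite FE //; apply: (continuous_ae_ge0 cF) => //.
have [A [mA A0 hA]] := aes; exists A; split=> // y hy; apply: hA => /= {}aes; apply: hy.
rewrite /= in_itv /= => yr.
have [yin sy] := rball y yr; rewrite -FE //.
by have [|_ /andP[/ltW]] := aes; first by rewrite in_itv.
Unshelve. all: by end_near. Qed.

Let front_homo a b : 0 <= a -> a <= b -> b <= T -> st a <= st b.
Proof.
move=> a0; rewrite le_eqVlt => /orP[/eqP -> //|ab] bT.
have [||d + E] := @MVT _ st (derive1 s) a b ab.
- by move=> y; rewrite in_itv /= => /andP[y1 y2]; apply: dst; rewrite (le_lt_trans a0 y1) (lt_le_trans y2).
- by apply: continuous_at_within => y _; exact: front_ext_continuous.
rewrite in_itv /= => /andP[d1 d2]; rewrite -subr_ge0 E mulr_ge0 ?subr_ge0 ?(ltW ab) //.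
by apply: derive_front_ge0; rewrite (le_lt_trans a0 d1) (lt_le_trans d2).
Qed.

Let front_gt0 t : 0 < st t.
Proof.
have -> : st t = st (clamp 0 T t) by rewrite /front_ext [clamp 0 T (clamp 0 T t)]clamp_id.
have /andP[h0 h1] := cl t; apply: lt_le_trans (front_homo (lexx 0) h0 h1).
by rewrite st0.
Qed.

(** The condition is given on the open time interval and extends to both ends by continuity of the
    extension along the front; reversing time reduces the end T to the end 0. *)
Let front_trace t : 0 <= t <= T -> u (s t) t = 0.
Proof.
have [_ [_ [_ [_ [_ [_ [_ [_ [_ [us _]]]]]]]]]] := sol.
have E r : 0 <= r <= T -> u (s r) r = ut (st r) r.
  by move=> hr; rewrite ut_id ?lexx ?(ltW (front_gt0 r)) // front_ext_id.
have ch r : {for r, continuous (fun r => ut (st r) r)}.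
  apply: (@continuous_comp _ _ _ (fun r => (st r, r)) (joint ut)); last first.
    by apply: cut; exact: front_gt0.
  exact: (@cvg_pair R R R (nbhs r) (nbhs (st r)) (nbhs r) _ _ _ st id (front_ext_continuous (x := r)) cvg_id).
have h0 r : 0 < r < T -> ut (st r) r = 0.
  by move=> /[dup] hr /andP[r0 rT]; rewrite -E ?us // !ltW.
have ext (f : R -> R) : {for 0, continuous f} -> (forall r, 0 < r < T -> f r = 0) -> f 0 = 0.
  move=> cf f0; apply/eqP; rewrite eq_le; apply/andP; split.
    rewrite -oppr_ge0; apply: (@continuous_right_ge0 (fun x => - f x) T (cvgN cf) T0).
    by move=> a /f0 ->; rewrite oppr0.
  by apply: (continuous_right_ge0 cf T0) => a /f0 ->.
move=> /andP[t0 tT]; rewrite E ?t0 //.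
move: t0; rewrite le_eqVlt => /orP[/eqP <-|t0]; first exact: (ext _ (ch 0) h0).
move: tT; rewrite le_eqVlt => /orP[/eqP ->|tT]; last by rewrite h0 // t0.
have := ext (fun r => ut (st (T - r)) (T - r)); rewrite subr0; apply.
  apply: (@continuous_comp _ _ _ (fun r => T - r) (fun r => ut (st r) r)); last exact: ch.
  by apply: cvgB; [exact: cvg_cst|exact: cvg_id].
by move=> r /andP[r0 rT]; rewrite h0 // subr_gt0 rT gtrBl.
Qed.

Lemma stefan_extension (L Lam : R) : (forall x, 0 < x < b0 -> 0 <= u0 x) ->
  (forall t, st t <= L) -> (forall t1 t2, `|st t1 - st t2| <= Lam * `|t1 - t2|) ->
  stefan_solution T alpha c L Lam st ut vt.
Proof.
move=> u0_ge0 sL hLam.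
have [_ [_ [_ [der [cdt [_ [_ [_ [eqn [_ [_ [ic _]]]]]]]]]]]] := sol.
have inT t : 0 < t < T -> 0 <= t <= T by move=> /andP[t1 t2]; rewrite !ltW.
have nearT t : 0 < t < T -> \forall r \near t, 0 <= r <= T.
  by move=> /andP[t1 t2]; near=> r; apply/andP; split; apply/ltW; near: r; [exact: lt_nbhsr|exact: lt_nbhsl].
split.
- split.
  + by move=> x t; apply: cut; exact: front_gt0.
  + by move=> x t tin; apply: cvt => //; exact: front_gt0.
  + by move=> x t tin; apply: vt0 => //; exact: front_gt0.
  + exact: dut.
  exists (fun x t => derive1 (u x) t) => x t tin xin; have Q := insideW tin xin.
  have [d1 _ _ d4] := der _ Q; have /andP[x0 xs] := xin; split.
  + have D : is_derive t 1 (u x) (derive1 (u x) t) by rewrite derive1E; exact: derivableP.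
    refine (near_eq_is_derive _ D); have hT := nearT t tin.
    near=> r; rewrite ut_id //; first by near: r.
    rewrite (ltW x0) /=; apply/ltW; near: r.
    exact: near_above.
  + have D : is_derive x 1 (caputo alpha (u^~ t)) (derive1 (u x) t).
      have /eqP := eqn _ Q; rewrite subr_eq0 => /eqP /= ->; rewrite derive1E; exact: derivableP.
    refine (near_eq_is_derive _ D); near=> y.
    rewrite (@caputoE L) //; first by near: y; exact: lt_nbhsr.
    by apply/ltW; near: y; exact: lt_nbhsl.
  + suff : {for (x, t), continuous ((fun p : R * R => derive1 (u p.1) p.2) \o id)} by [].
    apply: (within_comp_continuous cdt); first exact: cvg_id.
    exact: near_inside.
- split; [by move=> t; rewrite front_gt0 sL|exact: front_ext_continuous|].
  move=> r t r0 rt tT; rewrite subr_ge0 front_homo ?(ltW r0) ?(ltW tT) //=.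
  by apply: (le_trans (ler_norm _)); rewrite -[t - r]ger0_norm ?subr_ge0.
- by move=> x t sx; rewrite /field_ext clamp_ge ?(ltW (front_gt0 t)) // front_trace.
- move=> x /[dup] xin /andP[x0 xs].
  rewrite ut_id ?lexx ?(ltW T0) ?(ltW x0) ?(ltW xs) //; rewrite st0 in xs.
  by rewrite ic ?u0_ge0 ?x0.
- move=> t tin; have := dst tin; rewrite stefan_condition //.
  by rewrite (@caputoE L) // front_gt0.
Unshelve. all: by end_near. Qed.

Lemma extension_bound : exists2 L : R, 0 < L & forall t, st t <= L.
Proof.
have [Lam Lam0 hLam] := extended_front_lipschitz.
exists (st T); first exact: front_gt0.
move=> t; have -> : st t = st (clamp 0 T t) by rewrite /front_ext [clamp 0 T (clamp 0 T t)]clamp_id.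
by have /andP[h0 h1] := cl t; exact: front_homo.
Qed.

(** The initial condition covers ]0, b0[; from b0 on, the value is the trace of u at the front at
    time 0. *)
Lemma extension_initial x : 0 < x -> ut x 0 = if x < b0 then u0 x else 0.
Proof.
move=> x0; have T1 : 0 <= (0 : R) <= T by rewrite lexx ltW.
have [_ [_ [_ [_ [_ [_ [_ [_ [_ [_ [_ [ic _]]]]]]]]]]]] := sol.
have [xb|bx] := ltP x b0.
  by rewrite ut_id ?ic ?x0 // st0 !ltW.
rewrite /field_ext st0 (clamp_ge (ltW b0_gt0) bx) (clamp_id T1) /=.
have s0E : s 0 = b0 by rewrite -st0 front_ext_id.
by rewrite -[X in u X]s0E front_trace.
Qed.

End Extension.

(** * Comparison of the given solutions *)

Lemma Gamma_ge0 (R : realType) (z : R) : 0 <= Gamma z.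
Proof. by apply: Rintegral_ge0 => x _; rewrite mulr_ge0 ?powR_ge0 ?expR_ge0. Qed.

Theorem theorem5 (R : realType) (T alpha b1 b2 M1 M2 : R)
    (u01 u02 : R -> R) (u1 u2 : R -> R -> R) (s1 s2 : R -> R) :
  0 < T -> 0 < alpha < 1 -> 0 < b1 -> 0 < b2 -> 0 < M1 -> 0 < M2 ->
  initial_datum alpha b1 M1 u01 -> initial_datum alpha b2 M2 u02 ->
  is_solution alpha T b1 M1 u01 u1 s1 ->
  is_solution alpha T b2 M2 u02 u2 s2 ->
  b1 <= b2 -> (forall x, 0 <= x <= b1 -> u01 x <= u02 x) ->
  forall t, 0 <= t <= T -> s1 t <= s2 t.
Proof.
move=> T0 al01 b10 b20 _ _ [_ [_ [_ [u01_ge0 _]]]] [_ [_ [_ [u02_ge0 _]]]] S1 S2 b12 u12.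
have [_ [_ [_ [_ [_ [_ [[v1 [cv1 [vE1 v10]]] [_ [_ [_ [s10 _]]]]]]]]]]] := S1.
have [_ [_ [_ [_ [_ [_ [[v2 [cv2 [vE2 v20]]] [_ [_ [_ [s20 _]]]]]]]]]]] := S2.
have [L1 L10 hL1] := extension_bound T0 al01 b10 S1 cv1 vE1 v10.
have [L2 L20 hL2] := extension_bound T0 al01 b20 S2 cv2 vE2 v20.
have [Lam1 Lam10 hLam1] := extended_front_lipschitz T0 S1.
have [Lam2 Lam20 hLam2] := extended_front_lipschitz T0 S2.
(* Both fluxes must use the same truncated kernel, so that their difference is the flux of the
   difference. *)
pose L := Num.max L1 L2; pose Lam := Num.max Lam1 Lam2.
have L0 : 0 < L by rewrite lt_max L10.
have Lam0 : 0 <= Lam by rewrite le_max Lam10.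
have c0 : 0 <= (Gamma (1 - alpha))^-1 :> R by rewrite invr_ge0 Gamma_ge0.
have in1 x : 0 < x < b1 -> 0 <= u01 x by move=> /andP[? ?]; apply: u01_ge0; rewrite !ltW.
have in2 x : 0 < x < b2 -> 0 <= u02 x by move=> /andP[? ?]; apply: u02_ge0; rewrite !ltW.
have hL1' r : front_ext T s1 r <= L by rewrite le_max hL1.
have hL2' r : front_ext T s2 r <= L by rewrite le_max hL2 orbT.
have hLam1' r q : `|front_ext T s1 r - front_ext T s1 q| <= Lam * `|r - q|.
  by rewrite (le_trans (hLam1 r q)) // ler_wpM2r // le_max lexx.
have hLam2' r q : `|front_ext T s2 r - front_ext T s2 q| <= Lam * `|r - q|.
  by rewrite (le_trans (hLam2 r q)) // ler_wpM2r // le_max lexx orbT.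
have E1 := stefan_extension T0 al01 b10 S1 cv1 vE1 v10 in1 hL1' hLam1'.
have E2 := stefan_extension T0 al01 b20 S2 cv2 vE2 v20 in2 hL2' hLam2'.
have T00 : 0 <= (0 : R) <= T by rewrite lexx ltW.
have comp := stefan_comparison al01 c0 L0 Lam0 E1 E2.
have {}comp : forall t, 0 < t < T -> front_ext T s1 t <= front_ext T s2 t.
  apply: comp; first by rewrite !front_ext_id // s10 s20.
  move=> x x0.
  rewrite (extension_initial T0 al01 b10 S1 cv1 vE1 v10 x0).
  rewrite (extension_initial T0 al01 b20 S2 cv2 vE2 v20 x0).
  (* Beyond b1 the first extended datum is 0, and the second is nonnegative. *)
  have [xb1|xb1] := ltP x b1.
    by rewrite (lt_le_trans xb1 b12); apply: u12; rewrite !ltW.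
  by case: ifP => // xb2; apply: in2; rewrite x0.
move=> t /[dup] tin /andP[t0 tT].
move: t0; rewrite le_eqVlt => /orP[/eqP <-|t0]; first by rewrite s10 s20.
rewrite -(front_ext_id s1 tin) -(front_ext_id s2 tin).
move: tT; rewrite le_eqVlt => /orP[/eqP ->|tT]; last by apply: comp; rewrite t0.
(* The comparison holds for t < T; the final time is its limit, taken at 0 after reversing time. *)
have := @continuous_right_ge0 R (fun r => front_ext T s2 (T - r) - front_ext T s1 (T - r)) T.
rewrite !subr0 subr_ge0; apply => //.
  have cT : {for 0, continuous (fun r : R => T - r)}.
    by apply: cvgB; [exact: cvg_cst|exact: cvg_id].
  apply: cvgB; [apply: (@continuous_comp _ _ _ (fun r : R => T - r) (front_ext T s2)) => //|
                apply: (@continuous_comp _ _ _ (fun r : R => T - r) (front_ext T s1)) => //].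
    exact: (front_ext_continuous T0 S2).
  exact: (front_ext_continuous T0 S1).
by move=> a /andP[a0 aT]; rewrite subr_ge0; apply: comp; rewrite subr_gt0 aT gtrBl.
Qed.
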